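(* Let $\mathfrak B$ be a locally full $2$-subcategory of $\mathrm{Lin}_{\mathbf k}$. The canonical strict $2$-functor $\mathfrak A\to\mathfrak A'$ induces an equivalence from the $2$-category of integrable $2$-representations of $\mathfrak A'$ in $\mathfrak B$ to the $2$-category of integrable $2$-representations of $\mathfrak A$ in $\mathfrak B$.
   Context: **Base ring and root datum.** $I$ is a finite set, $C=(a_{ij})_{i,j\in I}$ a Cartan matrix ($a_{ii}=2$; $a_{ij}\in\mathbb Z_{\le0}$ for $i\ne j$; $a_{ij}=0\iff a_{ji}=0$), $m_{ij}=-a_{ij}$. $\mathbf k=\mathbb Z[\{t_{i,j,r,s}\}\cup\{t_{ij}^{\pm1}\}]$ with indeterminates $t_{i,j,r,s}$ ($i\ne j$, $0\le r<m_{ij}$, $0\le s<m_{ji}$, $t_{j,i,s,r}=t_{i,j,r,s}$) and $t_{ij}$ ($i\neq j$, $t_{ij}=t_{ji}$ if $a_{ij}=0$). $Q_{ii}=0$; $Q_{ij}=t_{ij}$ if $a_{ij}=0$; $Q_{ij}(u,v)=t_{ij}u^{m_{ij}}+\sum_{0\le r<m_{ij},0\le s<m_{ji}}t_{i,j,r,s}u^rv^s+t_{ji}v^{m_{ji}}$ if $i\ne j$, $a_{ij}\neq0$. A root datum of type $C$ is fixed: finitely generated free abelian groups $X,Y$, a perfect pairing $\langle-,-\rangle:Y\times X\to\mathbb Z$, injections $i\mapsto\alpha_i\in X$, $i\mapsto\alpha_i^\vee\in Y$ with $\langle\alpha_i^\vee,\alpha_j\rangle=a_{ij}$. **The $2$-category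 $\mathfrak A$.** $\mathcal B$ is the free strict monoidal $\mathbf k$-linear category generated by objects $E_s$ ($s\in I$) and arrows $x_s:E_s\to E_s$, $\tau_{st}:E_sE_t\to E_tE_s$, with relations: $\tau_{st}\circ\tau_{ts}=Q_{st}(E_tx_s,x_tE_s)$; $\tau_{tu}E_s\circ E_t\tau_{su}\circ\tau_{st}E_u-E_u\tau_{st}\circ\tau_{su}E_t\circ E_s\tau_{tu}$ equals $\frac{Q_{st}(x_sE_t,E_sx_t)E_s-E_sQ_{st}(E_tx_s,x_tE_s)}{x_sE_tE_s-E_sE_tx_s}$ if $s=u$ and $0$ otherwise; $\tau_{st}\circ x_sE_t-E_tx_s\circ\tau_{st}=\delta_{st}$; $\tau_{st}\circ E_sx_t-x_tE_s\circ\tau_{st}=-\delta_{st}$. $\mathcal B_1$ is obtained from $\mathcal B$ by adding a right dual $F_s$ of each $E_s$, with counit $\varepsilon_s:E_sF_s\to\mathbf1$ and unit $\eta_s:\mathbf1\to F_sE_s$. Give $E_s$ weight $\alpha_s$ and $F_s$ weight $-\alpha_s$; $\mathfrak A_1$ is the strict $2$-category with set of objects $X$ and $\mathcal Hom(\lambda,\lambda')$ the full subcategory of $\mathcal B_1$ of objects of weight $\lambda'-\lambda$. Put $\sigma_{st}=(F_tE_s\varepsilon_t)\circ(F_t\tau_{ts}F_t)\circ(\eta_tE_sF_t):E_sF_t\to F_tE_s$. $\mathfrak A$ is obtained from $\mathfrak A_1$ by inverting the following $2$-arrows (direct sums are formed in the additive closure), with $n=\langle\alpha_s^\vee,\lambda\rangle$: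 if $n\ge0$, $\rho_{s,\lambda}:E_sF_s\mathbf1_\lambda\to F_sE_s\mathbf1_\lambda\oplus\mathbf1_\lambda^{n}$ with components $\sigma_{ss}$ and $\varepsilon_s\circ(x_s^iF_s)$, $0\le i<n$; if $n\le0$, $\rho_{s,\lambda}:E_sF_s\mathbf1_\lambda\oplus\mathbf1_\lambda^{-n}\to F_sE_s\mathbf1_\lambda$ with components $\sigma_{ss}$ and $(F_sx_s^i)\circ\eta_s$, $0\le i<-n$; and $\sigma_{st}:E_sF_t\mathbf1_\lambda\to F_tE_s\mathbf1_\lambda$ for all $s\ne t$ and all $\lambda$. **The $2$-category $\mathfrak A'$.** Define $\tilde\varepsilon_{s,\lambda}:F_sE_s\mathbf1_\lambda\to\mathbf1_\lambda$, with $n=\langle\alpha_s^\vee,\lambda\rangle$: if $n\ge0$, it is the unique $2$-arrow with $\tilde\varepsilon_{s,\lambda}\circ\sigma_{ss}\equiv(-1)^{n+1}\varepsilon_s\circ(x_s^nF_s)$ modulo $\bigoplus_{i=0}^{n-1}\mathrm{End}(\mathbf1_\lambda)\cdot\varepsilon_s\circ(x_s^iF_s)$; if $n<0$, it is the unique $2$-arrow with $\tilde\varepsilon_{s,\lambda}\circ\rho_{s,\lambda}=(0,\dots,0,(-1)^{n+1})$. $\mathfrak A^l$ is defined like $\mathfrak A$ but with $F_s$ both right dual and left dual of $E_s$ (additional counit $\varepsilon_s^l:F_sE_s\to\mathbf1$ and unit $\eta^l_s:\mathbf1\to E_sF_s$), and $\mathfrak A'$ is $\mathfrak A^l$ with the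 relations $\varepsilon^l_s=\tilde\varepsilon_s$ added. **$2$-representations.** $\mathrm{Lin}_{\mathbf k}$ is the $2$-category of $\mathbf k$-linear categories. A $2$-representation of $\mathfrak A$ (or $\mathfrak A'$) in $\mathfrak B$ is a $\mathbf k$-linear $2$-functor to $\mathfrak B$, $\lambda\mapsto\mathcal V_\lambda$; these form a $2$-category whose $1$-morphisms are pseudo-natural transformations (with invertible structure $2$-arrows) and whose $2$-morphisms are modifications. A $2$-representation is integrable if all $E_s,F_s$ are locally nilpotent (for every object $M$, $E_s^nM=0=F_s^nM$ for some $n$). *)

(* Defs.v *)
From HB Require Import structures.
From mathcomp Require Import all_boot all_order all_algebra.
From mathcomp Require Import generic_quotient fraction boolp.
From mathcomp Require Import mpoly.

Set Implicit Arguments.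
Unset Strict Implicit.
Unset Printing Implicit Defensive.

Import Order.TTheory GRing.Theory Num.Theory.
Local Open Scope ring_scope.
Local Open Scope quotient_scope.

Record cartan (I : finType) := Cartan {
  ca :> I -> I -> int;
  ca_diag : forall i, ca i i = 2;
  ca_off : forall i j, i != j -> ca i j <= 0;
  ca_zero : forall i j, ca i j = 0 <-> ca j i = 0
}.

(** [cm C i j] is [- a_ij] for [i != j]; it is only used for such pairs. *)
Definition cm (I : finType) (C : cartan I) (i j : I) : nat := `|C i j|%N.

Section BaseRing.
Variables (I : finType) (C : cartan I).

Let bnd := (\max_(p : I * I) cm C p.1 p.2)%N.

(** Names for the indeterminates.  [t_{i,j,r,s}] is named by the unordered pair
    [{(i,r), (j,s)}], which encodes [t_{j,i,s,r} = t_{i,j,r,s}]; [t_ij] is named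
    by the unordered pair [{i,j}] when [a_ij = 0] and by [(i,j)] otherwise. *)
Definition tname := ({set I * 'I_bnd.+1} + ({set I} + I * I))%type.

Definition t4name (i j : I) (r s : nat) : tname :=
  inl [set (i, inord r); (j, inord s)].

Definition t2name (i j : I) : tname :=
  inr (if C i j == 0 then inl [set i; j] else inr (i, j)).

Definition tfield := {fraction {mpoly int[#|{: tname}|]}}.

Definition tvar (v : tname) : tfield := tofrac ('X_(enum_rank v)).

(** The base ring is the subring of the field of rational functions generated
    by the [t_{i,j,r,s}], the [t_ij] and the [t_ij^-1]. *)
Definition kgen (x : tfield) : Prop :=
  (exists i j (r : 'I_(cm C i j)) (s : 'I_(cm C j i)),
      i != j /\ x = tvar (t4name i j r s)) \/
  (exists i j, i != j /\ (x = tvar (t2name i j) \/ x = (tvar (t2name i j))^-1)).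

Definition kpred : {pred tfield} := fun x =>
  `[< forall S : {pred tfield}, subring_closed S ->
        (forall y, kgen y -> y \in S) -> x \in S >].

Lemma kpred_subring : subring_closed kpred.
Proof.
split.
- by apply/asboolP => S [S1 _ _] _.
- move=> x y /asboolP hx /asboolP hy; apply/asboolP => S cS gS.
  by case: (cS) => _ + _; apply; [apply: hx|apply: hy].
- move=> x y /asboolP hx /asboolP hy; apply/asboolP => S cS gS.
  by case: (cS) => _ _; apply; [apply: hx|apply: hy].
Qed.
HB.instance Definition _ := GRing.isSubringClosed.Build tfield kpred
  kpred_subring.

Record kring := Kring { kval :> tfield; kvalP : kval \in kpred }.
HB.instance Definition _ := [isSub for kval].
HB.instance Definition _ := [Choice of kring by <:].
HB.instance Definition _ := [SubChoice_isSubComNzRing of kring by <:].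

Definition kbase : comNzRingType := kring.

Lemma kgen_in x : kgen x -> x \in kpred.
Proof. by move=> gx; apply/asboolP => S _; apply. Qed.

(** The indeterminates as elements of [kring]; the default value of [insubd]
    only occurs for pairs [i = j], see [val_t4] and [val_t2]. *)
Definition t4 (i j : I) (r s : nat) : kbase := insubd (0 : kring) (tvar (t4name i j r s)).
Definition t2 (i j : I) : kbase := insubd (0 : kring) (tvar (t2name i j)).

Lemma val_t4 i j (r : 'I_(cm C i j)) (s : 'I_(cm C j i)) :
  i != j -> val (t4 i j r s) = tvar (t4name i j r s).
Proof.
move=> ij; rewrite insubdK //; apply: kgen_in; left.
by exists i, j, r, s.
Qed.

Lemma val_t2 i j : i != j -> val (t2 i j) = tvar (t2name i j).
Proof.
by move=> ij; rewrite insubdK //; apply: kgen_in; right; exists i, j; split=> //; left.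
Qed.

(** [Q_ij(u,v)] as an element of [k[v][u]]: the outer variable is [u], the inner
    one is [v]. *)
Definition Qpol (i j : I) : {poly {poly kbase}} :=
  if i == j then 0
  else if C i j == 0 then (t2 i j)%:P%:P
  else (t2 i j)%:P *: 'X^(cm C i j)
       + \sum_(r < cm C i j) \sum_(s < cm C j i)
           (t4 i j r s *: 'X^s) *: 'X^r
       + (t2 j i *: 'X^(cm C j i))%:P.

End BaseRing.

(** The finitely generated free abelian groups are those isomorphic to some
    [Z^n]. *)
Definition fg_free (A : zmodType) : Prop :=
  exists (n : nat) (f : {additive A -> 'rV[int]_n}), bijective f.

Record root_datum (I : finType) (C : cartan I) (X Y : zmodType) := RootDatum {
  rd_freeX : fg_free X;
  rd_freeY : fg_free Y;
  pairing : Y -> X -> int;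
  pairingDl : forall x y y', pairing (y + y') x = pairing y x + pairing y' x;
  pairingDr : forall y x x', pairing y (x + x') = pairing y x + pairing y x';
  pairing_perfectX : forall f : {additive X -> int},
    exists! y, forall x, f x = pairing y x;
  pairing_perfectY : forall f : {additive Y -> int},
    exists! x, forall y, f y = pairing y x;
  sroot : I -> X;
  scoroot : I -> Y;
  sroot_inj : injective sroot;
  scoroot_inj : injective scoroot;
  pairing_cartan : forall i j, pairing (scoroot i) (sroot j) = C i j
}.

Record cat1 := Cat1 {
  ob :> Type;
  hom1 : ob -> ob -> Type;
  one : forall a, hom1 a a;
  cmp : forall a b c, hom1 b c -> hom1 a b -> hom1 a c;
  cmpA : forall a b c d (h : hom1 c d) (g : hom1 b c) (f : hom1 a b),
    cmp h (cmp g f) = cmp (cmp h g) f;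
  cmp1l : forall a b (f : hom1 a b), cmp (one b) f = f;
  cmp1r : forall a b (f : hom1 a b), cmp f (one a) = f
}.
Arguments hom1 {c} _ _ : rename.
Arguments one {c} a : rename.

(** The arrow [f -> g] given by an equality [f = g]. *)
Definition castid (T : Type) (H : T -> T -> Type) (i : forall f, H f f)
  (f g : T) (e : f = g) : H f g :=
  match e in _ = g' return H f g' with erefl => i f end.

Section Lin2.
Variable (k : comNzRingType).

(** A strict [k]-linear 2-category with given objects and 1-arrows.  As
    composition of 1-arrows is associative only up to propositional equality,
    strict associativity and unitality of horizontal composition are expressed
    with the identity 2-arrows [castid] attached to these equalities. *)
Record lin2 (C : cat1) := Lin2 {
  hom2 : forall a b : C, hom1 a b -> hom1 a b -> lmodType k;
  id2 : forall (a b : C) (f : hom1 a b), hom2 f f;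
  vcmp : forall (a b : C) (f g h : hom1 a b), hom2 g h -> hom2 f g -> hom2 f h;
  hcmp : forall (a b c : C) (g g' : hom1 b c) (f f' : hom1 a b),
    hom2 g g' -> hom2 f f' -> hom2 (cmp g f) (cmp g' f');
  vcmpA : forall (a b : C) (f g h i : hom1 a b)
    (w : hom2 h i) (v : hom2 g h) (u : hom2 f g),
    vcmp w (vcmp v u) = vcmp (vcmp w v) u;
  vcmp1l : forall (a b : C) (f g : hom1 a b) (u : hom2 f g),
    vcmp (id2 g) u = u;
  vcmp1r : forall (a b : C) (f g : hom1 a b) (u : hom2 f g),
    vcmp u (id2 f) = u;
  vcmp_linl : forall (a b : C) (f g h : hom1 a b) (u : hom2 f g),
    linear (fun v : hom2 g h => vcmp v u);
  vcmp_linr : forall (a b : C) (f g h : hom1 a b) (v : hom2 g h),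
    linear (fun u : hom2 f g => vcmp v u);
  hcmp_linl : forall (a b c : C) (g g' : hom1 b c) (f f' : hom1 a b)
    (u : hom2 f f'), linear (fun v : hom2 g g' => hcmp v u);
  hcmp_linr : forall (a b c : C) (g g' : hom1 b c) (f f' : hom1 a b)
    (v : hom2 g g'), linear (fun u : hom2 f f' => hcmp v u);
  hcmp_id : forall (a b c : C) (g : hom1 b c) (f : hom1 a b),
    hcmp (id2 g) (id2 f) = id2 (cmp g f);
  interchange : forall (a b c : C) (g g' g'' : hom1 b c) (f f' f'' : hom1 a b)
    (v' : hom2 g' g'') (v : hom2 g g') (u' : hom2 f' f'') (u : hom2 f f'),
    hcmp (vcmp v' v) (vcmp u' u) = vcmp (hcmp v' u') (hcmp v u);
  hcmpA : forall (a b c d : C) (h h' : hom1 c d) (g g' : hom1 b c)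
    (f f' : hom1 a b) (w : hom2 h h') (v : hom2 g g') (u : hom2 f f'),
    vcmp (castid (H := fun p q => hom2 p q) (@id2 a d) (cmpA h' g' f')) (hcmp w (hcmp v u))
    = vcmp (hcmp (hcmp w v) u) (castid (H := fun p q => hom2 p q) (@id2 a d) (cmpA h g f));
  hcmp1l : forall (a b : C) (f f' : hom1 a b) (u : hom2 f f'),
    vcmp (castid (H := fun p q => hom2 p q) (@id2 a b) (cmp1l f')) (hcmp (id2 (one b)) u)
    = vcmp u (castid (H := fun p q => hom2 p q) (@id2 a b) (cmp1l f));
  hcmp1r : forall (a b : C) (f f' : hom1 a b) (u : hom2 f f'),
    vcmp (castid (H := fun p q => hom2 p q) (@id2 a b) (cmp1r f')) (hcmp u (id2 (one a)))
    = vcmp u (castid (H := fun p q => hom2 p q) (@id2 a b) (cmp1r f))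
}.

Arguments id2 {C} A {a b} f : rename.

Definition idto (C : cat1) (A : lin2 C) (a b : C) (f g : hom1 a b) (e : f = g) :
  hom2 A f g := castid (H := fun p q => hom2 A p q) (@id2 C A a b) e.

Definition pow2 (C : cat1) (A : lin2 C) (a b : C) (f : hom1 a b)
  (u : hom2 A f f) (n : nat) : hom2 A f f := iter n (vcmp u) (id2 A f).

(** Strict [k]-linear 2-functors that are the identity on objects and
    1-arrows. *)
Record lin2fun (C : cat1) (A A' : lin2 C) := Lin2fun {
  fun2 : forall (a b : C) (f g : hom1 a b), hom2 A f g -> hom2 A' f g;
  fun2_lin : forall (a b : C) (f g : hom1 a b), linear (@fun2 a b f g);
  fun2_id : forall (a b : C) (f : hom1 a b), fun2 (id2 A f) = id2 A' f;
  fun2_vcmp : forall (a b : C) (f g h : hom1 a b)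
    (v : hom2 A g h) (u : hom2 A f g),
    fun2 (vcmp v u) = vcmp (fun2 v) (fun2 u);
  fun2_hcmp : forall (a b c : C) (g g' : hom1 b c) (f f' : hom1 a b)
    (v : hom2 A g g') (u : hom2 A f f'),
    fun2 (hcmp v u) = hcmp (fun2 v) (fun2 u)
}.

Lemma fun2_idto (C : cat1) (A A' : lin2 C) (F : lin2fun A A') (a b : C)
  (f g : hom1 a b) (e : f = g) : fun2 F (idto A e) = idto A' e.
Proof. by case: _ / e; apply: fun2_id. Qed.

Lemma fun2_0 (C : cat1) (A A' : lin2 C) (F : lin2fun A A') (a b : C)
  (f g : hom1 a b) : fun2 F (0 : hom2 A f g) = 0.
Proof.
have := fun2_lin F (-1) (0 : hom2 A f g) 0.
by rewrite scaler0 addr0 scaleN1r addNr.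
Qed.

Lemma fun2_pow (C : cat1) (A A' : lin2 C) (F : lin2fun A A') (a b : C)
  (f : hom1 a b) (u : hom2 A f f) n : fun2 F (pow2 u n) = pow2 (fun2 F u) n.
Proof.
by elim: n => [|n IH] /=; rewrite ?fun2_id // fun2_vcmp IH.
Qed.

Definition lin2fun_comp (C : cat1) (A A' A'' : lin2 C) (G : lin2fun A' A'')
  (F : lin2fun A A') : lin2fun A A''.
Proof.
apply: (@Lin2fun _ _ _ (fun a b f g u => fun2 G (fun2 F u))).
- by move=> a b f g c u v; rewrite !fun2_lin.
- by move=> *; rewrite !fun2_id.
- by move=> *; rewrite !fun2_vcmp.
- by move=> *; rewrite !fun2_hcmp.
Defined.

Section Presentation.
Variable C : cat1.

Inductive term (G : forall a b : C, hom1 a b -> hom1 a b -> Type) :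
    forall a b : C, hom1 a b -> hom1 a b -> Type :=
| tgen a b (f g : hom1 a b) of G a b f g : term G f g
| tid a b (f : hom1 a b) : term G f f
| tvc a b (f g h : hom1 a b) of term G g h & term G f g : term G f h
| thc a b c (g g' : hom1 b c) (f f' : hom1 a b) of term G g g' & term G f f' :
    term G (cmp g f) (cmp g' f')
| tzero a b (f g : hom1 a b) : term G f g
| tadd a b (f g : hom1 a b) of term G f g & term G f g : term G f g
| tscale a b (f g : hom1 a b) of k & term G f g : term G f g.

Arguments tid {G a b} f.
Arguments tzero {G a b} f g.

Section Congruence.
Variable G : forall a b : C, hom1 a b -> hom1 a b -> Type.
Variable R : forall (a b : C) (f g : hom1 a b), term G f g -> term G f g -> Prop.

(** The smallest congruence containing [R] for which the axioms of a strict
    [k]-linear 2-category hold. *)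
Inductive eqt : forall (a b : C) (f g : hom1 a b),
    term G f g -> term G f g -> Prop :=
| eqt_rel a b (f g : hom1 a b) (t t' : term G f g) of R t t' : eqt t t'
| eqt_refl a b (f g : hom1 a b) (t : term G f g) : eqt t t
| eqt_sym a b (f g : hom1 a b) (t t' : term G f g) of eqt t t' : eqt t' t
| eqt_trans a b (f g : hom1 a b) (t t' t'' : term G f g) of
    eqt t t' & eqt t' t'' : eqt t t''
| eqt_vc a b (f g h : hom1 a b) (v v' : term G g h) (u u' : term G f g) of
    eqt v v' & eqt u u' : eqt (tvc v u) (tvc v' u')
| eqt_hc a b c (g g' : hom1 b c) (f f' : hom1 a b) (v v' : term G g g')
    (u u' : term G f f') of eqt v v' & eqt u u' : eqt (thc v u) (thc v' u')
| eqt_add a b (f g : hom1 a b) (t t' u u' : term G f g) of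
    eqt t t' & eqt u u' : eqt (tadd t u) (tadd t' u')
| eqt_scale a b (f g : hom1 a b) x (t t' : term G f g) of
    eqt t t' : eqt (tscale x t) (tscale x t')
| eqt_addA a b (f g : hom1 a b) (t u v : term G f g) :
    eqt (tadd t (tadd u v)) (tadd (tadd t u) v)
| eqt_addC a b (f g : hom1 a b) (t u : term G f g) : eqt (tadd t u) (tadd u t)
| eqt_add0 a b (f g : hom1 a b) (t : term G f g) : eqt (tadd (tzero f g) t) t
| eqt_scale0 a b (f g : hom1 a b) (t : term G f g) :
    eqt (tscale 0 t) (tzero f g)
| eqt_scale1 a b (f g : hom1 a b) (t : term G f g) : eqt (tscale 1 t) t
| eqt_scaleA a b (f g : hom1 a b) x y (t : term G f g) :
    eqt (tscale x (tscale y t)) (tscale (x * y) t)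
| eqt_scaleDr a b (f g : hom1 a b) x (t u : term G f g) :
    eqt (tscale x (tadd t u)) (tadd (tscale x t) (tscale x u))
| eqt_scaleDl a b (f g : hom1 a b) x y (t : term G f g) :
    eqt (tscale (x + y) t) (tadd (tscale x t) (tscale y t))
| eqt_vcA a b (f g h i : hom1 a b) (w : term G h i) (v : term G g h)
    (u : term G f g) : eqt (tvc w (tvc v u)) (tvc (tvc w v) u)
| eqt_vc1l a b (f g : hom1 a b) (u : term G f g) : eqt (tvc (tid g) u) u
| eqt_vc1r a b (f g : hom1 a b) (u : term G f g) : eqt (tvc u (tid f)) u
| eqt_vc_linl a b (f g h : hom1 a b) x (v v' : term G g h) (u : term G f g) :
    eqt (tvc (tadd (tscale x v) v') u) (tadd (tscale x (tvc v u)) (tvc v' u))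
| eqt_vc_linr a b (f g h : hom1 a b) x (v : term G g h) (u u' : term G f g) :
    eqt (tvc v (tadd (tscale x u) u')) (tadd (tscale x (tvc v u)) (tvc v u'))
| eqt_hc_linl a b c (g g' : hom1 b c) (f f' : hom1 a b) x
    (v v' : term G g g') (u : term G f f') :
    eqt (thc (tadd (tscale x v) v') u) (tadd (tscale x (thc v u)) (thc v' u))
| eqt_hc_linr a b c (g g' : hom1 b c) (f f' : hom1 a b) x
    (v : term G g g') (u u' : term G f f') :
    eqt (thc v (tadd (tscale x u) u')) (tadd (tscale x (thc v u)) (thc v u'))
| eqt_hc_id a b c (g : hom1 b c) (f : hom1 a b) :
    eqt (thc (tid g) (tid f)) (tid (cmp g f))
| eqt_interchange a b c (g g' g'' : hom1 b c) (f f' f'' : hom1 a b)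
    (v' : term G g' g'') (v : term G g g') (u' : term G f' f'')
    (u : term G f f') :
    eqt (thc (tvc v' v) (tvc u' u)) (tvc (thc v' u') (thc v u))
| eqt_hcA a b c d (h h' : hom1 c d) (g g' : hom1 b c) (f f' : hom1 a b)
    (w : term G h h') (v : term G g g') (u : term G f f') :
    eqt (tvc (castid (@tid G a d) (cmpA h' g' f')) (thc w (thc v u)))
        (tvc (thc (thc w v) u) (castid (@tid G a d) (cmpA h g f)))
| eqt_hc1l a b (f f' : hom1 a b) (u : term G f f') :
    eqt (tvc (castid (@tid G a b) (cmp1l f')) (thc (tid (one b)) u))
        (tvc u (castid (@tid G a b) (cmp1l f)))
| eqt_hc1r a b (f f' : hom1 a b) (u : term G f f') :
    eqt (tvc (castid (@tid G a b) (cmp1r f')) (thc u (tid (one a))))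
        (tvc u (castid (@tid G a b) (cmp1r f))).

HB.instance Definition _ a b (f g : hom1 a b) := gen_eqMixin (term G f g).
HB.instance Definition _ a b (f g : hom1 a b) := gen_choiceMixin (term G f g).

Section Hom2.
Variables (a b : C) (f g : hom1 a b).

Definition eqtb (t u : term G f g) : bool := `[< eqt t u >].

Lemma eqtb_refl : reflexive eqtb.
Proof. by move=> t; apply/asboolP; apply: eqt_refl. Qed.
Lemma eqtb_sym : ssrbool.symmetric eqtb.
Proof. by move=> t u; apply/asboolP/asboolP; apply: eqt_sym. Qed.
Lemma eqtb_trans : transitive eqtb.
Proof.
by move=> t u v /asboolP h /asboolP h'; apply/asboolP; apply: eqt_trans h h'.
Qed.

Canonical eqt_equiv := EquivRel eqtb eqtb_refl eqtb_sym eqtb_trans.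

Definition phom := {eq_quot eqt_equiv}.
HB.instance Definition _ := Choice.on phom.
HB.instance Definition _ := EqQuotient.on phom.

Definition cls (t : term G f g) : phom := \pi_phom t.

Lemma phomP (t u : term G f g) : cls t = cls u <-> eqt t u.
Proof.
rewrite /cls; split; first by move=> /eqmodP /asboolP.
by move=> h; apply/eqmodP/asboolP.
Qed.

Lemma repr_pi (t : term G f g) : eqt (repr (cls t)) t.
Proof. by apply/phomP; rewrite /cls reprK. Qed.

Definition ph_add (t u : phom) : phom := cls (tadd (repr t) (repr u)).
Definition ph_opp (t : phom) : phom := cls (tscale (-1) (repr t)).
Definition ph_scale x (t : phom) : phom := cls (tscale x (repr t)).
Definition ph_zero : phom := cls (tzero f g).

Lemma pi_add t u : cls (tadd t u) = ph_add (cls t) (cls u).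
Proof.
by apply/phomP; apply: eqt_add; apply: eqt_sym; apply: repr_pi.
Qed.
Lemma pi_scale x t : cls (tscale x t) = ph_scale x (cls t).
Proof. by apply/phomP; apply: eqt_scale; apply: eqt_sym; apply: repr_pi. Qed.

Lemma ph_ind (P : phom -> Prop) : (forall t, P (cls t)) -> forall x, P x.
Proof. by move=> h x; rewrite -[x]reprK; apply: h. Qed.

Lemma ph_addA : associative ph_add.
Proof.
elim/ph_ind=> x; elim/ph_ind=> y; elim/ph_ind=> z.
by rewrite -!pi_add; apply/phomP/eqt_addA.
Qed.
Lemma ph_addC : commutative ph_add.
Proof.
by elim/ph_ind=> x; elim/ph_ind=> y; rewrite -!pi_add; apply/phomP/eqt_addC.
Qed.
Lemma ph_add0 : left_id ph_zero ph_add.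
Proof. by elim/ph_ind=> x; rewrite -!pi_add; apply/phomP/eqt_add0. Qed.
Lemma ph_addN : left_inverse ph_zero ph_opp ph_add.
Proof.
elim/ph_ind=> x; rewrite -[ph_opp _]/(ph_scale _ _) -pi_scale -pi_add.
apply/phomP; apply: eqt_trans (eqt_scale0 x).
rewrite -[0](addNr 1); apply: eqt_trans (eqt_sym (eqt_scaleDl _ _ _)).
by apply: eqt_add; [apply: eqt_refl | apply/eqt_sym/eqt_scale1].
Qed.
HB.instance Definition _ :=
  GRing.isZmodule.Build phom ph_addA ph_addC ph_add0 ph_addN.

Lemma ph_scaleA x y (v : phom) :
  ph_scale x (ph_scale y v) = ph_scale (x * y) v.
Proof.
by elim/ph_ind: v => t; rewrite -!pi_scale; apply/phomP/eqt_scaleA.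
Qed.
Lemma ph_scale1 : left_id 1 ph_scale.
Proof. by elim/ph_ind=> t; rewrite -!pi_scale; apply/phomP/eqt_scale1. Qed.
Lemma ph_scaleDr : right_distributive ph_scale +%R.
Proof.
move=> x; elim/ph_ind=> t; elim/ph_ind=> u.
by rewrite -[_ + _]pi_add -[RHS]/(ph_add _ _) -!pi_scale -pi_add;
  apply/phomP/eqt_scaleDr.
Qed.
Lemma ph_scaleDl v : {morph ph_scale^~ v : x y / x + y}.
Proof.
move=> x y; elim/ph_ind: v => t.
by rewrite -[RHS]/(ph_add _ _) -!pi_scale -pi_add; apply/phomP/eqt_scaleDl.
Qed.
HB.instance Definition _ := GRing.Zmodule_isLmodule.Build k phom
  ph_scaleA ph_scale1 ph_scaleDr ph_scaleDl.

Lemma pi_lin x (t u : term G f g) :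
  x *: cls t + cls u = cls (tadd (tscale x t) u).
Proof. by rewrite pi_add pi_scale. Qed.

End Hom2.

Definition ph_id a b (f : hom1 a b) : phom f f := cls (tid f).
Definition ph_vc a b (f g h : hom1 a b) (v : phom g h) (u : phom f g) :
  phom f h := cls (tvc (repr v) (repr u)).
Definition ph_hc a b c (g g' : hom1 b c) (f f' : hom1 a b)
  (v : phom g g') (u : phom f f') : phom (cmp g f) (cmp g' f') :=
  cls (thc (repr v) (repr u)).

Lemma pi_vc a b (f g h : hom1 a b) (v : term G g h) (u : term G f g) :
  ph_vc (cls v) (cls u) = cls (tvc v u).
Proof. by apply/phomP; apply: eqt_vc; apply: repr_pi. Qed.
Lemma pi_hc a b c (g g' : hom1 b c) (f f' : hom1 a b) (v : term G g g')
  (u : term G f f') : ph_hc (cls v) (cls u) = cls (thc v u).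
Proof. by apply/phomP; apply: eqt_hc; apply: repr_pi. Qed.
Lemma pi_castid a b (f g : hom1 a b) (e : f = g) :
  castid (@ph_id a b) e = cls (castid (@tid G a b) e).
Proof. by case: _ / e. Qed.

(** The strict [k]-linear 2-category with generating 2-arrows [G] and
    relations [R]. *)
Definition presented : lin2 C.
Proof.
apply: (@Lin2 C (fun a b f g => phom f g : lmodType k) ph_id ph_vc ph_hc).
- move=> a b f g h i; elim/ph_ind=> w; elim/ph_ind=> v; elim/ph_ind=> u.
  by rewrite !pi_vc; apply/phomP/eqt_vcA.
- by move=> a b f g; elim/ph_ind=> u; rewrite pi_vc; apply/phomP/eqt_vc1l.
- by move=> a b f g; elim/ph_ind=> u; rewrite pi_vc; apply/phomP/eqt_vc1r.
- move=> a b f g h; elim/ph_ind=> u x; elim/ph_ind=> v; elim/ph_ind=> v'.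
  by rewrite pi_lin !pi_vc pi_lin; apply/phomP/eqt_vc_linl.
- move=> a b f g h; elim/ph_ind=> u x; elim/ph_ind=> v; elim/ph_ind=> v'.
  by rewrite pi_lin !pi_vc pi_lin; apply/phomP/eqt_vc_linr.
- move=> a b c g g' f f'; elim/ph_ind=> u x; elim/ph_ind=> v; elim/ph_ind=> v'.
  by rewrite pi_lin !pi_hc pi_lin; apply/phomP/eqt_hc_linl.
- move=> a b c g g' f f'; elim/ph_ind=> u x; elim/ph_ind=> v; elim/ph_ind=> v'.
  by rewrite pi_lin !pi_hc pi_lin; apply/phomP/eqt_hc_linr.
- by move=> a b c g f; rewrite pi_hc; apply/phomP/eqt_hc_id.
- move=> a b c g g' g'' f f' f''.
  elim/ph_ind=> v'; elim/ph_ind=> v; elim/ph_ind=> u'; elim/ph_ind=> u.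
  by rewrite !(pi_vc, pi_hc); apply/phomP/eqt_interchange.
- move=> a b c d h h' g g' f f'.
  elim/ph_ind=> w; elim/ph_ind=> v; elim/ph_ind=> u.
  by rewrite !(pi_castid, pi_vc, pi_hc); apply/phomP/eqt_hcA.
- move=> a b f f'; elim/ph_ind=> u.
  by rewrite !pi_castid /ph_id pi_hc !pi_vc; apply/phomP/eqt_hc1l.
- move=> a b f f'; elim/ph_ind=> u.
  by rewrite !pi_castid /ph_id pi_hc !pi_vc; apply/phomP/eqt_hc1r.
Defined.

Definition inj2 (a b : C) (f g : hom1 a b) (x : G f g) :
  hom2 presented f g := cls (tgen x).

End Congruence.

Section Universal.
Variables (G : forall a b : C, hom1 a b -> hom1 a b -> Type) (A : lin2 C).
Variable (i : forall (a b : C) (f g : hom1 a b), G f g -> hom2 A f g).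

Fixpoint eval (a b : C) (f g : hom1 a b) (t : term G f g) : hom2 A f g :=
  match t in @term _ a b f g return hom2 A f g with
  | tgen _ _ _ _ x => i x
  | tid _ _ f => id2 A f
  | tvc _ _ _ _ _ v u => vcmp (eval v) (eval u)
  | thc _ _ _ _ _ _ _ v u => hcmp (eval v) (eval u)
  | tzero _ _ _ _ => 0
  | tadd _ _ _ _ t u => eval t + eval u
  | tscale _ _ _ _ x t => x *: eval t
  end.

Lemma eval_castid a b (f g : hom1 a b) (e : f = g) :
  eval (castid (@tid G a b) e) = castid (H := fun p q => hom2 A p q) (@id2 C A a b) e.
Proof. by case: _ / e. Qed.

Variable R : forall (a b : C) (f g : hom1 a b), term G f g -> term G f g -> Prop.
Hypothesis Ri : forall (a b : C) (f g : hom1 a b) (t u : term G f g),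
  R t u -> eval t = eval u.

Lemma eval_eqt (a b : C) (f g : hom1 a b) (t u : term G f g) :
  eqt R t u -> eval t = eval u.
Proof.
elim=> {a b f g t u} //=.
- by move=> ? ? ? ? ? ? ? _ -> _ ->.
- by move=> ? ? ? ? ? ? ? ? ? _ -> _ ->.
- by move=> ? ? ? ? ? ? ? ? ? ? ? _ -> _ ->.
- by move=> ? ? ? ? ? ? ? ? _ -> _ ->.
- by move=> ? ? ? ? ? ? ? _ ->.
- by move=> *; rewrite addrA.
- by move=> *; rewrite addrC.
- by move=> *; rewrite add0r.
- by move=> *; rewrite scale0r.
- by move=> *; rewrite scale1r.
- by move=> *; rewrite scalerA.
- by move=> *; rewrite scalerDr.
- by move=> *; rewrite scalerDl.
- by move=> *; rewrite vcmpA.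
- by move=> *; rewrite vcmp1l.
- by move=> *; rewrite vcmp1r.
- by move=> *; rewrite vcmp_linl.
- by move=> *; rewrite vcmp_linr.
- by move=> *; rewrite hcmp_linl.
- by move=> *; rewrite hcmp_linr.
- by move=> *; rewrite hcmp_id.
- by move=> *; rewrite interchange.
- by move=> *; rewrite !eval_castid hcmpA.
- by move=> *; rewrite !eval_castid hcmp1l.
- by move=> *; rewrite !eval_castid hcmp1r.
Qed.

Lemma eval_repr a b (f g : hom1 a b) (t : term G f g) :
  eval (repr (cls R t)) = eval t.
Proof. by apply: eval_eqt; apply: repr_pi. Qed.

Definition presented_lift : lin2fun (presented R) A.
Proof.
apply: (@Lin2fun C (presented R) A (fun a b f g (u : phom R f g) => eval (repr u))).
- move=> a b f g x; elim/ph_ind=> t; elim/ph_ind=> u.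
  by rewrite pi_lin !eval_repr.
- by move=> a b f; rewrite eval_repr.
- move=> a b f g h; elim/ph_ind=> v; elim/ph_ind=> u.
  by rewrite [vcmp _ _]pi_vc !eval_repr.
- move=> a b c g g' f f'; elim/ph_ind=> v; elim/ph_ind=> u.
  by rewrite [hcmp _ _]pi_hc !eval_repr.
Defined.

Lemma presented_liftE a b (f g : hom1 a b) (t : term G f g) :
  fun2 presented_lift (cls R t : hom2 (presented R) f g) = eval t.
Proof. exact: eval_repr. Qed.

End Universal.

Lemma eval_inj2 (G : forall a b : C, hom1 a b -> hom1 a b -> Type)
  (R : forall (a b : C) (f g : hom1 a b), term G f g -> term G f g -> Prop)
  (a b : C) (f g : hom1 a b) (t : term G f g) :
  eval (A := presented R) (inj2 R) t = cls R t.
Proof.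
elim: t => {a b f g} //=.
- by move=> a b f g h v -> u ->; rewrite [LHS]pi_vc.
- by move=> a b c g g' f f' v -> u ->; rewrite [LHS]pi_hc.
- by move=> a b f g t -> u ->; rewrite pi_add.
- by move=> a b f g x t ->; rewrite pi_scale.
Qed.

Lemma eval_rel (G : forall a b : C, hom1 a b -> hom1 a b -> Type)
  (R : forall (a b : C) (f g : hom1 a b), term G f g -> term G f g -> Prop)
  (a b : C) (f g : hom1 a b) (t u : term G f g) :
  R a b f g t u ->
  eval (A := presented R) (inj2 R) t = eval (A := presented R) (inj2 R) u.
Proof. by move=> Rtu; rewrite !eval_inj2; apply/phomP/eqt_rel. Qed.

End Presentation.

End Lin2.

Arguments id2 {k C} A {a b} f : rename.
Arguments tid {k C G a b} f.
Arguments tzero {k C G a b} f g.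

Section Extensions.
Variables (k : comNzRingType) (C : cat1) (A : lin2 k C).

(** The relations expressing that [inc] is a [k]-linear 2-functor. *)
Inductive inc_rel (G : forall a b : C, hom1 a b -> hom1 a b -> Type)
  (inc : forall (a b : C) (f g : hom1 a b), hom2 A f g -> G a b f g) :
  forall (a b : C) (f g : hom1 a b), term k G f g -> term k G f g -> Prop :=
| inc_lin a b (f g : hom1 a b) x (u v : hom2 A f g) :
    inc_rel inc (tgen k (inc _ _ _ _ (x *: u + v)))
      (tadd (tscale x (tgen k (inc _ _ _ _ u))) (tgen k (inc _ _ _ _ v)))
| inc_id a b (f : hom1 a b) :
    inc_rel inc (tgen k (inc _ _ _ _ (id2 A f))) (tid f)
| inc_vcmp a b (f g h : hom1 a b) (v : hom2 A g h) (u : hom2 A f g) :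
    inc_rel inc (tgen k (inc _ _ _ _ (vcmp v u)))
      (tvc (tgen k (inc _ _ _ _ v)) (tgen k (inc _ _ _ _ u)))
| inc_hcmp a b c (g g' : hom1 b c) (f f' : hom1 a b)
    (v : hom2 A g g') (u : hom2 A f f') :
    inc_rel inc (tgen k (inc _ _ _ _ (hcmp v u)))
      (thc (tgen k (inc _ _ _ _ v)) (tgen k (inc _ _ _ _ u))).

Section Quotient.
Variable S : forall (a b : C) (f g : hom1 a b), hom2 A f g -> hom2 A f g -> Prop.

Inductive quot_rel : forall (a b : C) (f g : hom1 a b),
    term k (hom2 A) f g -> term k (hom2 A) f g -> Prop :=
| quot_inc a b (f g : hom1 a b) (t u : term k (hom2 A) f g) of
    inc_rel (fun a b f g u => u) t u : quot_rel t u
| quot_id a b (f g : hom1 a b) (u v : hom2 A f g) of S u v :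
    quot_rel (tgen k u) (tgen k v).

Definition quot : lin2 k C := presented quot_rel.
End Quotient.

(** Source [\bigoplus_p src p] and target [\bigoplus_q tgt q] of an arrow in the
    additive closure of a category of 1-arrows. *)
Record mxshape := MxShape {
  ms_a : C;
  ms_b : C;
  ms_P : finType;
  ms_Q : finType;
  ms_src : ms_P -> hom1 ms_a ms_b;
  ms_tgt : ms_Q -> hom1 ms_a ms_b
}.

Definition mxarr (s : mxshape) : Type :=
  forall (p : ms_P s) (q : ms_Q s), hom2 A (ms_src p) (ms_tgt q).

Section Localization.
Variables (J : Type) (s : J -> mxshape) (m : forall j, mxarr (s j)).

Inductive loc_gen : forall a b : C, hom1 a b -> hom1 a b -> Type :=
| loc_old a b (f g : hom1 a b) of hom2 A f g : loc_gen f g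
| loc_inv j (q : ms_Q (s j)) (p : ms_P (s j)) : loc_gen (ms_tgt q) (ms_src p).

Definition tsum (G : forall a b : C, hom1 a b -> hom1 a b -> Type)
  (a b : C) (f g : hom1 a b) (P : finType) (F : P -> term k G f g) :
  term k G f g := \big[@tadd k C G a b f g/tzero f g]_(p : P) F p.

Definition tdelta (G : forall a b : C, hom1 a b -> hom1 a b -> Type)
  (a b : C) (P : finType) (f : P -> hom1 a b) (p p' : P) :
  term k G (f p) (f p') :=
  match @eqP P p p' with
  | ReflectT e => castid (@tid k C G a b) (f_equal f e)
  | ReflectF _ => tzero (f p) (f p')
  end.

Inductive loc_rel : forall (a b : C) (f g : hom1 a b),
    term k loc_gen f g -> term k loc_gen f g -> Prop :=
| loc_inc a b (f g : hom1 a b) (t u : term k loc_gen f g) of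
    inc_rel loc_old t u : loc_rel t u
| loc_invl j (p p' : ms_P (s j)) :
    loc_rel (tsum (fun q => tvc (tgen k (loc_inv q p'))
                                (tgen k (loc_old (m p q)))))
            (tdelta loc_gen (@ms_src (s j)) p p')
| loc_invr j (q q' : ms_Q (s j)) :
    loc_rel (tsum (fun p => tvc (tgen k (loc_old (m p q')))
                                (tgen k (loc_inv q p))))
            (tdelta loc_gen (@ms_tgt (s j)) q q').

Definition loc : lin2 k C := presented loc_rel.

End Localization.
End Extensions.

Section ExtensionFunctors.
Variables (k : comNzRingType) (C : cat1).

Lemma inc_rel_eval (A D : lin2 k C)
  (G : forall a b : C, hom1 a b -> hom1 a b -> Type)
  (inc : forall (a b : C) (f g : hom1 a b), hom2 A f g -> G a b f g)
  (i : forall (a b : C) (f g : hom1 a b), G a b f g -> hom2 D f g)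
  (F : lin2fun A D) (a b : C) (f g : hom1 a b) (t u : term k G f g) :
  (forall (a b : C) (f g : hom1 a b) (u : hom2 A f g),
    i _ _ _ _ (inc _ _ _ _ u) = fun2 F u) ->
  inc_rel inc t u -> eval i t = eval i u.
Proof.
move=> iF; case=> {a b f g t u} /= *; rewrite !iF.
- exact: fun2_lin.
- exact: fun2_id.
- exact: fun2_vcmp.
- exact: fun2_hcmp.
Qed.

Definition quot_fun (A : lin2 k C)
  (S : forall (a b : C) (f g : hom1 a b), hom2 A f g -> hom2 A f g -> Prop) :
  lin2fun A (quot S).
Proof.
apply: (@Lin2fun k C A (quot S) (fun a b f g u => cls (quot_rel S) (tgen k u))).
- move=> a b f g x u v; rewrite pi_lin.
  apply/phomP/eqt_rel/quot_inc; exact: inc_lin.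
- move=> a b f; apply/phomP/eqt_rel/quot_inc.
  exact: inc_id.
- move=> a b f g h v u; rewrite [RHS]pi_vc; apply/phomP/eqt_rel/quot_inc.
  exact: inc_vcmp.
- move=> a b c g g' f f' v u; rewrite [RHS]pi_hc; apply/phomP/eqt_rel/quot_inc.
  exact: inc_hcmp.
Defined.

Section Loc.
Variables (J : Type) (s : J -> mxshape C).

Definition loc_fun (A : lin2 k C) (m : forall j, mxarr A (s j)) :
  lin2fun A (loc m).
Proof.
apply: (@Lin2fun k C A (loc m)
  (fun a b f g u => cls (loc_rel m) (tgen k (loc_old s u)))).
- move=> a b f g x u v; rewrite pi_lin.
  by apply/phomP/eqt_rel/loc_inc/inc_lin.
- by move=> a b f; apply/phomP/eqt_rel/loc_inc/inc_id.
- move=> a b f g h v u; rewrite [RHS]pi_vc.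
  exact/phomP/eqt_rel/loc_inc/inc_vcmp.
- move=> a b c g g' f f' v u; rewrite [RHS]pi_hc.
  exact/phomP/eqt_rel/loc_inc/inc_hcmp.
Defined.

Definition loc_ginv (A : lin2 k C) (m : forall j, mxarr A (s j)) (j : J)
  (q : ms_Q (s j)) (p : ms_P (s j)) : hom2 (loc m) (ms_tgt q) (ms_src p) :=
  cls (loc_rel m) (tgen k (loc_inv A q p)).

Variables (A D : lin2 k C) (m : forall j, mxarr A (s j)) (F : lin2fun A D).

Definition mxdelta (B : lin2 k C) (a b : C) (P : finType) (f : P -> hom1 a b)
  (p p' : P) : hom2 B (f p) (f p') :=
  match @eqP P p p' with
  | ReflectT e => idto B (f_equal f e)
  | ReflectF _ => 0
  end.

Lemma eval_tsum (G : forall a b : C, hom1 a b -> hom1 a b -> Type)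
  (B : lin2 k C) (i : forall (a b : C) (f g : hom1 a b), G a b f g -> hom2 B f g)
  (a b : C) (f g : hom1 a b) (P : finType) (t : P -> term k G f g) :
  eval i (tsum t) = \sum_p eval i (t p).
Proof. by rewrite /tsum; apply: (big_morph (eval i (g := g))). Qed.

Lemma eval_tdelta (G : forall a b : C, hom1 a b -> hom1 a b -> Type)
  (B : lin2 k C) (i : forall (a b : C) (f g : hom1 a b), G a b f g -> hom2 B f g)
  (a b : C) (P : finType) (f : P -> hom1 a b) (p p' : P) :
  eval i (tdelta k G f p p') = mxdelta B f p p'.
Proof. by rewrite /tdelta /mxdelta; case: eqP => // e; rewrite eval_castid. Qed.

Variable inv : forall j (q : ms_Q (s j)) (p : ms_P (s j)),
  hom2 D (ms_tgt q) (ms_src p).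
Hypothesis invl : forall j (p p' : ms_P (s j)),
  \sum_q vcmp (inv q p') (fun2 F (m p q)) = mxdelta D (@ms_src C (s j)) p p'.
Hypothesis invr : forall j (q q' : ms_Q (s j)),
  \sum_p vcmp (fun2 F (m p q')) (inv q p) = mxdelta D (@ms_tgt C (s j)) q q'.

Definition loc_eval (a b : C) (f g : hom1 a b) (x : loc_gen A s f g) :
  hom2 D f g :=
  match x in @loc_gen _ _ _ _ _ a b f g return hom2 D f g with
  | loc_old _ _ _ _ u => fun2 F u
  | loc_inv j q p => inv q p
  end.

Definition loc_lift : lin2fun (loc m) D.
Proof.
apply: (@presented_lift k C (loc_gen A s) D loc_eval (loc_rel m)).
move=> a b f g t u; case=> {a b f g t u} [a b f g t u|j p p'|j q q'].
- by apply: inc_rel_eval.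
- by rewrite eval_tsum eval_tdelta; apply: invl.
- by rewrite eval_tsum eval_tdelta; apply: invr.
Defined.

Lemma loc_invl_eq j (p p' : ms_P (s j)) :
  \sum_q vcmp (loc_ginv m q p') (fun2 (loc_fun m) (m p q))
    = mxdelta (loc m) (@ms_src C (s j)) p p'.
Proof.
have := eval_rel (loc_invl m p p').
by rewrite eval_tsum eval_tdelta.
Qed.

Lemma loc_invr_eq j (q q' : ms_Q (s j)) :
  \sum_p vcmp (fun2 (loc_fun m) (m p q')) (loc_ginv m q p)
    = mxdelta (loc m) (@ms_tgt C (s j)) q q'.
Proof.
have := eval_rel (loc_invr m q q').
by rewrite eval_tsum eval_tdelta.
Qed.
End Loc.
End ExtensionFunctors.

(** The letters [E_s] and [F_s].  Words are read as composites of functors: the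
    last letter acts first. *)
Inductive letter (I : Type) := LE of I | LF of I.
Arguments LE {I} _.
Arguments LF {I} _.

(** Monoidal categories are treated as 2-categories with one object. *)
Definition words (I : Type) : cat1 :=
  @Cat1 unit (fun _ _ => seq (letter I)) (fun _ => [::])
    (fun _ _ _ v u => v ++ u) (fun _ _ _ _ w v u => catA w v u)
    (fun _ _ => @cat0s _) (fun _ _ => @cats0 _).

Section Monoidal.
Variables (I : finType) (C : cartan I).

Local Notation k := (kbase C).
Local Notation W := (words I).

(** Generating arrows of [B_1]; those for the left duals are present when [l]
    is [true]. *)
Inductive bgen (l : bool) : forall a b : W, hom1 a b -> hom1 a b -> Type :=
| gx s : @bgen l tt tt [:: LE s] [:: LE s]
| gtau s t : @bgen l tt tt [:: LE s; LE t] [:: LE t; LE s]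
| geps s : @bgen l tt tt [:: LE s; LF s] [::]
| geta s : @bgen l tt tt [::] [:: LF s; LE s]
| gepsl s of l : @bgen l tt tt [:: LF s; LE s] [::]
| getal s of l : @bgen l tt tt [::] [:: LE s; LF s].

Section Relations.
Variable l : bool.

Local Notation T u v := (@term k W (bgen l) tt tt u v).
Local Notation "v ** u" := (tvc v u) (at level 40, left associativity).

Definition ttx s : T [:: LE s] [:: LE s] := tgen k (gx l s).
Definition ttau s t : T [:: LE s; LE t] [:: LE t; LE s] := tgen k (gtau l s t).
Definition teps s : T [:: LE s; LF s] [::] := tgen k (geps l s).
Definition teta s : T [::] [:: LF s; LE s] := tgen k (geta l s).
Definition tepsl s (h : l) : T [:: LF s; LE s] [::] := tgen k (gepsl s h).
Definition tetal s (h : l) : T [::] [:: LE s; LF s] := tgen k (getal s h).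

Definition twh (u v : seq (letter I)) (a b : seq (letter I)) (f : T a b) :
  T (u ++ (a ++ v)) (u ++ (b ++ v)) :=
  @thc k W (bgen l) tt tt tt u u (a ++ v) (b ++ v) (tid (C := W) (a := tt) (b := tt) u)
    (@thc k W (bgen l) tt tt tt a b v v f (tid (C := W) (a := tt) (b := tt) v)).

Section Words.
Variable w : seq (letter I).

Definition tsub (f g : T w w) : T w w := tadd f (tscale (-1) g).
Definition tpow (f : T w w) (n : nat) : T w w :=
  iter n (tvc f) (@tid k W (bgen l) tt tt w).
Definition tsumn (n : nat) (F : 'I_n -> T w w) : T w w := tsum F.

Definition tQ (s t : I) (U V : T w w) : T w w :=
  tsumn (fun p : 'I_(size (Qpol C s t)) =>
    tsumn (fun q : 'I_(size (Qpol C s t)`_p) =>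
      tscale (Qpol C s t)`_p`_q (tpow U p ** tpow V q))).

(** [(Q_st(U, V) - Q_st(U', V)) / (U - U')], using
    [(U^p - U'^p) / (U - U') = \sum_(i < p) U^i U'^(p-1-i)] *)
Definition tQdiff (s t : I) (U U' V : T w w) : T w w :=
  tsumn (fun p : 'I_(size (Qpol C s t)) =>
    tsumn (fun q : 'I_(size (Qpol C s t)`_p) =>
      tscale (Qpol C s t)`_p`_q
        (tsumn (fun i : 'I_p => tpow U i ** tpow U' (p - i.+1)%N) ** tpow V q))).

End Words.

Definition tbraidl s t u :
  T [:: LE s; LE t; LE u] [:: LE u; LE t; LE s] :=
  twh [::] [:: LE s] (ttau t u) ** twh [:: LE t] [::] (ttau s u)
  ** twh [::] [:: LE u] (ttau s t).
Definition tbraidr s t u :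
  T [:: LE s; LE t; LE u] [:: LE u; LE t; LE s] :=
  twh [:: LE u] [::] (ttau s t) ** twh [::] [:: LE t] (ttau s u)
  ** twh [:: LE s] [::] (ttau t u).

Inductive brel : forall (a b : W) (f g : hom1 a b),
    @term k W (bgen l) a b f g -> @term k W (bgen l) a b f g -> Prop :=
| rel_quad s t :
    brel (ttau s t ** ttau t s)
        (tQ s t (twh [:: LE t] [::] (ttx s)) (twh [::] [:: LE s] (ttx t)))
| rel_braid s t u : s != u ->
    brel (tadd (tbraidl s t u) (tscale (-1) (tbraidr s t u))) (tzero _ _)
| rel_braid_eq s t :
    brel (tsub (tbraidl s t s) (tbraidr s t s))
        (tQdiff s t (twh [::] [:: LE t; LE s] (ttx s))
                    (twh [:: LE s; LE t] [::] (ttx s))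
                    (twh [:: LE s] [:: LE s] (ttx t)))
| rel_dotl s t : s != t ->
    brel (tadd (ttau s t ** twh [::] [:: LE t] (ttx s))
              (tscale (-1) (twh [:: LE t] [::] (ttx s) ** ttau s t)))
        (tzero _ _)
| rel_dotl_eq s :
    brel (tsub (ttau s s ** twh [::] [:: LE s] (ttx s))
              (twh [:: LE s] [::] (ttx s) ** ttau s s))
        (tid (C := W) (a := tt) (b := tt) [:: LE s; LE s])
| rel_dotr s t : s != t ->
    brel (tadd (ttau s t ** twh [:: LE s] [::] (ttx t))
              (tscale (-1) (twh [::] [:: LE s] (ttx t) ** ttau s t)))
        (tzero _ _)
| rel_dotr_eq s :
    brel (tsub (ttau s s ** twh [:: LE s] [::] (ttx s))
              (twh [::] [:: LE s] (ttx s) ** ttau s s))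
        (tscale (-1) (tid (C := W) (a := tt) (b := tt) [:: LE s; LE s]))
| rel_dualE s :
    brel (twh [::] [:: LE s] (teps s) ** twh [:: LE s] [::] (teta s))
        (tid (C := W) (a := tt) (b := tt) [:: LE s])
| rel_dualF s :
    brel (twh [:: LF s] [::] (teps s) ** twh [::] [:: LF s] (teta s))
        (tid (C := W) (a := tt) (b := tt) [:: LF s])
| rel_ldualE s (h : l) :
    brel (twh [:: LE s] [::] (tepsl s h) ** twh [::] [:: LE s] (tetal s h))
        (tid (C := W) (a := tt) (b := tt) [:: LE s])
| rel_ldualF s (h : l) :
    brel (twh [::] [:: LF s] (tepsl s h) ** twh [:: LF s] [::] (tetal s h))
        (tid (C := W) (a := tt) (b := tt) [:: LF s]).

End Relations.

(** [B1 false] is [B_1]; [B1 true] is the variant where [F_s] is also a left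
    dual of [E_s]. *)
Definition B1 (l : bool) : lin2 k W := presented (brel (l := l)).

Section Arrows.
Variable l : bool.
Local Notation H u v := (@hom2 k W (B1 l) tt tt u v).
Local Notation "v ** u" := (vcmp v u) (at level 40, left associativity).

Definition bx s : H [:: LE s] [:: LE s] := inj2 (brel (l := l)) (gx l s).
Definition btau s t : H [:: LE s; LE t] [:: LE t; LE s] :=
  inj2 (brel (l := l)) (gtau l s t).
Definition bcounit s : H [:: LE s; LF s] [::] := inj2 (brel (l := l)) (geps l s).
Definition bunit s : H [::] [:: LF s; LE s] := inj2 (brel (l := l)) (geta l s).

Definition bwh (u v : seq (letter I)) (a b : seq (letter I)) (f : H a b) :
  H (u ++ (a ++ v)) (u ++ (b ++ v)) :=
  @hcmp k W (B1 l) tt tt tt u u (a ++ v) (b ++ v) (id2 (B1 l) (a := tt) (b := tt) u)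
    (@hcmp k W (B1 l) tt tt tt a b v v f (id2 (B1 l) (a := tt) (b := tt) v)).

Definition bsigma s t : H [:: LE s; LF t] [:: LF t; LE s] :=
  bwh [:: LF t; LE s] [::] (bcounit t) ** bwh [:: LF t] [:: LF t] (btau t s)
  ** bwh [::] [:: LE s; LF t] (bunit t).

(** [\varepsilon_s \circ (x_s^i F_s)] and [(F_s x_s^i) \circ \eta_s] *)
Definition bcounitx s (i : nat) : H [:: LE s; LF s] [::] :=
  bcounit s ** bwh [::] [:: LF s] (pow2 (bx s) i).
Definition bunitx s (i : nat) : H [::] [:: LF s; LE s] :=
  bwh [:: LF s] [::] (pow2 (bx s) i) ** bunit s.

End Arrows.

Definition bcounitl s : @hom2 k W (B1 true) tt tt [:: LF s; LE s] [::] :=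
  inj2 (brel (l := true)) (gepsl s isT).

Definition bgen_incl (a b : W) (f g : hom1 a b) (x : bgen false f g) :
  hom2 (B1 true) f g :=
  match x in @bgen _ a b f g return hom2 (B1 true) f g with
  | gx s => bx true s
  | gtau s t => btau true s t
  | geps s => bcounit true s
  | geta s => bunit true s
  | gepsl _ h => False_rect _ (notF h)
  | getal _ h => False_rect _ (notF h)
  end.

Lemma eval_tpow (l : bool) (B : lin2 k W)
  (i : forall (a b : W) (f g : hom1 a b), bgen l f g -> hom2 B f g)
  (w : seq (letter I)) (f : @term k W (bgen l) tt tt w w) n :
  eval i (tpow f n) = pow2 (eval i f) n.
Proof. by elim: n => //= n ->. Qed.

Lemma B1_incl_subproof (a b : W) (f g : hom1 a b) (t u : term k (bgen false) f g) :
  brel t u -> eval bgen_incl t = eval bgen_incl u.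
Proof.
pose j := inj2 (brel (l := true)).
have EQ w s t' (U V : @term k W (bgen false) tt tt w w)
   (U' V' : @term k W (bgen true) tt tt w w) :
   eval bgen_incl U = eval j U' -> eval bgen_incl V = eval j V' ->
   eval bgen_incl (tQ s t' U V) = eval j (tQ s t' U' V').
  move=> hU hV; rewrite /tQ /tsumn !eval_tsum; apply: eq_bigr => p _.
  rewrite !eval_tsum; apply: eq_bigr => q _ /=.
  by rewrite !eval_tpow hU hV.
have EQd w s t' (U1 U2 V : @term k W (bgen false) tt tt w w)
   (U1' U2' V' : @term k W (bgen true) tt tt w w) :
   eval bgen_incl U1 = eval j U1' -> eval bgen_incl U2 = eval j U2' ->
   eval bgen_incl V = eval j V' ->
   eval bgen_incl (tQdiff s t' U1 U2 V) = eval j (tQdiff s t' U1' U2' V').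
  move=> hU hU' hV; rewrite /tQdiff /tsumn !eval_tsum; apply: eq_bigr => p _.
  rewrite !eval_tsum; apply: eq_bigr => q _ /=.
  rewrite !eval_tpow hV !eval_tsum.
  congr (_ *: _); congr (ph_vc _ _).
  by apply: eq_bigr => r _ /=; rewrite !eval_tpow hU hU'.
case=> {a b f g t u}.
- move=> s t; rewrite (EQ _ _ _ _ _ (twh [:: LE t] [::] (ttx true s))
    (twh [::] [:: LE s] (ttx true t))) //.
  exact: (eval_rel (rel_quad true s t)).
- by move=> s t u su; exact: (eval_rel (rel_braid true t su)).
- move=> s t; rewrite (EQd _ _ _ _ _ _
    (twh [::] [:: LE t; LE s] (ttx true s)) (twh [:: LE s; LE t] [::] (ttx true s))
    (twh [:: LE s] [:: LE s] (ttx true t))) //.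
  exact: (eval_rel (rel_braid_eq true s t)).
- by move=> s t st; exact: (eval_rel (rel_dotl true st)).
- by move=> s; exact: (eval_rel (rel_dotl_eq true s)).
- by move=> s t st; exact: (eval_rel (rel_dotr true st)).
- by move=> s; exact: (eval_rel (rel_dotr_eq true s)).
- by move=> s; exact: (eval_rel (rel_dualE true s)).
- by move=> s; exact: (eval_rel (rel_dualF true s)).
- by [].
- by [].
Qed.

Definition B1_incl : lin2fun (B1 false) (B1 true) :=
  presented_lift B1_incl_subproof.

End Monoidal.

Section KacMoody.
Variables (I : finType) (C : cartan I) (X Y : zmodType) (D : root_datum C X Y).

Local Notation k := (kbase C).
Local Notation word := (seq (letter I)).

Definition wtl (c : letter I) : X :=
  match c with LE s => sroot D s | LF s => - sroot D s end.
Definition wt (w : word) : X := \sum_(c <- w) wtl c.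

Lemma wt_nil : wt [::] = 0. Proof. by rewrite /wt big_nil. Qed.
Lemma wt_cat u v : wt (u ++ v) = wt u + wt v.
Proof. by rewrite /wt big_cat. Qed.
Lemma wt2 a b : wt [:: a; b] = wtl a + wtl b.
Proof. by rewrite /wt !big_cons big_nil addr0. Qed.

(** The 1-arrows [a -> b] are the words of weight [b - a]. *)
Definition whom (a b : X) : Type := {w : word | wt w = b - a}.

Definition wone (a : X) : whom a a :=
  exist _ [::] (etrans wt_nil (esym (subrr a))).

Lemma wcmp_subproof (a b c : X) (v : whom b c) (u : whom a b) :
  wt (sval v ++ sval u) = c - a.
Proof. by rewrite wt_cat (svalP v) (svalP u) addrA subrK. Qed.
Definition wcmp (a b c : X) (v : whom b c) (u : whom a b) : whom a c :=
  exist _ (sval v ++ sval u) (wcmp_subproof v u).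

Lemma whom_inj (a b : X) (u v : whom a b) : sval u = sval v -> u = v.
Proof. by case: u v => [u pu] [v pv] /=; apply: eq_exist. Qed.

Lemma wcmpA (a b c d : X) (w : whom c d) (v : whom b c) (u : whom a b) :
  wcmp w (wcmp v u) = wcmp (wcmp w v) u.
Proof. by apply: whom_inj; apply: catA. Qed.
Lemma wcmp1l (a b : X) (u : whom a b) : wcmp (wone b) u = u.
Proof. by apply: whom_inj; apply: cat0s. Qed.
Lemma wcmp1r (a b : X) (u : whom a b) : wcmp u (wone a) = u.
Proof. by apply: whom_inj; apply: cats0. Qed.

Definition weights : cat1 := Cat1 wcmpA wcmp1l wcmp1r.

Section A1.
Variable l : bool.
Local Notation B := (@B1 I C l).

Definition A1hom2 (a b : X) (u v : whom a b) : lmodType k :=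
  @hom2 k (words I) B tt tt (sval u) (sval v).

Lemma A1_castid (a b : X) (u v : whom a b) (e : u = v) (e' : sval u = sval v) :
  castid (H := fun p q => A1hom2 p q) (fun p => id2 B (sval p)) e
  = castid (H := fun p q => hom2 B p q) (@id2 k (words I) B tt tt) e'.
Proof.
by case: _ / e in e' *; rewrite (Prop_irrelevance e' (erefl _)).
Qed.

Definition A1 : lin2 k weights.
Proof.
apply: (@Lin2 k weights A1hom2 (fun a b u => id2 B (sval u))
  (fun a b u v w y x => @vcmp k (words I) B tt tt (sval u) (sval v) (sval w) y x)
  (fun a b c v v' u u' y x => @hcmp k (words I) B tt tt tt
     (sval v) (sval v') (sval u) (sval u') y x)).
- by move=> *; apply: vcmpA.
- by move=> *; apply: vcmp1l.
- by move=> *; apply: vcmp1r.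
- by move=> *; apply: vcmp_linl.
- by move=> *; apply: vcmp_linr.
- by move=> *; apply: hcmp_linl.
- by move=> *; apply: hcmp_linr.
- by move=> *; apply: hcmp_id.
- by move=> *; apply: interchange.
- move=> a b c d h h' g g' f f' w v u.
  rewrite (A1_castid (wcmpA h' g' f') (catA (sval h') (sval g') (sval f'))).
  rewrite (A1_castid (wcmpA h g f) (catA (sval h) (sval g) (sval f))).
  exact: hcmpA.
- move=> a b f f' u.
  rewrite (A1_castid (wcmp1l f') (cat0s (sval f'))).
  rewrite (A1_castid (wcmp1l f) (cat0s (sval f))).
  exact: hcmp1l.
- move=> a b f f' u.
  rewrite (A1_castid (wcmp1r f') (cats0 (sval f'))).
  rewrite (A1_castid (wcmp1r f) (cats0 (sval f))).
  exact: hcmp1r.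
Defined.

End A1.

Definition A1_incl : lin2fun (A1 false) (A1 true).
Proof.
apply: (@Lin2fun k weights (A1 false) (A1 true)
  (fun a b u v x => @fun2 k (words I) _ _ (@B1_incl I C) tt tt (sval u) (sval v) x)).
- move=> a b u v.
  exact: (@fun2_lin k (words I) _ _ (@B1_incl I C) tt tt (sval u) (sval v)).
- by move=> a b u; apply: (fun2_id (@B1_incl I C)).
- by move=> a b u v w y x; apply: (fun2_vcmp (@B1_incl I C)).
- by move=> a b c v v' u u' y x; apply: (fun2_hcmp (@B1_incl I C)).
Defined.

Lemma wtEF s t a : wt [:: LE s; LF t] = a + (sroot D s - sroot D t) - a.
Proof. by rewrite wt2 /= [RHS]addrC addKr. Qed.
Lemma wtFE s t a : wt [:: LF t; LE s] = a + (sroot D s - sroot D t) - a.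
Proof. by rewrite wt2 /= [RHS]addrC addKr addrC. Qed.
Lemma wtEF0 s a : wt [:: LE s; LF s] = a - a.
Proof. by rewrite wt2 /= !subrr. Qed.
Lemma wtFE0 s a : wt [:: LF s; LE s] = a - a.
Proof. by rewrite wt2 /= subrr addNr. Qed.

Definition EF s a : whom a a := exist _ [:: LE s; LF s] (wtEF0 s a).
Definition FE s a : whom a a := exist _ [:: LF s; LE s] (wtFE0 s a).
Definition EFst s t a : whom a (a + (sroot D s - sroot D t)) :=
  exist _ [:: LE s; LF t] (wtEF s t a).
Definition FEst s t a : whom a (a + (sroot D s - sroot D t)) :=
  exist _ [:: LF t; LE s] (wtFE s t a).

Definition wtn (s : I) (a : X) : int := pairing D (scoroot D s) a.

Inductive loc_ix : Type :=
| ix_pos s a of 0 <= wtn s a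
| ix_neg s a of wtn s a <= 0
| ix_mixed (s t : I) (a : X) of s != t.

(** The index [None] is for [E_sF_s] (or [F_sE_s]), the indices [Some i] are for
    the copies of the identity. *)
Definition loc_shape (j : loc_ix) : mxshape weights :=
  match j with
  | ix_pos s a _ => @MxShape weights a a unit (option 'I_`|wtn s a|)
      (fun _ => EF s a) (fun q => if q is Some _ then wone a else FE s a)
  | ix_neg s a _ => @MxShape weights a a (option 'I_`|wtn s a|) unit
      (fun p => if p is Some _ then wone a else EF s a) (fun _ => FE s a)
  | ix_mixed s t a _ =>
      @MxShape weights a (a + (sroot D s - sroot D t)) unit unit
      (fun _ => EFst s t a) (fun _ => FEst s t a)
  end.

Definition loc_arr (l : bool) (j : loc_ix) : mxarr (A1 l) (loc_shape j) :=
  match j return mxarr (A1 l) (loc_shape j) with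
  | ix_pos s a _ => fun _ q =>
      match q return A1hom2 l (EF s a) (if q is Some _ then wone a else FE s a)
      with
      | None => bsigma C l s s
      | Some i => bcounitx C l s i
      end
  | ix_neg s a _ => fun p _ =>
      match p return A1hom2 l (if p is Some _ then wone a else EF s a) (FE s a)
      with
      | None => bsigma C l s s
      | Some i => bunitx C l s i
      end
  | ix_mixed s t a _ => fun _ _ => bsigma C l s t
  end.

(** [AA false] is the 2-category [A] and [AA true] is [A^l]. *)
Definition AA (l : bool) : lin2 k weights := loc (loc_arr l).

Definition iA (l : bool) : lin2fun (A1 l) (AA l) := loc_fun (loc_arr l).

Section EpsTilde.
Variables (l : bool) (s : I) (a : X).

Definition sigmaA : hom2 (AA l) (EF s a) (FE s a) :=
  fun2 (iA l) (bsigma C l s s : hom2 (A1 l) (EF s a) (FE s a)).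
Definition epsxA (i : nat) : hom2 (AA l) (EF s a) (wone a) :=
  fun2 (iA l) (bcounitx C l s i : hom2 (A1 l) (EF s a) (wone a)).
Definition etaxA (i : nat) : hom2 (AA l) (wone a) (FE s a) :=
  fun2 (iA l) (bunitx C l s i : hom2 (A1 l) (wone a) (FE s a)).

(** The property characterizing [\tilde\varepsilon_{s,a}]; note that
    [(-1)^(n+1)] only depends on the absolute value of [n]. *)
Definition is_epstilde (e : hom2 (AA l) (FE s a) (wone a)) : Prop :=
  let n := `|wtn s a|%N in
  if 0 <= wtn s a then
    exists c : 'I_n -> hom2 (AA l) (wone a) (wone a),
      vcmp e sigmaA
      = (-1) ^+ n.+1 *: epsxA n + \sum_(i < n) vcmp (c i) (epsxA i)
  else
    vcmp e sigmaA = 0 /\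
    forall i : 'I_n, vcmp e (etaxA i)
      = if i.+1 == n then (-1) ^+ n.+1 *: id2 (AA l) (wone a) else 0.

End EpsTilde.

Definition epslA (s : I) (a : X) : hom2 (AA true) (FE s a) (wone a) :=
  fun2 (iA true) (bcounitl C s : hom2 (A1 true) (FE s a) (wone a)).

Inductive epsl_rel : forall (a b : weights) (f g : hom1 a b),
    hom2 (AA true) f g -> hom2 (AA true) f g -> Prop :=
| EpslRel s a (e : hom2 (AA true) (FE s a) (wone a)) of
    is_epstilde e : epsl_rel (epslA s a) e.

Definition AA' : lin2 k weights := quot epsl_rel.

Definition A1_AA' : lin2fun (A1 false) AA' :=
  lin2fun_comp (quot_fun epsl_rel) (lin2fun_comp (iA true) A1_incl).

Definition AA'_inv (j : loc_ix) (q : ms_Q (loc_shape j)) (p : ms_P (loc_shape j)) :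
  hom2 AA' (ms_tgt q) (ms_src p) :=
  fun2 (quot_fun epsl_rel) (loc_ginv (loc_arr true) q p).

Lemma fun2_mxdelta (C' : cat1) (A A' : lin2 k C') (F : lin2fun A A')
  (a b : C') (P : finType) (f : P -> hom1 a b) (p p' : P) :
  fun2 F (mxdelta A f p p') = mxdelta A' f p p'.
Proof.
by rewrite /mxdelta; case: eqP => e; [apply: fun2_idto | apply: fun2_0].
Qed.

Lemma fun2_sum (C' : cat1) (A A' : lin2 k C') (F : lin2fun A A')
  (a b : C') (f g : hom1 a b) (P : finType) (u : P -> hom2 A f g) :
  fun2 F (\sum_p u p) = \sum_p fun2 F (u p).
Proof.
apply: (big_morph (fun2 F (g := g))); last exact: fun2_0.
by move=> x y; have := fun2_lin F 1 x y; rewrite !scale1r.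
Qed.

Lemma B1_incl_wh (u v a b : word)
  (f : @hom2 k (words I) (B1 C false) tt tt a b) :
  fun2 (B1_incl C) (bwh u v f) = bwh u v (fun2 (B1_incl C) f).
Proof. by rewrite /bwh !fun2_hcmp !fun2_id. Qed.

Lemma B1_incl_gen (a b : words I) (f g : hom1 a b) (x : bgen false f g) :
  fun2 (B1_incl C) (inj2 (@brel I C false) x) = bgen_incl C x.
Proof. by rewrite [LHS]presented_liftE. Qed.

Lemma B1_incl_sigma s t :
  fun2 (B1_incl C) (bsigma C false s t) = bsigma C true s t.
Proof.
rewrite /bsigma !fun2_vcmp (B1_incl_wh [:: LF t; LE s] [::] (bcounit C false t)).
rewrite (B1_incl_wh [:: LF t] [:: LF t] (btau C false t s)).
rewrite (B1_incl_wh [::] [:: LE s; LF t] (bunit C false t)).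
by rewrite !B1_incl_gen.
Qed.

Lemma B1_incl_epsx s i :
  fun2 (B1_incl C) (bcounitx C false s i) = bcounitx C true s i.
Proof.
rewrite /bcounitx fun2_vcmp (B1_incl_wh [::] [:: LF s] (pow2 (bx C false s) i)).
by rewrite fun2_pow !B1_incl_gen.
Qed.

Lemma B1_incl_etax s i :
  fun2 (B1_incl C) (bunitx C false s i) = bunitx C true s i.
Proof.
rewrite /bunitx fun2_vcmp (B1_incl_wh [:: LF s] [::] (pow2 (bx C false s) i)).
by rewrite fun2_pow !B1_incl_gen.
Qed.

Lemma A1_incl_arr (j : loc_ix) (p : ms_P (loc_shape j)) (q : ms_Q (loc_shape j)) :
  fun2 A1_incl (loc_arr false (j := j) p q) = loc_arr true (j := j) p q.
Proof.
move: p q; case: j => [s a h|s a h|s t a h].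
- by case=> -[i|]; [apply: B1_incl_epsx | apply: B1_incl_sigma].
- by case=> [i|] []; [apply: B1_incl_etax | apply: B1_incl_sigma].
- by move=> [] []; apply: B1_incl_sigma.
Qed.

Definition AA_AA' : lin2fun (AA false) AA'.
Proof.
apply: (loc_lift (m := loc_arr false) (F := A1_AA') (inv := AA'_inv)).
- move=> j p p'; rewrite -(fun2_mxdelta (quot_fun epsl_rel)).
  rewrite -(loc_invl_eq (loc_arr true)) fun2_sum; apply: eq_bigr => q _.
  by rewrite fun2_vcmp -A1_incl_arr.
- move=> j q q'; rewrite -(fun2_mxdelta (quot_fun epsl_rel)).
  rewrite -(loc_invr_eq (loc_arr true)) fun2_sum; apply: eq_bigr => p _.
  by rewrite fun2_vcmp -A1_incl_arr.
Defined.

Definition Epow (s : I) (n : nat) (a : X) : whom a (wt (nseq n (LE s)) + a) :=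
  exist _ (nseq n (LE s)) (esym (addrK a _)).
Definition Fpow (s : I) (n : nat) (a : X) : whom a (wt (nseq n (LF s)) + a) :=
  exist _ (nseq n (LF s)) (esym (addrK a _)).

Section EpsTildeUnique.
Variables (l : bool) (s : I) (a : X).

Lemma linear0' (V W : lmodType k) (f : V -> W) : linear f -> f 0 = 0.
Proof. by move=> /(_ (-1) 0 0); rewrite scaler0 addr0 scaleN1r addNr. Qed.
Lemma linearZ' (V W : lmodType k) (f : V -> W) x u :
  linear f -> f (x *: u) = x *: f u.
Proof. by move=> fl; have := fl x u 0; rewrite (linear0' fl) !addr0. Qed.
Lemma linearD' (V W : lmodType k) (f : V -> W) u v :
  linear f -> f (u + v) = f u + f v.
Proof. by move=> fl; have := fl 1 u v; rewrite !scale1r. Qed.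
Lemma linear_sum' (V W : lmodType k) (f : V -> W) (T : finType) (u : T -> V) :
  linear f -> f (\sum_t u t) = \sum_t f (u t).
Proof.
move=> fl; apply: (big_morph f); last exact: linear0'.
by move=> x y; apply: linearD'.
Qed.

Lemma mxdelta_diag (C' : cat1) (A : lin2 k C') (b c : C') (P : finType)
  (f : P -> hom1 b c) p : mxdelta A f p p = id2 A (f p).
Proof.
rewrite /mxdelta; case: eqP => // e.
by rewrite (Prop_irrelevance (f_equal f e) (erefl _)).
Qed.
Lemma mxdelta_off (C' : cat1) (A : lin2 k C') (b c : C') (P : finType)
  (f : P -> hom1 b c) p p' : p != p' -> mxdelta A f p p' = 0.
Proof. by rewrite /mxdelta; case: eqP. Qed.

Lemma sum_option (V : zmodType) (T : finType) (F : option T -> V) :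
  \sum_q F q = F None + \sum_t F (Some t).
Proof.
rewrite (bigD1 None) //=; congr (_ + _).
rewrite (reindex_omap Some id) /=; last by case.
by apply: eq_bigl => t; rewrite eqxx.
Qed.

Lemma sum_unit (V : zmodType) (F : unit -> V) : \sum_q F q = F tt.
Proof. by rewrite (big_pred1 tt) //; case. Qed.

Lemma is_epstilde_unique : exists! e, is_epstilde (l := l) (s := s) (a := a) e.
Proof.
pose A := AA l; set n := `|wtn s a|%N.
pose sg : k := (-1) ^+ n.+1.
case: (boolP (0 <= wtn s a)) => [h|h].
  pose j := ix_pos h.
  pose G q := loc_ginv (loc_arr l) (j := j) q tt.
  have El : vcmp (G None) (@sigmaA l s a)
      + \sum_(i < n) vcmp (G (Some i)) (@epsxA l s a i) = id2 A (EF s a).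
    have := loc_invl_eq (loc_arr l) (j := j) tt tt.
    by rewrite mxdelta_diag sum_option.
  have Er0 : vcmp (@sigmaA l s a) (G None) = id2 A (FE s a).
    have := loc_invr_eq (loc_arr l) (j := j) None None.
    by rewrite mxdelta_diag sum_unit.
  have Er i : vcmp (@epsxA l s a (i : 'I_n)) (G None) = 0.
    have := loc_invr_eq (loc_arr l) (j := j) None (Some i).
    by rewrite mxdelta_off // sum_unit.
  pose e0 : hom2 A (FE s a) (wone a) := sg *: vcmp (@epsxA l s a n) (G None).
  exists e0; split.
    rewrite /is_epstilde /e0 h -/n; cbv zeta.
    exists (fun i => - (sg *: vcmp (@epsxA l s a n) (G (Some i)))).
    have {1}-> : (-1) ^+ n.+1 *: @epsxA l s a n
        = sg *: vcmp (@epsxA l s a n) (id2 A (EF s a)) by rewrite vcmp1r.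
    rewrite -El (linearD' _ _ (vcmp_linr _)) (linear_sum' _ (vcmp_linr _)).
    rewrite scalerDr (linearZ' _ _ (vcmp_linl (@sigmaA l s a))) -vcmpA -addrA.
    rewrite -[LHS]addr0; congr (_ + _); rewrite scaler_sumr -big_split big1 //.
    move=> i _; rewrite -scaleN1r; cbv beta.
    rewrite (linearZ' _ _ (vcmp_linl (@epsxA l s a i))).
    rewrite (linearZ' _ _ (vcmp_linl (@epsxA l s a i))).
    by rewrite scaleN1r vcmpA; apply: subrr.
  move=> e; rewrite /is_epstilde h => -[c Ec].
  rewrite -[RHS]vcmp1r -Er0 vcmpA Ec (linearD' _ _ (vcmp_linl (G None))).
  rewrite (linearZ' _ _ (vcmp_linl (G None))).
  rewrite (linear_sum' _ (vcmp_linl (G None))) big1 ?addr0 // => i _.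
  by rewrite -vcmpA Er (linear0' (vcmp_linr _)).
have h' : wtn s a <= 0 by rewrite ltW // ltNge.
have n0 : (0 < n)%N by rewrite absz_gt0; apply: contraNneq h => ->.
pose j := ix_neg h'.
pose G p := loc_ginv (loc_arr l) (j := j) tt p.
have Er : vcmp (@sigmaA l s a) (G None)
    + \sum_(i < n) vcmp (@etaxA l s a i) (G (Some i)) = id2 A (FE s a).
  have := loc_invr_eq (loc_arr l) (j := j) tt tt.
  by rewrite mxdelta_diag sum_option.
have last_lt : (n.-1 < n)%N by rewrite prednK.
pose m := Ordinal last_lt.
exists (sg *: G (Some m)); split.
  rewrite /is_epstilde (negPf h); split.
    rewrite (linearZ' _ _ (vcmp_linl (@sigmaA l s a))).
    have := loc_invl_eq (loc_arr l) (j := j) None (Some m).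
    rewrite sum_unit mxdelta_off // => E.
    by transitivity (sg *: (0 : hom2 A (EF s a) (wone a)));
      [congr (_ *: _) | rewrite scaler0].
  move=> i; rewrite (linearZ' _ _ (vcmp_linl (@etaxA l s a i))).
  have := loc_invl_eq (loc_arr l) (j := j) (Some i) (Some m).
  rewrite sum_unit; case: (eqVneq i m) => [->|im].
    rewrite mxdelta_diag prednK // eqxx => E.
    by congr (_ *: _).
  rewrite mxdelta_off; last by apply: contra_neq im => -[].
  have -> : (i.+1 == n) = false.
    apply: contra_neqF im => /eqP E; apply: val_inj => /=.
    by rewrite -E.
  move=> E; transitivity (sg *: (0 : hom2 A (wone a) (wone a)));
    [by congr (_ *: _) | by rewrite scaler0].
move=> e; rewrite /is_epstilde (negPf h) => -[e1 e2].
rewrite -[RHS]vcmp1r -Er (linearD' _ _ (vcmp_linr e)) vcmpA e1.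
rewrite (linear0' (vcmp_linl _)) add0r (linear_sum' _ (vcmp_linr e)).
have mn : m.+1 == n by rewrite /= prednK.
rewrite (bigD1 m) // big1 => [|i im].
  apply: (etrans _ (esym (addr0 _))).
  by rewrite vcmpA e2 mn (linearZ' _ _ (vcmp_linl _)) vcmp1l.
rewrite vcmpA e2; case: eqP => [E|_]; last exact: (linear0' (vcmp_linl _)).
by case/eqP: im; apply: val_inj; exact: (congr1 predn E).
Qed.

End EpsTildeUnique.

End KacMoody.

(** Not strict: the 2-category of 2-representations below is strict only up to
    propositional equality of records. *)
Record bicat := Bicat {
  b0 :> Type;
  b1 : b0 -> b0 -> Type;
  b2 : forall x y : b0, b1 x y -> b1 x y -> Type;
  bid : forall (x y : b0) (f : b1 x y), b2 f f;
  bvc : forall (x y : b0) (f g h : b1 x y), b2 g h -> b2 f g -> b2 f h;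
  bone : forall x : b0, b1 x x;
  bcmp : forall x y z : b0, b1 y z -> b1 x y -> b1 x z;
  bhc : forall (x y z : b0) (g g' : b1 y z) (f f' : b1 x y),
    b2 g g' -> b2 f f' -> b2 (bcmp g f) (bcmp g' f');
  bas : forall (x y z t : b0) (h : b1 z t) (g : b1 y z) (f : b1 x y),
    b2 (bcmp h (bcmp g f)) (bcmp (bcmp h g) f);
  blu : forall (x y : b0) (f : b1 x y), b2 (bcmp (bone y) f) f;
  bru : forall (x y : b0) (f : b1 x y), b2 (bcmp f (bone x)) f;
  binv := fun (x y : b0) (f g : b1 x y) (u : b2 f g) =>
    exists v : b2 g f, bvc v u = bid f /\ bvc u v = bid g;
  bvcA : forall (x y : b0) (f g h i : b1 x y)
    (w : b2 h i) (v : b2 g h) (u : b2 f g),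
    bvc w (bvc v u) = bvc (bvc w v) u;
  bvc1l : forall (x y : b0) (f g : b1 x y) (u : b2 f g), bvc (bid g) u = u;
  bvc1r : forall (x y : b0) (f g : b1 x y) (u : b2 f g), bvc u (bid f) = u;
  bhc_id : forall (x y z : b0) (g : b1 y z) (f : b1 x y),
    bhc (bid g) (bid f) = bid (bcmp g f);
  bhc_vc : forall (x y z : b0) (g g' g'' : b1 y z) (f f' f'' : b1 x y)
    (v' : b2 g' g'') (v : b2 g g') (u' : b2 f' f'') (u : b2 f f'),
    bhc (bvc v' v) (bvc u' u) = bvc (bhc v' u') (bhc v u);
  bas_inv : forall (x y z t : b0) (h : b1 z t) (g : b1 y z) (f : b1 x y),
    binv (bas h g f);
  blu_inv : forall (x y : b0) (f : b1 x y), binv (blu f);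
  bru_inv : forall (x y : b0) (f : b1 x y), binv (bru f);
  bas_nat : forall (x y z t : b0) (h h' : b1 z t) (g g' : b1 y z)
    (f f' : b1 x y) (w : b2 h h') (v : b2 g g') (u : b2 f f'),
    bvc (bas h' g' f') (bhc w (bhc v u)) = bvc (bhc (bhc w v) u) (bas h g f);
  blu_nat : forall (x y : b0) (f f' : b1 x y) (u : b2 f f'),
    bvc (blu f') (bhc (bid (bone y)) u) = bvc u (blu f);
  bru_nat : forall (x y : b0) (f f' : b1 x y) (u : b2 f f'),
    bvc (bru f') (bhc u (bid (bone x))) = bvc u (bru f);
  bpentagon : forall (x y z t s : b0)
    (i : b1 t s) (h : b1 z t) (g : b1 y z) (f : b1 x y),
    bvc (bas (bcmp i h) g f) (bas i h (bcmp g f))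
    = bvc (bhc (bas i h g) (bid f))
        (bvc (bas i (bcmp h g) f) (bhc (bid i) (bas h g f)));
  btriangle : forall (x y z : b0) (g : b1 y z) (f : b1 x y),
    bvc (bhc (bru g) (bid f)) (bas g (bone y) f) = bhc (bid g) (blu f)
}.

Definition invertible2 (B : bicat) (x y : B) (f g : b1 x y) (u : b2 f g) : Prop :=
  exists v : b2 g f, bvc v u = bid f /\ bvc u v = bid g.

Definition iso1 (B : bicat) (x y : B) (f g : b1 x y) : Prop :=
  exists u : b2 f g, invertible2 u.

Definition equiv0 (B : bicat) (x y : B) : Prop :=
  exists (f : b1 x y) (g : b1 y x),
    iso1 (bcmp g f) (bone x) /\ iso1 (bcmp f g) (bone y).

Record psfun (B B' : bicat) := Psfun {
  ps0 :> B -> B';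
  ps1 : forall x y : B, b1 x y -> b1 (ps0 x) (ps0 y);
  ps2 : forall (x y : B) (f g : b1 x y), b2 f g -> b2 (ps1 f) (ps1 g);
  psc : forall (x y z : B) (g : b1 y z) (f : b1 x y),
    b2 (bcmp (ps1 g) (ps1 f)) (ps1 (bcmp g f));
  psu : forall x : B, b2 (bone (ps0 x)) (ps1 (bone x));
  psc_inv : forall (x y z : B) (g : b1 y z) (f : b1 x y),
    invertible2 (psc g f);
  psu_inv : forall x : B, invertible2 (psu x);
  ps2_id : forall (x y : B) (f : b1 x y), ps2 (bid f) = bid (ps1 f);
  ps2_vc : forall (x y : B) (f g h : b1 x y) (v : b2 g h) (u : b2 f g),
    ps2 (bvc v u) = bvc (ps2 v) (ps2 u);
  psc_nat : forall (x y z : B) (g g' : b1 y z) (f f' : b1 x y)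
    (v : b2 g g') (u : b2 f f'),
    bvc (psc g' f') (bhc (ps2 v) (ps2 u)) = bvc (ps2 (bhc v u)) (psc g f);
  psc_as : forall (x y z t : B) (h : b1 z t) (g : b1 y z) (f : b1 x y),
    bvc (ps2 (bas h g f)) (bvc (psc h (bcmp g f)) (bhc (bid (ps1 h)) (psc g f)))
    = bvc (bvc (psc (bcmp h g) f) (bhc (psc h g) (bid (ps1 f))))
        (bas (ps1 h) (ps1 g) (ps1 f));
  psc_lu : forall (x y : B) (f : b1 x y),
    bvc (ps2 (blu f)) (bvc (psc (bone y) f) (bhc (psu y) (bid (ps1 f))))
    = blu (ps1 f);
  psc_ru : forall (x y : B) (f : b1 x y),
    bvc (ps2 (bru f)) (bvc (psc f (bone x)) (bhc (bid (ps1 f)) (psu x)))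
    = bru (ps1 f)
}.

(** Equivalences of 2-categories: 2-functors inducing equivalences between the
    categories of 1-arrows and reaching every object up to equivalence. *)
Definition equivalence2 (B B' : bicat) (P : psfun B B') : Prop :=
  [/\ forall (x y : B) (f g : b1 x y), bijective (@ps2 B B' P x y f g),
      forall (x y : B) (h : b1 (P x) (P y)), exists f : b1 x y, iso1 (ps1 P f) h &
      forall x' : B', exists x : B, equiv0 (P x) x'].

Section LinearCategories.
Variable k : comNzRingType.

Record lcat := Lcat {
  lob :> Type;
  lhom : lob -> lob -> lmodType k;
  lid : forall M : lob, lhom M M;
  lcmp : forall M N P : lob, lhom N P -> lhom M N -> lhom M P;
  lcmpA : forall (M N P Q : lob) (w : lhom P Q) (v : lhom N P) (u : lhom M N),
    lcmp w (lcmp v u) = lcmp (lcmp w v) u;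
  lcmp1l : forall (M N : lob) (u : lhom M N), lcmp (lid N) u = u;
  lcmp1r : forall (M N : lob) (u : lhom M N), lcmp u (lid M) = u;
  lcmp_linl : forall (M N P : lob) (u : lhom M N),
    linear (fun v : lhom N P => lcmp v u);
  lcmp_linr : forall (M N P : lob) (v : lhom N P),
    linear (fun u : lhom M N => lcmp v u)
}.
Arguments lid {l} M : rename.

Local Notation "v ** u" := (lcmp v u) (at level 40, left associativity).

Definition liso (V : lcat) (M N : V) (u : lhom M N) : Prop :=
  exists v : lhom N M, v ** u = lid M /\ u ** v = lid N.

Definition lzero (V : lcat) (M : V) : Prop := lid M = 0.

Record lfun (V W : lcat) := Lfun {
  fob :> V -> W;
  fmap : forall M N : V, lhom M N -> lhom (fob M) (fob N);
  fmap_lin : forall M N : V, linear (@fmap M N);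
  fmap_id : forall M : V, fmap (lid M) = lid (fob M);
  fmap_cmp : forall (M N P : V) (v : lhom N P) (u : lhom M N),
    fmap (v ** u) = fmap v ** fmap u
}.

Definition lfun_id (V : lcat) : lfun V V.
Proof. by apply: (@Lfun V V id (fun M N u => u)). Defined.

Definition lfun_cmp (U V W : lcat) (G : lfun V W) (F : lfun U V) : lfun U W.
Proof.
apply: (@Lfun U W (fun M => G (F M)) (fun M N u => fmap G (fmap F u))).
- by move=> M N x u v; rewrite !fmap_lin.
- by move=> M; rewrite !fmap_id.
- by move=> M N P v u; rewrite !fmap_cmp.
Defined.

Record ltr (V W : lcat) (F G : lfun V W) := Ltr {
  tr :> forall M : V, lhom (F M) (G M);
  tr_nat : forall (M N : V) (u : lhom M N), tr N ** fmap F u = fmap G u ** tr M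
}.

(** A locally full 2-subcategory of the 2-category of [k]-linear categories
    retains all natural transformations between the 1-arrows it contains, so
    that it is determined by its objects and 1-arrows. *)
Record lfsub := Lfsub {
  in0 : lcat -> Prop;
  in1 : forall V W : lcat, lfun V W -> Prop;
  in1_id : forall V : lcat, in0 V -> in1 (lfun_id V);
  in1_cmp : forall (U V W : lcat) (G : lfun V W) (F : lfun U V),
    in0 U -> in0 V -> in0 W -> in1 G -> in1 F -> in1 (lfun_cmp G F)
}.

(** As the 2-category of [k]-linear categories is strict, with compositions
    computed objectwise, the coherence conditions below are written on objects
    and involve no associators on the target side. *)

Section Representations.
Variables (C : cat1) (B : lfsub).

Section Rep.
Variable A : lin2 k C.

Record rep2 := Rep2 {
  r0 :> C -> lcat;
  r0_in : forall a : C, in0 B (r0 a);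
  r1 : forall a b : C, hom1 a b -> lfun (r0 a) (r0 b);
  r1_in : forall (a b : C) (f : hom1 a b), in1 B (r1 f);
  r2 : forall (a b : C) (f g : hom1 a b), hom2 A f g -> ltr (r1 f) (r1 g);
  r2_lin : forall (a b : C) (f g : hom1 a b) (M : r0 a),
    linear (fun u : hom2 A f g => r2 u M);
  r2_id : forall (a b : C) (f : hom1 a b) (M : r0 a),
    r2 (id2 A f) M = lid (r1 f M);
  r2_vcmp : forall (a b : C) (f g h : hom1 a b) (v : hom2 A g h)
    (u : hom2 A f g) (M : r0 a), r2 (vcmp v u) M = r2 v M ** r2 u M;
  rc : forall (a b c : C) (g : hom1 b c) (f : hom1 a b),
    ltr (lfun_cmp (r1 g) (r1 f)) (r1 (cmp g f));
  rc_iso : forall (a b c : C) (g : hom1 b c) (f : hom1 a b) (M : r0 a),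
    liso (rc g f M);
  ru : forall a : C, ltr (lfun_id (r0 a)) (r1 (one a));
  ru_iso : forall (a : C) (M : r0 a), liso (ru a M);
  rc_nat : forall (a b c : C) (g g' : hom1 b c) (f f' : hom1 a b)
    (v : hom2 A g g') (u : hom2 A f f') (M : r0 a),
    rc g' f' M ** (r2 v (r1 f' M) ** fmap (r1 g) (r2 u M))
    = r2 (hcmp v u) M ** rc g f M;
  rc_assoc : forall (a b c d : C) (h : hom1 c d) (g : hom1 b c) (f : hom1 a b)
    (M : r0 a),
    r2 (idto A (cmpA h g f)) M ** (rc h (cmp g f) M ** fmap (r1 h) (rc g f M))
    = rc (cmp h g) f M ** rc h g (r1 f M);
  rc_unitl : forall (a b : C) (f : hom1 a b) (M : r0 a),
    r2 (idto A (cmp1l f)) M ** (rc (one b) f M ** ru b (r1 f M)) = lid (r1 f M);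
  rc_unitr : forall (a b : C) (f : hom1 a b) (M : r0 a),
    r2 (idto A (cmp1r f)) M ** (rc f (one a) M ** fmap (r1 f) (ru a M))
    = lid (r1 f M)
}.

Record pnat (V W : rep2) := Pnat {
  p1 :> forall a : C, lfun (V a) (W a);
  p1_in : forall a : C, in1 B (p1 a);
  p2 : forall (a b : C) (f : hom1 a b),
    ltr (lfun_cmp (r1 W f) (p1 a)) (lfun_cmp (p1 b) (r1 V f));
  p2_iso : forall (a b : C) (f : hom1 a b) (M : V a), liso (p2 f M);
  p2_nat : forall (a b : C) (f g : hom1 a b) (u : hom2 A f g) (M : V a),
    p2 g M ** r2 W u (p1 a M) = fmap (p1 b) (r2 V u M) ** p2 f M;
  p2_cmp : forall (a b c : C) (g : hom1 b c) (f : hom1 a b) (M : V a),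
    p2 (cmp g f) M ** rc W g f (p1 a M)
    = fmap (p1 c) (rc V g f M)
      ** (p2 g (r1 V f M) ** fmap (r1 W g) (p2 f M));
  p2_one : forall (a : C) (M : V a),
    p2 (one a) M ** ru W a (p1 a M) = fmap (p1 a) (ru V a M)
}.

Record modif (V W : rep2) (S T : pnat V W) := Modif {
  md :> forall a : C, ltr (S a) (T a);
  md_nat : forall (a b : C) (f : hom1 a b) (M : V a),
    p2 T f M ** fmap (r1 W f) (md a M) = md b (r1 V f M) ** p2 S f M
}.

Lemma ltr_eq (V W : lcat) (F G : lfun V W) (s t : ltr F G) :
  (forall M, s M = t M) -> s = t.
Proof.
case: s t => [s ps] [t pt] /= st.
have E : s = t by apply: functional_extensionality_dep.
by rewrite -E in pt *; rewrite (Prop_irrelevance ps pt).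
Qed.

Lemma modif_eq (V W : rep2) (S T : pnat V W) (m n : modif S T) :
  (forall a (M : V a), m a M = n a M) -> m = n.
Proof.
case: m n => [m pm] [n pn] /= mn.
have E : m = n.
  by apply: functional_extensionality_dep => a; apply: ltr_eq => M; apply: mn.
by rewrite -E in pn *; rewrite (Prop_irrelevance pm pn).
Qed.

Lemma liso_cmp (V : lcat) (M N P : V) (v : lhom N P) (u : lhom M N) :
  liso v -> liso u -> liso (v ** u).
Proof.
move=> [v' [v1 v2]] [u' [u1 u2]]; exists (u' ** v'); split.
- by rewrite lcmpA -(lcmpA u') v1 lcmp1r u1.
- by rewrite lcmpA -(lcmpA v) u2 lcmp1r v2.
Qed.

Lemma liso_fmap (V W : lcat) (F : lfun V W) (M N : V) (u : lhom M N) :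
  liso u -> liso (fmap F u).
Proof.
by move=> [v [vu uv]]; exists (fmap F v); rewrite -!fmap_cmp vu uv !fmap_id.
Qed.

Lemma liso_id (V : lcat) (M : V) : liso (lid M).
Proof. by exists (lid M); rewrite lcmp1l. Qed.

Definition pnat_one (V : rep2) : pnat V V.
Proof.
unshelve refine (@Pnat V V (fun a => lfun_id (V a)) _
  (fun a b f => @Ltr _ _ (lfun_cmp (r1 V f) (lfun_id (V a)))
      (lfun_cmp (lfun_id (V b)) (r1 V f)) (fun M => lid (r1 V f M)) _) _ _ _ _).
- by move=> M N u /=; rewrite lcmp1l lcmp1r.
- by move=> a; apply/in1_id/r0_in.
- by move=> *; apply: liso_id.
- by move=> a b f g u M /=; rewrite lcmp1l lcmp1r.
- by move=> a b c g f M /=; rewrite fmap_id !lcmp1l lcmp1r.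
- by move=> a M /=; rewrite lcmp1l.
Defined.

Definition pnat_cmp (U V W : rep2) (T : pnat V W) (S : pnat U V) : pnat U W.
Proof.
unshelve refine (@Pnat U W (fun a => lfun_cmp (T a) (S a)) _
  (fun a b f => @Ltr _ _ (lfun_cmp (r1 W f) (lfun_cmp (T a) (S a)))
     (lfun_cmp (lfun_cmp (T b) (S b)) (r1 U f))
     (fun M => fmap (T b) (p2 S f M) ** p2 T f (S a M)) _) _ _ _ _).
- move=> M N u; have /= ET := tr_nat (p2 T f) (fmap (S a) u).
  have /= ES := tr_nat (p2 S f) u.
  by rewrite /= -lcmpA ET lcmpA -fmap_cmp ES fmap_cmp lcmpA.
- by move=> a; apply: in1_cmp; (exact: r0_in) || exact: p1_in.
- move=> a b f M /=; apply: liso_cmp; last exact: p2_iso.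
  by apply: liso_fmap; apply: p2_iso.
- move=> a b f g u M /=.
  by rewrite -lcmpA p2_nat !lcmpA -!fmap_cmp p2_nat.
- move=> a b c g f M /=.
  rewrite -lcmpA p2_cmp !lcmpA -fmap_cmp p2_cmp !fmap_cmp -!lcmpA.
  congr (_ ** (_ ** _)); rewrite !lcmpA; congr (_ ** _).
  exact: (esym (tr_nat (p2 T g) (p2 S f M))).
- by move=> a M /=; rewrite -lcmpA p2_one -fmap_cmp p2_one.
Defined.

Definition modif_id (V W : rep2) (S : pnat V W) : modif S S.
Proof.
unshelve refine (@Modif V W S S (fun a => @Ltr _ _ (S a) (S a)
  (fun M => lid (S a M)) _) _).
- by move=> M N u; rewrite lcmp1l lcmp1r.
- by move=> a b f M /=; rewrite fmap_id lcmp1l lcmp1r.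
Defined.

Definition modif_vc (V W : rep2) (S T R : pnat V W) (n : modif T R)
  (m : modif S T) : modif S R.
Proof.
unshelve refine (@Modif V W S R (fun a => @Ltr _ _ (S a) (R a)
  (fun M => n a M ** m a M) _) _).
- by move=> M N u; rewrite -lcmpA tr_nat lcmpA tr_nat lcmpA.
- move=> a b f M /=; rewrite fmap_cmp lcmpA (md_nat n f M).
  by rewrite -(lcmpA _ (p2 T f M)) (md_nat m f M) lcmpA.
Defined.

Definition modif_hc (U V W : rep2) (T T' : pnat V W) (S S' : pnat U V)
  (n : modif T T') (m : modif S S') : modif (pnat_cmp T S) (pnat_cmp T' S').
Proof.
unshelve refine (@Modif U W (pnat_cmp T S) (pnat_cmp T' S')
  (fun a => @Ltr _ _ (lfun_cmp (T a) (S a)) (lfun_cmp (T' a) (S' a))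
  (fun M => n a (S' a M) ** fmap (T a) (m a M)) _) _).
- move=> M N u /=; rewrite -[LHS]lcmpA -fmap_cmp (tr_nat (m a) u) fmap_cmp.
  by rewrite [LHS]lcmpA (tr_nat (n a) (fmap (S' a) u)) lcmpA.
- move=> a b f M /=.
  have /= ET := tr_nat (p2 T f) (m a M).
  rewrite fmap_cmp -lcmpA (lcmpA (p2 T' f (S' a M))) (md_nat n f (S' a M)).
  rewrite -(lcmpA _ (p2 T f (S' a M))) ET !lcmpA; congr (_ ** _).
  by rewrite -(tr_nat (n b)) -!lcmpA -!fmap_cmp (md_nat m f M).
Defined.

(** The two composites have equal components, and this is the identity. *)
Definition modif_as (U V W Z : rep2) (R : pnat W Z) (T : pnat V W)
  (S : pnat U V) :
  modif (pnat_cmp R (pnat_cmp T S)) (pnat_cmp (pnat_cmp R T) S).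
Proof.
unshelve refine (@Modif U Z (pnat_cmp R (pnat_cmp T S)) (pnat_cmp (pnat_cmp R T) S)
  (fun a => @Ltr _ _ (lfun_cmp (R a) (lfun_cmp (T a) (S a)))
    (lfun_cmp (lfun_cmp (R a) (T a)) (S a)) (fun M => lid (R a (T a (S a M)))) _) _).
- by move=> M N u /=; rewrite lcmp1l lcmp1r.
- by move=> a b f M /=; rewrite fmap_id lcmp1l lcmp1r fmap_cmp lcmpA.
Defined.

Definition modif_lu (V W : rep2) (S : pnat V W) :
  modif (pnat_cmp (pnat_one W) S) S.
Proof.
unshelve refine (@Modif V W (pnat_cmp (pnat_one W) S) S
  (fun a => @Ltr _ _ (lfun_cmp (lfun_id (W a)) (S a)) (S a)
    (fun M => lid (S a M)) _) _).
- by move=> M N u /=; rewrite lcmp1l lcmp1r.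
- by move=> a b f M /=; rewrite fmap_id lcmp1l !lcmp1r.
Defined.

Definition modif_ru (V W : rep2) (S : pnat V W) :
  modif (pnat_cmp S (pnat_one V)) S.
Proof.
unshelve refine (@Modif V W (pnat_cmp S (pnat_one V)) S
  (fun a => @Ltr _ _ (lfun_cmp (S a) (lfun_id (V a))) (S a)
    (fun M => lid (S a M)) _) _).
- by move=> M N u /=; rewrite lcmp1l lcmp1r.
- by move=> a b f M /=; rewrite !fmap_id !lcmp1l lcmp1r.
Defined.

(** The 2-category of the 2-representations satisfying [Q], with all
    pseudo-natural transformations and modifications. *)
Definition rep_bicat (Q : rep2 -> Prop) : bicat.
Proof.
unshelve refine (@Bicat {V : rep2 | Q V}
  (fun V W => pnat (sval V) (sval W)) (fun V W S T => modif S T)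
  (fun V W S => modif_id S) (fun V W S T R n m => modif_vc n m)
  (fun V => pnat_one (sval V)) (fun U V W T S => pnat_cmp T S)
  (fun U V W T T' S S' n m => modif_hc n m)
  (fun U V W Z R T S => modif_as R T S)
  (fun V W S => modif_lu S) (fun V W S => modif_ru S)
  _ _ _ _ _ _ _ _ _ _ _ _ _).
- by move=> *; apply: modif_eq => a M /=; rewrite lcmpA.
- by move=> *; apply: modif_eq => a M /=; rewrite lcmp1l.
- by move=> *; apply: modif_eq => a M /=; rewrite lcmp1r.
- by move=> *; apply: modif_eq => a M /=; rewrite fmap_id lcmp1l.
- move=> U V W T T' T'' S S' S'' n' n m' m; apply: modif_eq => a M /=.
  rewrite fmap_cmp -!lcmpA; congr (_ ** _); rewrite !lcmpA; congr (_ ** _).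
  by rewrite tr_nat.
- move=> U V W Z R T S.
  unshelve eexists.
    unshelve refine (@Modif _ _ (pnat_cmp (pnat_cmp R T) S)
      (pnat_cmp R (pnat_cmp T S))
      (fun a => @Ltr _ _ (lfun_cmp (lfun_cmp (R a) (T a)) (S a))
        (lfun_cmp (R a) (lfun_cmp (T a) (S a)))
        (fun M => lid (R a (T a (S a M)))) _) _).
    + by move=> M N u /=; rewrite lcmp1l lcmp1r.
    + by move=> a b f M /=; rewrite fmap_id lcmp1l lcmp1r fmap_cmp lcmpA.
  by split; apply: modif_eq => a M /=; rewrite lcmp1l.
- move=> V W S; unshelve eexists.
    unshelve refine (@Modif _ _ S (pnat_cmp (pnat_one (sval W)) S)
      (fun a => @Ltr _ _ (S a) (lfun_cmp (lfun_id (sval W a)) (S a))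
        (fun M => lid (S a M)) _) _).
    + by move=> M N u /=; rewrite lcmp1l lcmp1r.
    + by move=> a b f M /=; rewrite fmap_id lcmp1l !lcmp1r.
  by split; apply: modif_eq => a M /=; rewrite lcmp1l.
- move=> V W S; unshelve eexists.
    unshelve refine (@Modif _ _ S (pnat_cmp S (pnat_one (sval V)))
      (fun a => @Ltr _ _ (S a) (lfun_cmp (S a) (lfun_id (sval V a)))
        (fun M => lid (S a M)) _) _).
    + by move=> M N u /=; rewrite lcmp1l lcmp1r.
    + by move=> a b f M /=; rewrite !fmap_id !lcmp1l lcmp1r.
  by split; apply: modif_eq => a M /=; rewrite lcmp1l.
- move=> U V W Z R R' T T' S S' r n m; apply: modif_eq => a M /=.
  by rewrite lcmp1l lcmp1r fmap_cmp lcmpA.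
- by move=> V W S S' m; apply: modif_eq => a M /=; rewrite !lcmp1l lcmp1r.
- move=> V W S S' m; apply: modif_eq => a M /=.
  by rewrite fmap_id lcmp1l !lcmp1r.
- move=> U V W Z Y Q' R T S; apply: modif_eq => a M /=.
  by rewrite !fmap_id !lcmp1l.
- move=> U V W T S; apply: modif_eq => a M /=.
  by rewrite !fmap_id !lcmp1l.
Defined.

End Rep.

Section Restriction.
Variables (A A' : lin2 k C) (F : lin2fun A A').

Definition restr0 (V : rep2 A') : rep2 A.
Proof.
unshelve refine (@Rep2 A V (@r0_in _ V) (fun a b f => r1 V f) (@r1_in _ V)
  (fun a b f g u => r2 V (fun2 F u)) _ _ _
  (fun a b c g f => rc V g f) (@rc_iso _ V) (ru V) (@ru_iso _ V) _ _ _ _).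
- by move=> a b f g M x u v /=; rewrite fun2_lin r2_lin.
- by move=> a b f M; rewrite fun2_id r2_id.
- by move=> a b f g h v u M; rewrite fun2_vcmp r2_vcmp.
- by move=> a b c g g' f f' v u M; rewrite fun2_hcmp rc_nat.
- by move=> a b c d h g f M; rewrite fun2_idto rc_assoc.
- by move=> a b f M; rewrite fun2_idto rc_unitl.
- by move=> a b f M; rewrite fun2_idto rc_unitr.
Defined.

Definition restr1 (V W : rep2 A') (S : pnat V W) : pnat (restr0 V) (restr0 W) :=
  @Pnat A (restr0 V) (restr0 W) S (@p1_in _ _ _ S) (fun a b f => p2 S f)
    (@p2_iso _ _ _ S) (fun a b f g u M => p2_nat S (fun2 F u) M)
    (@p2_cmp _ _ _ S) (@p2_one _ _ _ S).

Definition restr2 (V W : rep2 A') (S T : pnat V W) (m : modif S T) :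
  modif (restr1 S) (restr1 T) :=
  @Modif A (restr0 V) (restr0 W) (restr1 S) (restr1 T) m (@md_nat _ _ _ _ _ m).

Variables (Q' : rep2 A' -> Prop) (Q : rep2 A -> Prop).
Hypothesis QQ : forall V, Q' V -> Q (restr0 V).

Definition restriction : psfun (rep_bicat Q') (rep_bicat Q).
Proof.
unshelve refine (@Psfun (rep_bicat Q') (rep_bicat Q)
  (fun V => exist _ (restr0 (sval V)) (QQ (svalP V)))
  (fun V W S => restr1 S) (fun V W S T m => restr2 m) _ _ _ _ _ _ _ _ _ _).
- move=> U V W T S.
  unshelve refine (@Modif A _ _ (pnat_cmp (restr1 T) (restr1 S))
    (restr1 (pnat_cmp T S))
    (fun a => @Ltr _ _ (lfun_cmp (T a) (S a)) (lfun_cmp (T a) (S a))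
      (fun M => lid (T a (S a M))) _) _).
  + by move=> M N u; rewrite lcmp1l lcmp1r.
  + by move=> a b f M /=; rewrite fmap_id lcmp1l lcmp1r.
- move=> V.
  unshelve refine (@Modif A _ _ (pnat_one (restr0 (sval V)))
    (restr1 (pnat_one (sval V)))
    (fun a => @Ltr _ _ (lfun_id (sval V a)) (lfun_id (sval V a))
      (fun M => lid M) _) _).
  + by move=> M N u; rewrite lcmp1l lcmp1r.
  + by move=> a b f M /=; rewrite fmap_id lcmp1l.
- move=> U V W T S; unshelve eexists.
    unshelve refine (@Modif A _ _ (restr1 (pnat_cmp T S))
      (pnat_cmp (restr1 T) (restr1 S))
      (fun a => @Ltr _ _ (lfun_cmp (T a) (S a)) (lfun_cmp (T a) (S a))
        (fun M => lid (T a (S a M))) _) _).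
    + by move=> M N u; rewrite lcmp1l lcmp1r.
    + by move=> a b f M /=; rewrite fmap_id lcmp1l lcmp1r.
  by split; apply: modif_eq => a M /=; rewrite lcmp1l.
- move=> V; unshelve eexists.
    unshelve refine (@Modif A _ _ (restr1 (pnat_one (sval V)))
      (pnat_one (restr0 (sval V)))
      (fun a => @Ltr _ _ (lfun_id (sval V a)) (lfun_id (sval V a))
        (fun M => lid M) _) _).
    + by move=> M N u; rewrite lcmp1l lcmp1r.
    + by move=> a b f M /=; rewrite fmap_id lcmp1l.
  by split; apply: modif_eq => a M /=; rewrite lcmp1l.
- by move=> V W S; apply: modif_eq => a M.
- by move=> V W S T R n m; apply: modif_eq => a M.
- by move=> *; apply: modif_eq => a M /=; rewrite lcmp1l lcmp1r.
- by move=> *; apply: modif_eq => a M /=; rewrite !fmap_id !lcmp1l.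
- by move=> *; apply: modif_eq => a M /=; rewrite !lcmp1l.
- by move=> *; apply: modif_eq => a M /=; rewrite !fmap_id !lcmp1l.
Defined.

End Restriction.
End Representations.
End LinearCategories.

Section Integrable.
Variables (I : finType) (C : cartan I) (X Y : zmodType) (D : root_datum C X Y).
Variable B : lfsub (kbase C).

Definition integrable (A : lin2 (kbase C) (weights D)) (V : rep2 B A) : Prop :=
  forall (a : X) (M : V a) (s : I), exists n : nat,
    lzero (r1 V (Epow D s n a) M) /\ lzero (r1 V (Fpow D s n a) M).

Definition int_reps (A : lin2 (kbase C) (weights D)) : bicat :=
  rep_bicat (@integrable A).

Lemma integrable_restr (V : rep2 B (AA' D)) :
  integrable V -> integrable (restr0 (AA_AA' D) V).
Proof. by []. Qed.

Definition int_restriction : psfun (int_reps (AA' D)) (int_reps (AA D false)) :=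
  restriction integrable_restr.

End Integrable.

(* Main.v *)
From HB Require Import structures.
Require Import Defs.
From mathcomp Require Import all_boot all_order all_algebra.
From mathcomp Require Import boolp.

(** The canonical 2-functor [AA -> AA'] is an isomorphism of 2-categories, and
    restriction of 2-representations along an isomorphism is an equivalence
    ([restriction_equivalence]).

    The arrows [epsilon^l] and [eta^l] that [AA'] adds exist in [AA] already:
    [epstilde] is the counit of an adjunction in which [F_s] is left dual to [E_s]
    ([epstilde_counit]).  Sending [epsilon^l] to [epstilde] and [eta^l] to the
    corresponding unit therefore defines a 2-functor [inv_AA'] from [AA'] to
    [AA].  One composite is the identity because it fixes the generators.  The
    other one fixes [epsilon^l] because of the relation added in [AA']
    ([AA_AA'_epstilde]), and then it fixes [eta^l], because the unit of an
    adjunction is determined by its counit ([unit_unique], [left_dual_ext]).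

    The heart of the matter is the pair of zigzag identities for [epstilde] and
    a unit.  Let [n] be the value of the coroot at the source weight [lambda]
    of [E], so that the value at the target weight [lambda + alpha] is [n + 2].
    Up to sign, the counit is [epsilon x^n sigma'] for [n >= 0], where [sigma']
    is the component of [rho^-1] that inverts [sigma], and it is the last
    component of [rho^-1] for [n < 0].  The unit is, up to sign, the last
    component [c] of [rho^-1] at [lambda + alpha] for [n >= -1], and
    [sigma' x^(-n-2) eta] for [n <= -2].

    For [n >= 0] the zigzag on [E] asserts that [epsilon x^n] composed with
    [g = (E sigma')(c E) : E -> E E F] is the identity.  The braid relation,
    rotated by duality, says that the path [E E F -> E F E -> F E E] given by
    two copies of [sigma] intertwines the crossings [tau] at its ends.  From
    this and from the orthogonality of the components of [rho^-1], every
    component of the two maps [rho] along this path kills [tau g]; since both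
    [rho] are invertible, [tau g = 0].  Moving [n + 1] dots through the crossing
    in this vanishing arrow leaves [1] minus the zigzag ([zigzag_core]).  The
    zigzag on [F] is the same computation with dots and crossings replaced by
    their mates; negative weights are obtained upside down, in the opposite
    category ([zigzag_core_op]); the case [n = -1], where the two [rho] have
    opposite shapes, is separate ([zigzag_core_middle]).

    These computations take place in linear categories on which functors act,
    where composition is strictly associative.  They apply to the 2-category
    itself through its regular 2-representation, composition of 1-arrows, which
    is faithful ([act_inj]).  Conversely, a 2-functor out of [A1] is built from
    the presentation of the monoidal category, whose arrows carry no weight, by
    evaluating each generator at all weights simultaneously ([one_object],
    [to_words], [from_words]). *)

Set Implicit Arguments.
Unset Strict Implicit.
Unset Printing Implicit Defensive.

Import Order.TTheory GRing.Theory Num.Theory.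
Local Open Scope ring_scope.

Local Notation "v ** u" := (lcmp v u) (at level 40, left associativity).

(** * Linear categories *)

Section LinearMaps.
Variables (k : comNzRingType) (V W : lmodType k) (f : V -> W).
Hypothesis fl : linear f.

Lemma lin0 : f 0 = 0.
Proof. by have := fl (-1) 0 0; rewrite scaler0 addr0 scaleN1r addNr. Qed.
Lemma linZ c u : f (c *: u) = c *: f u.
Proof. by have := fl c u 0; rewrite lin0 !addr0. Qed.
Lemma linD u v : f (u + v) = f u + f v.
Proof. by have := fl 1 u v; rewrite !scale1r. Qed.
Lemma linN u : f (- u) = - f u.
Proof. by rewrite -!scaleN1r linZ. Qed.
Lemma lin_sum (J : Type) (r : seq J) (P : pred J) (u : J -> V) :
  f (\sum_(j <- r | P j) u j) = \sum_(j <- r | P j) f (u j).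
Proof. by apply: (big_morph f); [apply: linD | apply: lin0]. Qed.
End LinearMaps.

Section Lcat.
Variables (k : comNzRingType) (V : lcat k).
Implicit Types (M N P : V).

Lemma lcmp0l M N P (u : lhom M N) : (0 : lhom N P) ** u = 0.
Proof. exact: (lin0 (lcmp_linl u)). Qed.
Lemma lcmp0r M N P (v : lhom N P) : v ** (0 : lhom M N) = 0.
Proof. exact: (lin0 (lcmp_linr v)). Qed.
Lemma lcmpDl M N P (v w : lhom N P) (u : lhom M N) :
  (v + w) ** u = v ** u + w ** u.
Proof. exact: (linD (lcmp_linl u)). Qed.
Lemma lcmpDr M N P (v : lhom N P) (u w : lhom M N) :
  v ** (u + w) = v ** u + v ** w.
Proof. exact: (linD (lcmp_linr v)). Qed.
Lemma lcmpNl M N P (v : lhom N P) (u : lhom M N) : (- v) ** u = - (v ** u).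
Proof. exact: (linN (lcmp_linl u)). Qed.
Lemma lcmpNr M N P (v : lhom N P) (u : lhom M N) : v ** (- u) = - (v ** u).
Proof. exact: (linN (lcmp_linr v)). Qed.
Lemma lcmpZl M N P c (v : lhom N P) (u : lhom M N) :
  (c *: v) ** u = c *: (v ** u).
Proof. exact: (linZ (lcmp_linl u)). Qed.
Lemma lcmpZr M N P c (v : lhom N P) (u : lhom M N) :
  v ** (c *: u) = c *: (v ** u).
Proof. exact: (linZ (lcmp_linr v)). Qed.
Lemma lcmp_suml M N P (J : Type) (r : seq J) (Q : pred J)
  (v : J -> lhom N P) (u : lhom M N) :
  (\sum_(j <- r | Q j) v j) ** u = \sum_(j <- r | Q j) v j ** u.
Proof. exact: (lin_sum (lcmp_linl u)). Qed.

Fact lcat_key : unit. Proof. exact: tt. Qed.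
(** The definition is locked: rewriting with [lcmpA] would otherwise unfold a
    power and reassociate inside it. *)
Definition lpow M (u : lhom M M) (n : nat) : lhom M M :=
  locked_with lcat_key (iter n (lcmp u) (lid M)).

Lemma lpow0 M (u : lhom M M) : lpow u 0 = lid M.
Proof. by rewrite /lpow !locked_withE. Qed.
Lemma lpowS M (u : lhom M M) n : lpow u n.+1 = u ** lpow u n.
Proof. by rewrite /lpow !locked_withE. Qed.
Lemma lpowSr M (u : lhom M M) n : lpow u n.+1 = lpow u n ** u.
Proof.
elim: n => [|n IH]; first by rewrite ?lpowS !lpow0 ?lcmp1l ?lcmp1r.
by rewrite lpowS {1}IH lcmpA -lpowS.
Qed.
Lemma lpow_comm M N (u : lhom M M) (v : lhom N N) (w : lhom M N) n :
  w ** u = v ** w -> w ** lpow u n = lpow v n ** w.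
Proof.
move=> wu; elim: n => [|n IH]; first by rewrite ?lpowS !lpow0 ?lcmp1l ?lcmp1r.
by rewrite !lpowS lcmpA wu -lcmpA IH lcmpA.
Qed.

Definition lcat_op : lcat k.
Proof.
apply: (@Lcat k V (fun M N => lhom N M) (fun M => lid M)
  (fun M N P v u => u ** v)).
- by move=> *; rewrite lcmpA.
- by move=> *; rewrite lcmp1r.
- by move=> *; rewrite lcmp1l.
- by move=> *; apply: lcmp_linr.
- by move=> *; apply: lcmp_linl.
Defined.

End Lcat.

Lemma lpow_op (k : comNzRingType) (V : lcat k) (M : V) (u : lhom M M) n :
  @lpow k (lcat_op V) M u n = lpow u n.
Proof. by elim: n => [|n IH]; [rewrite !lpow0 | rewrite [LHS]lpowSr [RHS]lpowS -IH]. Qed.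

Section Lfun.
Variables (k : comNzRingType) (V W : lcat k) (F : lfun V W).

Lemma fmap0 (M N : V) : fmap F (0 : lhom M N) = 0.
Proof. exact: (lin0 (@fmap_lin _ _ _ F M N)). Qed.
Lemma fmapD (M N : V) (u v : lhom M N) : fmap F (u + v) = fmap F u + fmap F v.
Proof. exact: (linD (@fmap_lin _ _ _ F M N)). Qed.
Lemma fmapN (M N : V) (u : lhom M N) : fmap F (- u) = - fmap F u.
Proof. exact: (linN (@fmap_lin _ _ _ F M N)). Qed.
Lemma fmapZ (M N : V) c (u : lhom M N) : fmap F (c *: u) = c *: fmap F u.
Proof. exact: (linZ (@fmap_lin _ _ _ F M N)). Qed.
Lemma fmap_sum (M N : V) (J : Type) (r : seq J) (Q : pred J)
  (u : J -> lhom M N) :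
  fmap F (\sum_(j <- r | Q j) u j) = \sum_(j <- r | Q j) fmap F (u j).
Proof. exact: (lin_sum (@fmap_lin _ _ _ F M N)). Qed.
Lemma fmap_pow (M : V) (u : lhom M M) n : fmap F (lpow u n) = lpow (fmap F u) n.
Proof. by elim: n => [|n IH]; [rewrite !lpow0 fmap_id | rewrite !lpowS fmap_cmp IH]. Qed.
End Lfun.

(** * The computation behind the zigzag identities *)

(** The intended reading is [P = E E F], [Q = E F E], [R = F E E] and [O = E],
    applied to some object.  [s1] and [s2] are the two copies of [sigma], [T] and
    [U] are crossings of the two [E], [e] and [f] are the caps, [x1] and [x2] are
    dots on the outer and on the inner [E] of [P], [y] is a dot on the capped [E]
    of [Q], [xO] is a dot on [O], and [s1'], [b], [s2'], [c] are the components of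
    the inverses of [rho] at weights of value [n] and [n + 2]. *)
Section Core.
Variables (k : comNzRingType) (V : lcat k) (P Q R O : V).
Variables (s1 : lhom P Q) (s2 : lhom Q R) (T : lhom P P) (U : lhom R R).
Variables (e : lhom P O) (f : lhom Q O).
Variables (kappa : k) (x1 x2 : lhom P P) (y : lhom Q Q) (xO : lhom O O).
Variables (n : nat) (s1' : lhom Q P) (s2' : lhom R Q).
Variables (b : 'I_n -> lhom O P) (c : 'I_n.+2 -> lhom O Q).
Hypothesis braid : U ** s2 ** s1 = s2 ** s1 ** T.
Hypothesis TT : T ** T = 0.
Hypothesis fs1 : f ** s1 = e ** T.
Hypothesis Tx : T ** x1 = x2 ** T + kappa *: lid P.
Hypothesis x12 : x1 ** x2 = x2 ** x1.
Hypothesis ys1 : y ** s1 = s1 ** x1.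
Hypothesis ex1 : e ** x1 = xO ** e.

(** Each dot that passes the crossing leaves a term without crossing, in which
    the remaining dots sit on both strands. *)
Lemma dots_through_crossing a :
  e ** lpow x2 a ** T = f ** lpow y a ** s1
    - kappa *: (\sum_(p < a) lpow xO (a - p.+1) ** (e ** lpow x2 p)).
Proof.
elim: a => [|a IH].
  by rewrite !lpow0 !lcmp1r big_ord0 scaler0 subr0 fs1.
have E2 : x2 ** T = T ** x1 - kappa *: lid P by rewrite Tx addrK.
rewrite (lpowSr x2) (lpowSr y) !lcmpA -(lcmpA _ x2 T) E2 lcmpDr lcmpNr lcmpZr lcmp1r.
rewrite lcmpA IH lcmpDl lcmpNl lcmpZl -!lcmpA -ys1 -addrA; congr (_ + _).
rewrite big_ord_recr /= subnn lpow0 lcmp1l scalerDr opprD; congr (_ - _).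
congr (- (_ *: _)); rewrite lcmp_suml; apply: eq_bigr => p _.
have -> : (a.+1 - p.+1 = (a - p.+1).+1)%N by rewrite -subSn ?ltn_ord.
rewrite -!lcmpA.
have -> : lpow x2 p ** x1 = x1 ** lpow x2 p by rewrite (lpow_comm _ x12).
by rewrite [e ** _]lcmpA ex1 -[in LHS]lcmpA (lcmpA _ xO) -lpowSr.
Qed.

Hypothesis s1K : s1 ** s1' = lid Q.
Hypothesis es1' : forall i : 'I_n, e ** lpow x2 i ** s1' = 0.
Hypothesis s1_tot : s1' ** s1 + \sum_(i < n) b i ** (e ** lpow x2 i) = lid P.
Hypothesis s2_tot : s2' ** s2 + \sum_(i < n.+2) c i ** (f ** lpow y i) = lid Q.
Hypothesis s2c : s2 ** c ord_max = 0.
Hypothesis fc : forall i : 'I_n.+2,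
  f ** lpow y i ** c ord_max = (if i == ord_max then lid O else 0).

(** With [g = s1' c], the arrow [T g] vanishes: [(s1, e x2^i)] and [(s2, f y^i)]
    are jointly monic, and every composite of their components kills it.  Hence
    [e x2^(n+1) T g = 0], while moving the [n + 1] dots through the crossing turns
    this arrow into [f y^(n+1) c = 1] minus the wanted composite; the other
    terms contain [e x2^p s1' = 0] with [p < n]. *)
Lemma zigzag_core : kappa *: (e ** lpow x2 n ** s1' ** c ord_max) = lid O.
Proof.
(* [z] and [t] are the two kinds of dotted caps of [g]: without and with the
   crossing. *)
pose g := s1' ** c ord_max.
pose z a := e ** lpow x2 a ** g.
pose t a := e ** lpow x2 a ** T ** g.
have z0 a : (a < n)%N -> z a = 0.
  by move=> an; rewrite /z /g lcmpA (es1' (Ordinal an)) lcmp0l.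
have tE a : (a < n.+2)%N -> t a = (if a == n.+1 then lid O else 0)
    - kappa *: \sum_(p < a) lpow xO (a - p.+1) ** z p.
  move=> an; rewrite /t dots_through_crossing lcmpDl lcmpNl lcmpZl.
  congr (_ - _ *: _).
    by rewrite /g -!lcmpA (lcmpA s1) s1K lcmp1l lcmpA (fc (Ordinal an)).
  by rewrite lcmp_suml; apply: eq_bigr => p _; rewrite -lcmpA.
have t0 a : (a <= n)%N -> t a = 0.
  move=> an; rewrite tE; last by rewrite ltnS ltnW.
  rewrite ltn_eqF ?ltnS // big1 ?scaler0 ?subr0 // => p _.
  by rewrite z0 ?lcmp0r // (leq_trans (ltn_ord p)).
(* Two crossings cancel, so that only terms with at most [n] dots on [T g] remain. *)
have fs1T j : (j < n.+2)%N -> f ** lpow y j ** s1 ** T ** g = 0.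
  move=> jn; have := dots_through_crossing j.
  move=> /(congr1 (fun u => u ** T ** g)).
  rewrite -(lcmpA _ T T) TT lcmp0r lcmp0l !lcmpDl !lcmpNl !lcmpZl.
  move=> /eqP; rewrite eq_sym subr_eq0 => /eqP ->.
  rewrite !lcmp_suml big1 ?scaler0 // => p _.
  have := t0 p; rewrite /t => tp.
  by rewrite -!lcmpA in tp *; rewrite tp ?lcmp0r // -ltnS (leq_trans (ltn_ord p)).
have s1T : s1 ** T ** g = 0.
  rewrite -[LHS]lcmp1l -s2_tot lcmpDl lcmp_suml big1 ?addr0 => [|i _].
    rewrite -!lcmpA (lcmpA s2) (lcmpA (s2 ** s1)) -braid.
    by rewrite -!lcmpA (lcmpA s1) s1K lcmp1l s2c !lcmp0r.
  have := fs1T i (ltn_ord i); rewrite -!lcmpA => ->; exact: lcmp0r.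
have Tg : T ** g = 0.
  rewrite -[LHS]lcmp1l -s1_tot lcmpDl -lcmpA (lcmpA s1) s1T lcmp0r add0r.
  rewrite lcmp_suml big1 // => i _.
  have := t0 i (ltnW (ltn_ord i)); rewrite /t -!lcmpA => ->; exact: lcmp0r.
have := tE n.+1 (ltnSn _); rewrite /t -lcmpA Tg lcmp0r eqxx big_ord_recr /=.
rewrite big1 ?add0r => [|p _]; last by rewrite z0 ?lcmp0r.
rewrite subnn lpow0 lcmp1l /z /g !lcmpA => /eqP.
by rewrite eq_sym subr_eq0 => /eqP <-.
Qed.

End Core.

(** The same configuration when [rho] has value [-1] and [1] at the two weights:
    it is [(sigma, eta) : E F + 1 -> F E] at the first and
    [(sigma, epsilon) : E F -> F E + 1] at the second, with [u] and [v] the cups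
    and [d] the component of the first inverse next to [s1']. *)
Section CoreMiddle.
Variables (k : comNzRingType) (V : lcat k) (P Q R O : V).
Variables (s1 : lhom P Q) (s2 : lhom Q R) (T : lhom P P) (U : lhom R R).
Variables (e : lhom P O) (f : lhom Q O).
Variables (u : lhom O Q) (v : lhom O R) (d : lhom Q O) (s1' : lhom Q P).
Variables (s2' : lhom R Q) (c : lhom O Q).
Hypothesis braid : U ** s2 ** s1 = s2 ** s1 ** T.
Hypothesis TT : T ** T = 0.
Hypothesis fs1 : f ** s1 = e ** T.
Hypothesis UU : U ** U = 0.
Hypothesis s2u : s2 ** u = U ** v.
Hypothesis s1_tot : s1 ** s1' + u ** d = lid Q.
Hypothesis s1K : s1' ** s1 = lid P.
Hypothesis s2_tot : s2' ** s2 + c ** f = lid Q.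
Hypothesis s2c : s2 ** c = 0.
Hypothesis fc : f ** c = lid O.
Hypothesis fu : f ** u = lid O.

(** Splitting the identity in [f c = 1] along [rho] at the first weight gives
    [f s1 s1' c + f u d c = e T s1' c + d c], and [T s1' c = 0] because all
    components of both [rho] kill it: here two crossings meet both in [f s1 T]
    and in [U s2 u]. *)
Lemma zigzag_core_middle : d ** c = lid O.
Proof.
have s1T : s1 ** (T ** s1' ** c) = 0.
  rewrite -[LHS]lcmp1l -s2_tot lcmpDl -!lcmpA (lcmpA f s1) fs1.
  rewrite -(lcmpA e) (lcmpA T T) TT lcmp0l !lcmp0r addr0.
  rewrite (lcmpA s2 s1) (lcmpA (s2 ** s1)) -braid -!lcmpA.
  have -> : s1 ** (s1' ** c) = c - u ** d ** c.
    by rewrite -[X in X - _]lcmp1l -s1_tot lcmpDl -lcmpA addrK.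
  rewrite lcmpDr s2c add0r lcmpNr -lcmpA (lcmpA s2) s2u -lcmpA lcmpNr.
  by rewrite (lcmpA U U) UU lcmp0l oppr0 lcmp0r.
have T0 : T ** s1' ** c = 0 by rewrite -[LHS]lcmp1l -s1K -lcmpA s1T lcmp0r.
have : f ** (s1 ** s1' + u ** d) ** c = lid O by rewrite s1_tot lcmp1r fc.
rewrite lcmpDr lcmpDl !lcmpA fs1 fu lcmp1l -2!lcmpA (lcmpA T) T0 lcmp0r.
by rewrite add0r.
Qed.
End CoreMiddle.

Section CoreOp.
Variables (k : comNzRingType) (V : lcat k) (P Q R O : V).
Variables (s1 : lhom Q P) (s2 : lhom R Q) (T : lhom P P) (U : lhom R R).
Variables (e : lhom O P) (f : lhom O Q).
Variables (kappa : k) (x1 x2 : lhom P P) (y : lhom Q Q) (xO : lhom O O).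
Variables (n : nat) (s1' : lhom P Q) (s2' : lhom Q R).
Variables (b : 'I_n -> lhom P O) (c : 'I_n.+2 -> lhom Q O).
Hypothesis braid : T ** s1 ** s2 = s1 ** s2 ** U.
Hypothesis TT : T ** T = 0.
Hypothesis s1f : s1 ** f = T ** e.
Hypothesis xT : x1 ** T = T ** x2 + kappa *: lid P.
Hypothesis x12 : x1 ** x2 = x2 ** x1.
Hypothesis s1y : s1 ** y = x1 ** s1.
Hypothesis x1e : x1 ** e = e ** xO.
Hypothesis s1K : s1' ** s1 = lid Q.
Hypothesis s1'e : forall i : 'I_n, s1' ** (lpow x2 i ** e) = 0.
Hypothesis s1_tot : s1 ** s1' + \sum_(i < n) lpow x2 i ** e ** b i = lid P.
Hypothesis s2_tot : s2 ** s2' + \sum_(i < n.+2) lpow y i ** f ** c i = lid Q.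
Hypothesis cs2 : c ord_max ** s2 = 0.
Hypothesis cf : forall i : 'I_n.+2,
  c ord_max ** (lpow y i ** f) = (if i == ord_max then lid O else 0).

(** All hypotheses are those of [zigzag_core] with arrows reversed. *)
Lemma zigzag_core_op : kappa *: (c ord_max ** (s1' ** (lpow x2 n ** e))) = lid O.
Proof.
rewrite -(lpow_op x2).
apply: (@zigzag_core k (lcat_op V) P Q R O s1 s2 T U e f kappa x1 x2 y xO n
  s1' s2' b c); rewrite /= ?lcmpA //.
- by move=> i; rewrite lpow_op.
- by under eq_bigr => i _ do rewrite lpow_op.
- by under eq_bigr => i _ do rewrite lpow_op.
- by move=> i; rewrite lpow_op.
Qed.
End CoreOp.

(** * Adjunctions and crossings *)

(** Only components are recorded, no functor of natural transformations: then
    whiskering by a functor is [fmap] or evaluation at an image, and composition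
    is strictly associative. *)
Record adj (k : comNzRingType) (V W : lcat k) := Adj {
  lE : lfun V W;
  lF : lfun W V;
  ep : forall N : W, lhom (lE (lF N)) N;
  et : forall M : V, lhom M (lF (lE M));
  ep_nat : forall (N N' : W) (g : lhom N N'),
    ep N' ** fmap lE (fmap lF g) = g ** ep N;
  et_nat : forall (M M' : V) (g : lhom M M'),
    et M' ** g = fmap lF (fmap lE g) ** et M;
  zigE : forall M : V, ep (lE M) ** fmap lE (et M) = lid (lE M);
  zigF : forall N : W, fmap lF (ep N) ** et (lF N) = lid (lF N)
}.

Section Adjunction.
Variables (k : comNzRingType) (V W : lcat k) (a : adj V W).
Local Notation E := (lE a).
Local Notation F := (lF a).

(** The transpose of [X] under the adjunction. *)
Definition flat (A : V) (B : W) (X : lhom (E A) B) : lhom A (F B) :=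
  locked_with lcat_key (fmap F X ** et a A).

Lemma flatE (A : V) (B : W) (X : lhom (E A) B) : flat X = fmap F X ** et a A.
Proof. by rewrite /flat locked_withE. Qed.

Lemma flatK (A : V) (B : W) (X : lhom (E A) B) : ep a B ** fmap E (flat X) = X.
Proof. by rewrite !flatE fmap_cmp lcmpA ep_nat -lcmpA zigE lcmp1r. Qed.

Lemma adj_inj (A : V) (B : W) (g h : lhom A (F B)) :
  ep a B ** fmap E g = ep a B ** fmap E h -> g = h.
Proof.
have K u : fmap F (ep a B ** fmap E u) ** et a A = u.
  by rewrite fmap_cmp -lcmpA -et_nat lcmpA zigF lcmp1l.
by move=> gh; rewrite -(K g) gh K.
Qed.

Lemma flat_post (A : V) (B B' : W) (Z : lhom B B') (X : lhom (E A) B) :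
  fmap F Z ** flat X = flat (Z ** X).
Proof. by rewrite !flatE fmap_cmp lcmpA. Qed.

Lemma flat_pre (A A' : V) (B : W) (X : lhom (E A) B) (h : lhom A' A) :
  flat X ** h = flat (X ** fmap E h).
Proof. by rewrite !flatE fmap_cmp -!lcmpA et_nat. Qed.

Section Dot.
Variable x : forall M : V, lhom (E M) (E M).
Hypothesis x_nat : forall (M M' : V) (g : lhom M M'),
  x M' ** fmap E g = fmap E g ** x M.

(** The mate of the dot: a dot on the strand [F]. *)
Definition dual_dot (N : W) : lhom (F N) (F N) :=
  locked_with lcat_key (flat (ep a N ** x (F N))).

Lemma dual_dotE N : dual_dot N = flat (ep a N ** x (F N)).
Proof. by rewrite /dual_dot locked_withE. Qed.
Lemma ep_dual_dot N : ep a N ** fmap E (dual_dot N) = ep a N ** x (F N).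
Proof. by rewrite dual_dotE flatK. Qed.

Lemma ep_dual_dot_pow N i :
  ep a N ** fmap E (lpow (dual_dot N) i) = ep a N ** lpow (x (F N)) i.
Proof.
elim: i => [|i IH]; first by rewrite !lpow0 fmap_id.
by rewrite !lpowS fmap_cmp lcmpA ep_dual_dot -lcmpA x_nat lcmpA IH -!lcmpA -lpowSr lpowS.
Qed.

Lemma dual_dot_nat (N N' : W) (g : lhom N N') :
  fmap F g ** dual_dot N = dual_dot N' ** fmap F g.
Proof.
rewrite !dual_dotE flat_post flat_pre; congr flat.
by rewrite lcmpA -ep_nat -!lcmpA x_nat.
Qed.

Lemma dual_dot_et M i :
  lpow (dual_dot (E M)) i ** et a M = fmap F (lpow (x M) i) ** et a M.
Proof.
elim: i => [|i IH]; first by rewrite !lpow0 fmap_id.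
rewrite lpowSr lpowS fmap_cmp -!lcmpA -IH.
have -> : dual_dot (E M) ** et a M = fmap F (x M) ** et a M.
  apply: adj_inj; rewrite !fmap_cmp !lcmpA ep_dual_dot ep_nat.
  by rewrite -!lcmpA x_nat zigE lcmp1r lcmpA zigE lcmp1l.
rewrite !lcmpA; congr (_ ** _); apply/esym/lpow_comm.
exact: dual_dot_nat.
Qed.
End Dot.
End Adjunction.

Section Crossing.
Variables (k : comNzRingType) (V0 V1 V2 : lcat k).
Variables (a0 : adj V0 V1) (a1 : adj V1 V2).
Local Notation E0 := (lE a0).
Local Notation F0 := (lF a0).
Local Notation E1 := (lE a1).
Local Notation F1 := (lF a1).
Variables (x0 : forall M : V0, lhom (E0 M) (E0 M)).
Variables (x1 : forall M : V1, lhom (E1 M) (E1 M)).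
Variables (t : forall M : V0, lhom (E1 (E0 M)) (E1 (E0 M))).

(** The nil Hecke relations on two strands of one label; the braid relation
    involves a third functor and stays apart. *)
Record nilHecke : Prop := NilHecke {
  x0_nat : forall (M M' : V0) (g : lhom M M'),
    x0 M' ** fmap E0 g = fmap E0 g ** x0 M;
  x1_nat : forall (M M' : V1) (g : lhom M M'),
    x1 M' ** fmap E1 g = fmap E1 g ** x1 M;
  t_nat : forall (M M' : V0) (g : lhom M M'),
    t M' ** fmap E1 (fmap E0 g) = fmap E1 (fmap E0 g) ** t M;
  t_nil : forall M, t M ** t M = 0;
  t_dotl : forall M, t M ** x1 (E0 M) = fmap E1 (x0 M) ** t M + lid _;
  t_dotr : forall M, t M ** fmap E1 (x0 M) = x1 (E0 M) ** t M - lid _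
}.

(** The composite [sigma] of unit, crossing and counit, written as a transpose
    of the last two. *)
Definition sig (M : V1) : lhom (E0 (F0 M)) (F1 (E1 M)) :=
  locked_with lcat_key (flat (fmap E1 (ep a0 M) ** t (F0 M))).
Lemma sigE M : sig M = flat (fmap E1 (ep a0 M) ** t (F0 M)).
Proof. by rewrite /sig locked_withE. Qed.

(** The counit of the composite adjunction. *)
Definition e2 (N : V2) : lhom (E1 (E0 (F0 (F1 N)))) N :=
  locked_with lcat_key (ep a1 N ** fmap E1 (ep a0 (F1 N))).
Lemma e2E N : e2 N = ep a1 N ** fmap E1 (ep a0 (F1 N)).
Proof. by rewrite /e2 locked_withE. Qed.

(** The mate of the crossing: a crossing of two strands [F]. *)
Definition dual_t (N : V2) : lhom (F0 (F1 N)) (F0 (F1 N)) :=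
  locked_with lcat_key (flat (flat (e2 N ** t (F0 (F1 N))))).
Lemma dual_tE N : dual_t N = flat (flat (e2 N ** t (F0 (F1 N)))).
Proof. by rewrite /dual_t locked_withE. Qed.

Lemma e2_inj (A : V0) (N : V2) (g h : lhom A (F0 (F1 N))) :
  e2 N ** fmap E1 (fmap E0 g) = e2 N ** fmap E1 (fmap E0 h) -> g = h.
Proof.
by rewrite e2E -!lcmpA -!fmap_cmp => /adj_inj/adj_inj.
Qed.

Lemma e2_dual_t N : e2 N ** fmap E1 (fmap E0 (dual_t N)) = e2 N ** t (F0 (F1 N)).
Proof. by rewrite {1}e2E -lcmpA -fmap_cmp dual_tE !flatK. Qed.

(** The pitchfork moves: [sig] is the crossing turned by a cap, so that a cap or
    a cup slides through it.  [dual_cap_sig] and [dual_sig_cup] do this on the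
    strand that runs downwards, where the crossing becomes its mate. *)
Lemma cap_sig M :
  ep a1 (E1 M) ** fmap E1 (sig M) = fmap E1 (ep a0 M) ** t (F0 M).
Proof. by rewrite sigE flatK. Qed.

Definition epx i (M : V1) : lhom (E0 (F0 M)) M :=
  locked_with lcat_key (ep a0 M ** lpow (x0 (F0 M)) i).
Lemma epxE i M : epx i M = ep a0 M ** lpow (x0 (F0 M)) i.
Proof. by rewrite /epx locked_withE. Qed.
Definition etx i (M : V1) : lhom M (F1 (E1 M)) :=
  locked_with lcat_key (fmap F1 (lpow (x1 M) i) ** et a1 M).
Lemma etxE i M : etx i M = fmap F1 (lpow (x1 M) i) ** et a1 M.
Proof. by rewrite /etx locked_withE. Qed.

(** For a coroot of value [n >= 0]: the components [sp] and [c] of the inverse of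
    [rho], whose own components are [sig] and the caps with fewer than [n] dots.
    The five equations are the entries of the two matrix products. *)
Definition pos_inv n (sp : forall M, lhom (F1 (E1 M)) (E0 (F0 M)))
    (c : 'I_n -> forall M, lhom M (E0 (F0 M))) : Prop :=
  forall M, [/\ sig M ** sp M = lid _, forall i : 'I_n, epx i M ** sp M = 0,
    sp M ** sig M + \sum_(i < n) c i M ** epx i M = lid _,
    forall i, sig M ** c i M = 0 &
    forall i j : 'I_n, epx i M ** c j M = if i == j then lid _ else 0].

(** The same for a coroot of value [-n <= 0], with cups in place of caps. *)
Definition neg_inv n (sp : forall M, lhom (F1 (E1 M)) (E0 (F0 M)))
    (d : 'I_n -> forall M, lhom (F1 (E1 M)) M) : Prop :=
  forall M, [/\ sp M ** sig M = lid _, forall i : 'I_n, sp M ** etx i M = 0,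
    sig M ** sp M + \sum_(i < n) etx i M ** d i M = lid _,
    forall i, d i M ** sig M = 0 &
    forall i j : 'I_n, d j M ** etx i M = if i == j then lid _ else 0].

Hypothesis H : nilHecke.

Lemma sig_nat (M M' : V1) (g : lhom M M') :
  fmap F1 (fmap E1 g) ** sig M = sig M' ** fmap E0 (fmap F0 g).
Proof.
rewrite !sigE flat_post flat_pre; congr flat.
by rewrite -[RHS]lcmpA (t_nat H) !lcmpA -!fmap_cmp ep_nat.
Qed.

Lemma dual_t_nil N : dual_t N ** dual_t N = 0.
Proof.
apply: e2_inj; rewrite !fmap_cmp lcmpA e2_dual_t -lcmpA (t_nat H).
by rewrite lcmpA e2_dual_t -lcmpA (t_nil H) !fmap0 !lcmp0r.
Qed.

(** Taking mates exchanges the two strands, so this follows from the relation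
    [t_dotr]. *)
Lemma dual_t_dot N :
  dual_t N ** fmap F0 (dual_dot x1 N)
  = dual_dot x0 (F1 N) ** dual_t N + lid _.
Proof.
have D1 : e2 N ** fmap E1 (fmap E0 (fmap F0 (dual_dot x1 N)))
    = e2 N ** x1 (E0 (F0 (F1 N))).
  rewrite e2E -!lcmpA -fmap_cmp ep_nat fmap_cmp lcmpA ep_dual_dot.
  by rewrite -!lcmpA (x1_nat H).
have D0 : e2 N ** fmap E1 (fmap E0 (dual_dot x0 (F1 N)))
    = e2 N ** fmap E1 (x0 (F0 (F1 N))).
  by rewrite e2E -!lcmpA -!fmap_cmp ep_dual_dot.
apply: e2_inj; rewrite !fmapD lcmpDr !fmap_cmp !fmap_id lcmp1r !lcmpA D0 e2_dual_t.
rewrite -!lcmpA (t_nat H) lcmpA D1 -fmap_cmp (x0_nat H) fmap_cmp.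
by rewrite (lcmpA (e2 N)) e2_dual_t -!lcmpA (t_dotr H) lcmpDr lcmpNr lcmp1r subrK.
Qed.

Lemma dual_cap_sig N :
  fmap F1 (ep a1 N) ** sig (F1 N) = ep a0 (F1 N) ** fmap E0 (dual_t N).
Proof.
apply: adj_inj; rewrite !fmap_cmp lcmpA ep_nat -lcmpA cap_sig.
by rewrite !lcmpA -e2E e2_dual_t.
Qed.

Lemma sig_cup M : sig (E0 M) ** fmap E0 (et a0 M) = fmap F1 (t M) ** et a1 (E0 M).
Proof.
apply: adj_inj; rewrite !fmap_cmp !lcmpA cap_sig ep_nat -!lcmpA (t_nat H).
by rewrite lcmpA -fmap_cmp zigE fmap_id lcmp1l zigE lcmp1r.
Qed.

Lemma dual_sig_cup (N : V1) :
  fmap F0 (sig N) ** et a0 (F0 N) = dual_t (E1 N) ** fmap F0 (et a1 N).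
Proof.
apply: e2_inj; rewrite !fmap_cmp !lcmpA e2_dual_t -[RHS]lcmpA (t_nat H).
rewrite !e2E -!lcmpA (lcmpA (fmap E1 (ep a0 _)) _ (t _)) -!fmap_cmp ep_nat.
rewrite [X in ep a0 _ ** X]fmap_cmp (lcmpA (ep a0 _)) ep_nat -lcmpA zigE lcmp1r cap_sig.
by rewrite fmap_cmp !lcmpA zigE lcmp1l.
Qed.
End Crossing.

Section Ladder.
Variables (k : comNzRingType) (V0 V1 V2 V3 : lcat k).
Variables (a0 : adj V0 V1) (a1 : adj V1 V2) (a2 : adj V2 V3).
Local Notation E0 := (lE a0).
Local Notation F0 := (lF a0).
Local Notation E1 := (lE a1).
Local Notation F1 := (lF a1).
Local Notation E2 := (lE a2).
Local Notation F2 := (lF a2).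
Variables (x0 : forall M : V0, lhom (E0 M) (E0 M)).
Variables (x1 : forall M : V1, lhom (E1 M) (E1 M)).
Variables (x2 : forall M : V2, lhom (E2 M) (E2 M)).
Variables (t01 : forall M : V0, lhom (E1 (E0 M)) (E1 (E0 M))).
Variables (t12 : forall M : V1, lhom (E2 (E1 M)) (E2 (E1 M))).
Hypothesis H01 : nilHecke x0 x1 t01.
Hypothesis H12 : nilHecke x1 x2 t12.
Hypothesis t_braid : forall M : V0,
  t12 (E0 M) ** fmap E2 (t01 M) ** t12 (E0 M)
  = fmap E2 (t01 M) ** t12 (E0 M) ** fmap E2 (t01 M).

Local Notation sig1 := (sig t01).
Local Notation sig2 := (sig t12).

(** The braid relation with its third strand bent down by a cap.  The error term
    of the relation is absent as all strands have the same label. *)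
Lemma sig_braid M :
  fmap F2 (t12 M) ** sig2 (E1 M) ** fmap E1 (sig1 M)
  = sig2 (E1 M) ** fmap E1 (sig1 M) ** t01 (F0 M).
Proof.
have S : sig2 (E1 M) ** fmap E1 (sig1 M)
    = flat (fmap E2 (fmap E1 (ep a0 M)) ** fmap E2 (t01 (F0 M))
            ** t12 (E0 (F0 M))).
  rewrite (sigE _ (E1 M)) flat_pre -lcmpA (t_nat H12) lcmpA -fmap_cmp cap_sig.
  by rewrite fmap_cmp.
rewrite -lcmpA S flat_post flat_pre; congr flat.
rewrite !lcmpA (t_nat H12) -!lcmpA; congr (_ ** _).
by rewrite !lcmpA t_braid.
Qed.

(** The braid relation with two strands bent down. *)
Lemma dual_sig_braid N :
  dual_t t12 (E2 N) ** fmap F1 (sig2 N) ** sig1 (F1 N)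
  = fmap F1 (sig2 N) ** sig1 (F1 N) ** fmap E0 (dual_t t01 N).
Proof.
have S : e2 a1 a2 (E2 N) ** fmap E2 (fmap E1 (fmap F1 (sig2 N) ** sig1 (F1 N)))
    = fmap E2 (e2 a0 a1 N) ** t12 (E0 (F0 (F1 N))) ** fmap E2 (t01 (F0 (F1 N))).
  rewrite e2E -!lcmpA -!fmap_cmp [X in ep a1 _ ** X]fmap_cmp (lcmpA (ep a1 _)) ep_nat.
  rewrite -lcmpA cap_sig !fmap_cmp !lcmpA cap_sig e2E fmap_cmp.
  by rewrite -!lcmpA (lcmpA (t12 _)) (t_nat H12) !lcmpA.
apply: (@e2_inj _ _ _ _ a1 a2).
set w := fmap F1 _ ** _ in S *; rewrite -[dual_t t12 _ ** _ ** _]lcmpA -/w.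
rewrite [fmap E1 (dual_t _ _ ** w)]fmap_cmp [fmap E2 (_ ** fmap E1 w)]fmap_cmp.
rewrite [fmap E1 (w ** _)]fmap_cmp [fmap E2 (fmap E1 w ** _)]fmap_cmp.
rewrite !lcmpA e2_dual_t S -[LHS]lcmpA (t_nat H12) lcmpA S.
rewrite -!lcmpA -fmap_cmp (t_nat H01) fmap_cmp.
rewrite (lcmpA (t12 _) _ (fmap E2 (t01 _))) (t_nat H12) -!lcmpA.
rewrite (lcmpA (fmap E2 (e2 _ _ _)) (fmap E2 (fmap E1 _))) -fmap_cmp e2_dual_t.
by rewrite fmap_cmp -!lcmpA; congr (_ ** _); rewrite !lcmpA t_braid.
Qed.

(** In each of the following six lemmas the hypotheses of the core lemma are
    rotated forms of the nil Hecke and inversion relations.  On [E] the path is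
    [E E F -> E F E -> F E E] with the given dots and crossing; on [F] it is
    [E F F -> F E F -> F F E], with their mates. *)
Lemma zigzagE_pos n s1 c1 s2 c2 :
  pos_inv x0 t01 (n := n) s1 c1 -> pos_inv x1 t12 (n := n.+2) s2 c2 ->
  forall M : V1, fmap E1 (epx x0 n M ** s1 M) ** c2 ord_max (E1 M) = lid _.
Proof.
move=> i1 i2 M; have [s1K es1 tot1 _ _] := i1 M.
have [_ _ tot2 s2c fc] := i2 (E1 M).
have ex i : fmap E1 (ep a0 M) ** lpow (fmap E1 (x0 (F0 M))) i
    = fmap E1 (epx x0 i M) by rewrite -fmap_pow -fmap_cmp epxE.
have fx i : ep a1 (E1 M) ** lpow (x1 (F1 (E1 M))) i = epx x1 i (E1 M).
  by rewrite epxE.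
have := zigzag_core (kappa := 1) (x1 := x1 _) (x2 := fmap E1 (x0 (F0 M)))
  (y := x1 _) (xO := x1 M) (n := n) (s1' := fmap E1 (s1 M)) (s2' := s2 (E1 M))
  (b := fun i => fmap E1 (c1 i M)) (c := fun i => c2 i (E1 M))
  (sig_braid M) (t_nil H01 _) (cap_sig _ M).
rewrite ex => Z; rewrite fmap_cmp -[LHS]scale1r; apply: Z.
- by rewrite scale1r (t_dotl H01).
- exact: (x1_nat H01).
- exact: (x1_nat H01).
- exact/esym/(x1_nat H01).
- by rewrite -fmap_cmp s1K fmap_id.
- by move=> i; rewrite ex -fmap_cmp es1 fmap0.
- under eq_bigr => i _ do rewrite ex -fmap_cmp.
  by rewrite -fmap_cmp -fmap_sum -fmapD tot1 fmap_id.
- by under eq_bigr => i _ do rewrite fx.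
- exact: s2c.
- by move=> i; rewrite fx fc.
Qed.

Lemma zigzagF_pos n s1 c1 s2 c2 :
  pos_inv x0 t01 (n := n) s1 c1 -> pos_inv x1 t12 (n := n.+2) s2 c2 ->
  forall N : V2, epx x0 n (F1 N) ** s1 (F1 N) ** fmap F1 (c2 ord_max N) = lid _.
Proof.
move=> i1 i2 N; have [s1K es1 tot1 _ _] := i1 (F1 N).
have [_ _ tot2 s2c fc] := i2 N.
have ex i : ep a0 (F1 N) ** lpow (fmap E0 (dual_dot x0 (F1 N))) i
    = epx x0 i (F1 N).
  by rewrite -fmap_pow (ep_dual_dot_pow (x0_nat H01)) epxE.
have fx i : fmap F1 (ep a1 N) ** lpow (fmap F1 (fmap E1 (dual_dot x1 N))) i
    = fmap F1 (epx x1 i N).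
  by rewrite -!fmap_pow -fmap_cmp (ep_dual_dot_pow (x1_nat H01)) epxE.
have TT : fmap E0 (dual_t t01 N) ** fmap E0 (dual_t t01 N) = 0.
  by rewrite -fmap_cmp (dual_t_nil H01) fmap0.
have := zigzag_core (kappa := 1) (x1 := fmap E0 (fmap F0 (dual_dot x1 N)))
  (x2 := fmap E0 (dual_dot x0 (F1 N))) (y := fmap F1 (fmap E1 (dual_dot x1 N)))
  (xO := dual_dot x1 N) (n := n) (s1' := s1 (F1 N)) (s2' := fmap F1 (s2 N))
  (b := fun i => c1 i (F1 N)) (c := fun i => fmap F1 (c2 i N))
  (dual_sig_braid N) TT (dual_cap_sig _ _).
rewrite ex => Z; rewrite -[LHS]scale1r; apply: Z.
- by rewrite scale1r -!fmap_cmp (dual_t_dot H01) fmapD fmap_id.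
- by rewrite -!fmap_cmp -(dual_dot_nat (x0_nat H01)).
- exact: (sig_nat H01).
- exact: ep_nat.
- exact: s1K.
- by move=> i; rewrite ex es1.
- by under eq_bigr => i _ do rewrite ex.
- under eq_bigr => i _ do rewrite fx -fmap_cmp.
  by rewrite -fmap_cmp -fmap_sum -fmapD tot2 fmap_id.
- by rewrite -fmap_cmp s2c fmap0.
- by move=> i; rewrite fx -fmap_cmp fc; case: eqP; rewrite ?fmap_id ?fmap0.
Qed.

(** Seen upside down the crossing exchanges its two dot relations, whence the
    sign [-1]. *)
Lemma zigzagE_neg n s1 d1 s2 d2 :
  neg_inv x1 t01 (n := n.+2) s1 d1 -> neg_inv x2 t12 (n := n) s2 d2 ->
  forall M : V1,
    fmap E1 (d1 ord_max M) ** (s2 (E1 M) ** etx x2 n (E1 M)) = - lid _.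
Proof.
move=> i1 i2 M; have [_ _ tot1 ds1 de1] := i1 M.
have [s2K se2 tot2 _ _] := i2 (E1 M).
have ex i : lpow (fmap F2 (x2 (E1 M))) i ** et a2 (E1 M) = etx x2 i (E1 M).
  by rewrite etxE -fmap_pow.
have fx i : lpow (fmap E1 (fmap F1 (x1 M))) i ** fmap E1 (et a1 M)
    = fmap E1 (etx x1 i M).
  by rewrite etxE -!fmap_pow -fmap_cmp.
have xT : fmap F2 (fmap E2 (x1 M)) ** fmap F2 (t12 M)
    = fmap F2 (t12 M) ** fmap F2 (x2 (E1 M)) + -1 *: lid _.
  by rewrite -!fmap_cmp (t_dotl H12) fmapD fmap_id scaleN1r addrK.
have := zigzag_core_op (kappa := -1) (x1 := fmap F2 (fmap E2 (x1 M)))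
  (x2 := fmap F2 (x2 (E1 M))) (y := fmap E1 (fmap F1 (x1 M)))
  (xO := x1 M) (n := n) (s1' := s2 (E1 M)) (s2' := fmap E1 (s1 M))
  (b := fun i => d2 i (E1 M)) (c := fun i => fmap E1 (d1 i M))
  (sig_braid M) _ (sig_cup H12 M) xT.
rewrite ex scaleN1r => Z; rewrite -[LHS]opprK; congr (- _); apply: Z.
- by rewrite -fmap_cmp (t_nil H12) fmap0.
- by rewrite -!fmap_cmp (x1_nat H12).
- by rewrite (sig_nat H12).
- by rewrite et_nat.
- exact: s2K.
- by move=> i; rewrite ex se2.
- by under eq_bigr => i _ do rewrite ex.
- under eq_bigr => i _ do rewrite fx -fmap_cmp.
  by rewrite -fmap_cmp -fmap_sum -fmapD tot1 fmap_id.
- by rewrite -fmap_cmp ds1 fmap0.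
- by move=> i; rewrite fx -fmap_cmp de1; case: eqP; rewrite ?fmap_id ?fmap0.
Qed.

Lemma zigzagF_neg n s1 d1 s2 d2 :
  neg_inv x1 t01 (n := n.+2) s1 d1 -> neg_inv x2 t12 (n := n) s2 d2 ->
  forall N : V2,
    d1 ord_max (F1 N) ** fmap F1 (s2 N ** etx x2 n N) = - lid _.
Proof.
move=> i1 i2 N; have [_ _ tot1 ds1 de1] := i1 (F1 N).
have [s2K se2 tot2 _ _] := i2 N.
have ex i : lpow (fmap F1 (dual_dot x2 (E2 N))) i ** fmap F1 (et a2 N)
    = fmap F1 (etx x2 i N).
  by rewrite -fmap_pow -fmap_cmp (dual_dot_et (x1_nat H12)) etxE.
have fx i : lpow (dual_dot x1 (E1 (F1 N))) i ** et a1 (F1 N) = etx x1 i (F1 N).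
  by rewrite (dual_dot_et (x1_nat H01)) etxE.
have xT : dual_dot x1 (F2 (E2 N)) ** dual_t t12 (E2 N)
    = dual_t t12 (E2 N) ** fmap F1 (dual_dot x2 (E2 N)) + -1 *: lid _.
  by rewrite (dual_t_dot H12) scaleN1r addrK.
have := zigzag_core_op (kappa := -1) (x1 := dual_dot x1 (F2 (E2 N)))
  (x2 := fmap F1 (dual_dot x2 (E2 N))) (y := dual_dot x1 (E1 (F1 N)))
  (xO := dual_dot x1 N) (n := n) (s1' := fmap F1 (s2 N)) (s2' := s1 (F1 N))
  (b := fun i => fmap F1 (d2 i N)) (c := fun i => d1 i (F1 N))
  (dual_sig_braid N) (dual_t_nil H12 _) (dual_sig_cup H12 N) xT.
rewrite ex scaleN1r => Z; rewrite fmap_cmp -[LHS]opprK; congr (- _); apply: Z.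
- by rewrite (dual_dot_nat (x1_nat H01)).
- by rewrite (dual_dot_nat (x1_nat H01)).
- by rewrite (dual_dot_nat (x1_nat H01)).
- by rewrite -fmap_cmp s2K fmap_id.
- by move=> i; rewrite ex -fmap_cmp se2 fmap0.
- under eq_bigr => i _ do rewrite ex -fmap_cmp.
  by rewrite -fmap_cmp -fmap_sum -fmapD tot2 fmap_id.
- by under eq_bigr => i _ do rewrite fx.
- by rewrite ds1.
- by move=> i; rewrite fx de1.
Qed.

Lemma zigzagE_mid s1 d1 s2 c2 :
  neg_inv x1 t01 (n := 1) s1 d1 -> pos_inv x1 t12 (n := 1) s2 c2 ->
  forall M : V1, fmap E1 (d1 ord_max M) ** c2 ord_max (E1 M) = lid _.
Proof.
move=> i1 i2 M; have [s1K _ tot1 ds1 de1] := i1 M.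
have [_ _ tot2 s2c fc] := i2 (E1 M).
move: tot1 tot2 (fc ord_max ord_max).
rewrite !big_ord1 !epxE !etxE eqxx /= !lpow0 fmap_id lcmp1l lcmp1r.
rewrite !(ord1 ord_max) => tot1 tot2 fc1.
apply: (zigzag_core_middle (sig_braid M) (t_nil H01 _) (cap_sig _ _)
  (u := fmap E1 (et a1 M)) (v := et a2 (E1 M)) (s1' := fmap E1 (s1 M))
  (s2' := s2 (E1 M))).
- by rewrite -fmap_cmp (t_nil H12) fmap0.
- exact: (sig_cup H12).
- by rewrite -!fmap_cmp -fmapD tot1 fmap_id.
- by rewrite -fmap_cmp s1K fmap_id.
- exact: tot2.
- exact: s2c.
- exact: fc1.
- exact: zigE.
Qed.

Lemma zigzagF_mid s1 d1 s2 c2 :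
  neg_inv x1 t01 (n := 1) s1 d1 -> pos_inv x1 t12 (n := 1) s2 c2 ->
  forall N : V2, d1 ord_max (F1 N) ** fmap F1 (c2 ord_max N) = lid _.
Proof.
move=> i1 i2 N; have [s1K _ tot1 ds1 de1] := i1 (F1 N).
have [_ _ tot2 s2c fc] := i2 N.
move: tot1 tot2 (fc ord_max ord_max).
rewrite !big_ord1 !epxE !etxE eqxx /= !lpow0 fmap_id lcmp1l lcmp1r.
rewrite !(ord1 ord_max) => tot1 tot2 fc1.
have TT : fmap E0 (dual_t t01 N) ** fmap E0 (dual_t t01 N) = 0.
  by rewrite -fmap_cmp (dual_t_nil H01) fmap0.
apply: (zigzag_core_middle (dual_sig_braid N) TT (dual_cap_sig _ _)
  (u := et a1 (F1 N)) (v := fmap F1 (et a2 N)) (s1' := s1 (F1 N))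
  (s2' := fmap F1 (s2 N))).
- exact: (dual_t_nil H12).
- exact: (dual_sig_cup H12).
- exact: tot1.
- exact: s1K.
- by rewrite -!fmap_cmp -fmapD tot2 fmap_id.
- by rewrite -fmap_cmp s2c fmap0.
- by rewrite -fmap_cmp fc1 fmap_id.
- exact: zigF.
Qed.
End Ladder.

(** * The regular 2-representation *)

Section Regular.
Variables (k : comNzRingType) (C : cat1) (A : lin2 k C).
Implicit Types (a b c d z : C).

Lemma idto_refl a b (f : hom1 a b) (e : f = f) : idto A e = id2 A f.
Proof. by rewrite (Prop_irrelevance e (erefl f)). Qed.

Lemma idtoK a b (f g : hom1 a b) (e : f = g) :
  vcmp (idto A (esym e)) (idto A e) = id2 A f.
Proof. by case: _ / e; rewrite vcmp1l. Qed.

(** Composition of 1-arrows is associative and unital only up to propositional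
    equality; [cst] absorbs such equalities, so that 2-arrows whose ends are
    equal but not convertible can be composed and compared. *)
Definition cst a b (P P' Q Q' : hom1 a b) (e : P = P') (e' : Q = Q')
    (g : hom2 A P' Q') : hom2 A P Q :=
  vcmp (idto A (esym e')) (vcmp g (idto A e)).

Lemma cst_id a b (P Q : hom1 a b) (e : P = P) (e' : Q = Q) (g : hom2 A P Q) :
  cst e e' g = g.
Proof. by rewrite /cst !idto_refl vcmp1l vcmp1r. Qed.

Lemma cst_cst a b (P P' P'' Q Q' Q'' : hom1 a b) (e1 : P = P') (e2 : P' = P'')
    (e : P = P'') (e1' : Q = Q') (e2' : Q' = Q'') (e' : Q = Q'')
    (g : hom2 A P'' Q'') : cst e1 e1' (cst e2 e2' g) = cst e e' g.
Proof. by subst; rewrite !cst_id. Qed.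

Lemma cst_vc a b (P P' Q Q' R R' : hom1 a b) (e : P = P') (e' : Q = Q')
    (e'' : R = R') (h : hom2 A Q' R') (g : hom2 A P' Q') :
  vcmp (cst e' e'' h) (cst e e' g) = cst e e'' (vcmp h g).
Proof. by subst; rewrite !cst_id. Qed.

Lemma cst_hc a b c (P P' Q Q' : hom1 b c) (R R' S S' : hom1 a b)
    (e1 : P = P') (e2 : Q = Q') (e3 : R = R') (e4 : S = S')
    (e5 : cmp P R = cmp P' R') (e6 : cmp Q S = cmp Q' S')
    (h : hom2 A P' Q') (g : hom2 A R' S') :
  hcmp (cst e1 e2 h) (cst e3 e4 g) = cst e5 e6 (hcmp h g).
Proof. by subst; rewrite !cst_id. Qed.

Lemma cst_trans a b (P P' P'' Q Q' Q'' : hom1 a b) (e1 : P = P') (e2 : P' = P'')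
    (e1' : Q = Q') (e2' : Q' = Q'') (g : hom2 A P'' Q'') :
  cst e1 e1' (cst e2 e2' g) = cst (etrans e1 e2) (etrans e1' e2') g.
Proof. exact: cst_cst. Qed.

Lemma cst_irr a b (P P' Q Q' : hom1 a b) (e1 e2 : P = P') (e1' e2' : Q = Q')
    (g : hom2 A P' Q') : cst e1 e1' g = cst e2 e2' g.
Proof. by rewrite (Prop_irrelevance e1 e2) (Prop_irrelevance e1' e2'). Qed.

Lemma cst_hcl a b c (P P' Q Q' : hom1 b c) (R S : hom1 a b)
    (e1 : P = P') (e2 : Q = Q') (h : hom2 A P' Q') (g : hom2 A R S) :
  hcmp (cst e1 e2 h) g
  = cst (congr1 (fun p => cmp p R) e1) (congr1 (fun p => cmp p S) e2) (hcmp h g).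
Proof. by subst; rewrite !cst_id. Qed.

Lemma cst_hcr a b c (P Q : hom1 b c) (R R' S S' : hom1 a b)
    (e1 : R = R') (e2 : S = S') (h : hom2 A P Q) (g : hom2 A R' S') :
  hcmp h (cst e1 e2 g)
  = cst (congr1 (cmp P) e1) (congr1 (cmp Q) e2) (hcmp h g).
Proof. by subst; rewrite !cst_id. Qed.

Lemma cst_id2 a b (P Q R : hom1 a b) (e : P = R) (e' : Q = R) (e'' : P = Q) :
  cst e e' (id2 A R) = idto A e''.
Proof. by subst; rewrite cst_id idto_refl. Qed.

Lemma cst_lin a b (P P' Q Q' : hom1 a b) (e : P = P') (e' : Q = Q') :
  linear (cst (P := P) (Q := Q) e e').
Proof. by move=> x u v; rewrite /cst vcmp_linl vcmp_linr. Qed.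

Lemma hcmpA_cst a b c d (h h' : hom1 c d) (g g' : hom1 b c) (f f' : hom1 a b)
    (e : cmp h (cmp g f) = cmp (cmp h g) f)
    (e' : cmp h' (cmp g' f') = cmp (cmp h' g') f')
    (w : hom2 A h h') (v : hom2 A g g') (u : hom2 A f f') :
  hcmp w (hcmp v u) = cst e e' (hcmp (hcmp w v) u).
Proof.
rewrite /cst (Prop_irrelevance e (cmpA h g f)) -[X in vcmp _ X]hcmpA vcmpA.
rewrite (Prop_irrelevance e' (cmpA h' g' f')).
rewrite (idtoK (cmpA h' g' f')).
by rewrite vcmp1l.
Qed.

Lemma hcmp1l_cst a b (f f' : hom1 a b) (e : cmp (Defs.one b) f = f)
    (e' : cmp (Defs.one b) f' = f') (u : hom2 A f f') :
  hcmp (id2 A (Defs.one b)) u = cst e e' u.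
Proof.
rewrite /cst (Prop_irrelevance e (cmp1l f)) -[X in vcmp _ X]hcmp1l vcmpA.
rewrite (Prop_irrelevance e' (cmp1l f')).
rewrite (idtoK (cmp1l f')).
by rewrite vcmp1l.
Qed.

Lemma hcmp1r_cst a b (f f' : hom1 a b) (e : cmp f (Defs.one a) = f)
    (e' : cmp f' (Defs.one a) = f') (u : hom2 A f f') :
  hcmp u (id2 A (Defs.one a)) = cst e e' u.
Proof.
rewrite /cst (Prop_irrelevance e (cmp1r f)) -[X in vcmp _ X]hcmp1r vcmpA.
rewrite (Prop_irrelevance e' (cmp1r f')).
rewrite (idtoK (cmp1r f')).
by rewrite vcmp1l.
Qed.

(** The regular 2-representation attached to [z] sends [a] to the category of
    1-arrows from [z] to [a], and 1-arrows act by composition. *)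
Definition reg0 z a : lcat k.
Proof.
apply: (@Lcat k (hom1 z a) (fun P Q => hom2 A P Q) (fun P => id2 A P)
  (fun P Q R v u => vcmp v u)).
- by move=> *; apply: vcmpA.
- by move=> *; apply: vcmp1l.
- by move=> *; apply: vcmp1r.
- by move=> *; apply: vcmp_linl.
- by move=> *; apply: vcmp_linr.
Defined.

Definition reg1 z a b (u : hom1 a b) : lfun (reg0 z a) (reg0 z b).
Proof.
apply: (@Lfun k (reg0 z a) (reg0 z b) (fun M => cmp u M)
  (fun M N g => hcmp (id2 A u) g)).
- by move=> M N; apply: hcmp_linr.
- by move=> M; apply: hcmp_id.
- by move=> M N P v w; have := Defs.interchange (id2 A u) (id2 A u) v w; rewrite vcmp1l.
Defined.

(** [Phi] is a strict form of [reg1 u]: the same functor up to equality of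
    1-arrows, for which for instance [Phi M] may be [cmp v (cmp w M)] when
    [u] is [cmp v w]. *)
Record real z a b (u : hom1 a b) (Phi : lfun (reg0 z a) (reg0 z b)) : Prop :=
  Real {
    real_ob : forall M : hom1 z a, Phi M = cmp u M :> hom1 z b;
    real_map : forall (M N : hom1 z a) (g : hom2 A M N) (e : Phi M = cmp u M)
      (e' : Phi N = cmp u N), fmap Phi g = cst e e' (hcmp (id2 A u) g)
  }.

Lemma real_reg1 z a b (u : hom1 a b) : real u (reg1 z u).
Proof. by split=> // M N g e e'; rewrite cst_id. Qed.

Lemma real_one z a (u : hom1 a a) : u = Defs.one a -> real u (lfun_id (reg0 z a)).
Proof.
move=> ->; split=> [M|M N g e e'] /=; first by rewrite cmp1l.
by rewrite (hcmp1l_cst (esym e) (esym e')) (cst_cst _ _ (erefl _) _ _ (erefl _)) cst_id.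
Qed.

Lemma real_cmp z a b c (u : hom1 b c) (v : hom1 a b) (w : hom1 a c) Phi Psi :
  real (z := z) u Phi -> real (z := z) v Psi -> w = cmp u v ->
  real w (lfun_cmp Phi Psi).
Proof.
move=> [uo um] [vo vm] ->; split=> [M|M N g e e'] /=.
  by rewrite uo vo cmpA.
rewrite (um _ _ _ (uo _) (uo _)) (vm _ _ _ (vo _) (vo _)).
have E M' : cmp u (Psi M') = cmp u (cmp v M') by rewrite vo.
rewrite -{1}(cst_id (erefl u) (erefl u) (id2 A u)).
rewrite (cst_hc _ _ _ _ (E _) (E _)) -hcmp_id.
rewrite (hcmpA_cst (cmpA _ _ _) (cmpA _ _ _)).
have E' M' : cmp u (Psi M') = cmp (cmp u v) M' by rewrite E cmpA.
by rewrite (cst_cst _ _ (E' _) _ _ (E' _)) (cst_cst _ _ e _ _ e').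
Qed.

(** A 2-arrow acts on [M] by whiskering.  The ends [P] and [Q] are left free so
    that they can be iterated values of functors, in which no association of
    1-arrows is visible. *)
Definition act z a b (u v : hom1 a b) (f : hom2 A u v) (M : hom1 z a)
    (P Q : hom1 z b) (e : P = cmp u M) (e' : Q = cmp v M) : hom2 A P Q :=
  cst e e' (hcmp f (id2 A M)).

Lemma act_irr z a b (u v : hom1 a b) (f : hom2 A u v) (M : hom1 z a)
    (P Q : hom1 z b) (e1 e2 : P = cmp u M) (e1' e2' : Q = cmp v M) :
  act f e1 e1' = act f e2 e2'.
Proof. by rewrite (Prop_irrelevance e1 e2) (Prop_irrelevance e1' e2'). Qed.

Lemma act_id z a b (u : hom1 a b) (M : hom1 z a) (P : hom1 z b)
    (e e' : P = cmp u M) : act (id2 A u) e e' = id2 A P.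
Proof.
by move: e' (e); rewrite e => e1 e2; rewrite /act hcmp_id cst_id.
Qed.

Lemma act_vc z a b (u v w : hom1 a b) (g : hom2 A v w) (f : hom2 A u v)
    (M : hom1 z a) (P Q R : hom1 z b) (e : P = cmp u M) (e' : Q = cmp v M)
    (e'' : R = cmp w M) :
  act (vcmp g f) e e'' = vcmp (act g e' e'') (act f e e').
Proof. by rewrite /act cst_vc -Defs.interchange vcmp1l. Qed.

Lemma act_lin z a b (u v : hom1 a b) (M : hom1 z a) (P Q : hom1 z b)
    (e : P = cmp u M) (e' : Q = cmp v M) :
  linear (fun f : hom2 A u v => act f e e').
Proof. by move=> x f g; rewrite /act hcmp_linl cst_lin. Qed.

Lemma act_cst z a b (u u' v v' : hom1 a b) (eu : u = u') (ev : v = v')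
    (f : hom2 A u' v') (M : hom1 z a) (P Q : hom1 z b)
    (e : P = cmp u M) (e' : Q = cmp v M) (e1 : P = cmp u' M)
    (e1' : Q = cmp v' M) : act (cst eu ev f) e e' = act f e1 e1'.
Proof. by subst u' v'; rewrite cst_id; apply: act_irr. Qed.

Lemma act_nat z a b (u v : hom1 a b) Phi Psi (f : hom2 A u v)
    (ru : real (z := z) u Phi) (rv : real (z := z) v Psi)
    (M N : hom1 z a) (g : hom2 A M N) eM eM' eN eN' :
  vcmp (act (M := N) (P := Phi N) (Q := Psi N) f eN eN') (fmap Phi g)
  = vcmp (fmap Psi g) (act (M := M) (P := Phi M) (Q := Psi M) f eM eM').
Proof.
rewrite /act (real_map ru g eM eN) (real_map rv g eM' eN') !cst_vc.
by rewrite -!Defs.interchange !vcmp1l !vcmp1r.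
Qed.

(** Whiskering on the left by [u] becomes the functor of [u], and whiskering on
    the right by [f] becomes evaluation at the image of [M] ([act_whiskr]): this
    turns diagrams into composites in a linear category. *)
Lemma act_whisk z a b c (u : hom1 b c) (f f' : hom1 a b) (w w' : hom1 a c)
    (g : hom2 A f f') (ew : w = cmp u f) (ew' : w' = cmp u f')
    (M : hom1 z a) (Phi : lfun (reg0 z b) (reg0 z c)) (ru : real u Phi)
    (P Q : hom1 z b) (e : P = cmp f M) (e' : Q = cmp f' M)
    (e1 : Phi P = cmp w M) (e1' : Phi Q = cmp w' M) :
  act (cst ew ew' (hcmp (id2 A u) g)) e1 e1' = fmap Phi (act g e e').
Proof.
subst w w' P Q; rewrite /act !cst_id (real_map ru _ (real_ob ru _) (real_ob ru _)).
rewrite (hcmpA_cst (cmpA _ _ _) (cmpA _ _ _)).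
by rewrite (cst_cst _ _ e1 _ _ e1').
Qed.

Lemma act_whiskr z a b c (u u' : hom1 b c) (f : hom1 a b) (w w' : hom1 a c)
    (g : hom2 A u u') (ew : w = cmp u f) (ew' : w' = cmp u' f)
    (M : hom1 z a) (N : hom1 z b) (eN : N = cmp f M) (P Q : hom1 z c)
    (e : P = cmp u N) (e' : Q = cmp u' N)
    (e1 : P = cmp w M) (e1' : Q = cmp w' M) :
  act (cst ew ew' (hcmp g (id2 A f))) e1 e1' = act g e e'.
Proof.
subst w w' N P Q; rewrite /act !cst_id -hcmp_id.
by rewrite (hcmpA_cst (cmpA _ _ _) (cmpA _ _ _)); congr cst; apply: Prop_irrelevance.
Qed.

Lemma act_wh z a b c d (u : hom1 c d) (w w' : hom1 b c) (v : hom1 a b)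
    (g : hom2 A w w') (Phi : lfun (reg0 z c) (reg0 z d)) (ru : real u Phi)
    (M : hom1 z a) (N : hom1 z b) (eN : N = cmp v M) (P Q : hom1 z c)
    (e : P = cmp w N) (e' : Q = cmp w' N)
    (e1 : Phi P = cmp (cmp u (cmp w v)) M)
    (e1' : Phi Q = cmp (cmp u (cmp w' v)) M) :
  act (hcmp (id2 A u) (hcmp g (id2 A v))) e1 e1' = fmap Phi (act g e e').
Proof.
have eP : P = cmp (cmp w v) M by rewrite e eN cmpA.
have eQ : Q = cmp (cmp w' v) M by rewrite e' eN cmpA.
rewrite -[hcmp (id2 A u) _](cst_id (erefl _) (erefl _)) (act_whisk _ _ _ ru eP eQ).
by rewrite -[hcmp g _](cst_id (erefl _) (erefl _)) (act_whiskr _ _ _ eN e e').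
Qed.

(** The regular 2-representation is faithful: a 2-arrow is recovered from its
    action on an identity 1-arrow. *)
Lemma act_inj a b (u v : hom1 a b) (f g : hom2 A u v) (P Q : hom1 a b)
    (e : P = cmp u (Defs.one a)) (e' : Q = cmp v (Defs.one a)) :
  act f e e' = act g e e' -> f = g.
Proof.
have eP : P = u by rewrite e cmp1r.
have eQ : Q = v by rewrite e' cmp1r.
have K h : act h e e' = cst eP eQ h.
  rewrite /act (hcmp1r_cst (cmp1r _) (cmp1r _)); exact: cst_cst.
rewrite !K => /(congr1 (cst (esym eP) (esym eQ))).
by rewrite !(cst_cst _ _ (erefl _) _ _ (erefl _)) !cst_id.
Qed.
End Regular.

(** * Relations between the generating 2-arrows *)

(** [Qpol s s = 0] makes the quadratic relation and the braid relation for one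
    label homogeneous. *)
Section Generators.
Variables (I : finType) (C : cartan I) (l : bool) (s : I).
Local Notation W := (words I).
Local Notation H u v := (@hom2 (kbase C) W (B1 C l) tt tt u v).
Local Notation "v *o u" := (@vcmp _ W (B1 C l) tt tt _ _ _ v u)
  (at level 40, left associativity).
Local Notation "[E]" := [:: LE s].
Local Notation "[F]" := [:: LF s].
Local Notation x := (bx C l s).
Local Notation tau := (btau C l s s).

Lemma btau_nil : tau *o tau = 0.
Proof.
apply: etrans (eval_rel (rel_quad C l s s)) _.
rewrite /tQ /tsumn eval_tsum big1 // => p _; exfalso.
by case: p => p /=; rewrite /Qpol eqxx size_poly0.
Qed.

Lemma btau_dotl :
  tau *o bwh [::] [E] x = bwh [E] [::] x *o tau + id2 (B1 C l) (a := tt) (b := tt) [:: LE s; LE s].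
Proof.
have : tau *o bwh [::] [E] x + -1 *: (bwh [E] [::] x *o tau)
  = id2 (B1 C l) (a := tt) (b := tt) [:: LE s; LE s].
  exact: (eval_rel (rel_dotl_eq C l s)).
rewrite scaleN1r => /eqP.
by rewrite subr_eq addrC => /eqP.
Qed.

Lemma btau_dotr :
  tau *o bwh [E] [::] x = bwh [::] [E] x *o tau - id2 (B1 C l) (a := tt) (b := tt) [:: LE s; LE s].
Proof.
have : tau *o bwh [E] [::] x + -1 *: (bwh [::] [E] x *o tau)
  = -1 *: id2 (B1 C l) (a := tt) (b := tt) [:: LE s; LE s].
  exact: (eval_rel (rel_dotr_eq C l s)).
rewrite !scaleN1r => /eqP.
by rewrite subr_eq addrC => /eqP.
Qed.

Lemma btau_braid :
  bwh [::] [E] tau *o bwh [E] [::] tau *o bwh [::] [E] tau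
  = bwh [E] [::] tau *o bwh [::] [E] tau *o bwh [E] [::] tau.
Proof.
have : bwh [::] [E] tau *o bwh [E] [::] tau *o bwh [::] [E] tau
  + -1 *: (bwh [E] [::] tau *o bwh [::] [E] tau *o bwh [E] [::] tau) = 0.
  apply: etrans (eval_rel (rel_braid_eq C l s s)) _.
  rewrite /tQdiff /tsumn eval_tsum big1 // => p _.
  by exfalso; case: p => p /=; rewrite /Qpol eqxx size_poly0.
by rewrite scaleN1r => /eqP; rewrite subr_eq0 => /eqP.
Qed.

Lemma bdualE :
  bwh [::] [E] (bcounit C l s) *o bwh [E] [::] (bunit C l s)
  = id2 (B1 C l) (a := tt) (b := tt) [E].
Proof. exact: (eval_rel (rel_dualE C l s)). Qed.

Lemma bdualF :
  bwh [F] [::] (bcounit C l s) *o bwh [::] [F] (bunit C l s)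
  = id2 (B1 C l) (a := tt) (b := tt) [F].
Proof. exact: (eval_rel (rel_dualF C l s)). Qed.
End Generators.

(** * From weights to words *)

Section WordFamilies.
Variables (I : finType) (C : cartan I) (X Y : zmodType) (D : root_datum C X Y).
Variable A : lin2 (kbase C) (weights D).
Local Notation k := (kbase C).
Local Notation word := (seq (letter I)).
Local Notation wt := (wt D).
Implicit Types (x y z : X) (f g w : word).

Definition wd x y w (hw : wt w = y - x) : @hom1 (weights D) x y := exist _ w hw.

Lemma wd_eq x y w (h h' : wt w = y - x) : wd h = wd h'.
Proof. exact: whom_inj. Qed.

Lemma wd_congr x y w w' (e : w = w') (h : wt w = y - x) (h' : wt w' = y - x) :
  wd h = wd h'.
Proof. exact: whom_inj. Qed.

(** A 2-arrow of [A] for all pairs of weights between which [w] and [w'] are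
    1-arrows. *)
Definition wfam w w' : Type :=
  forall x y (h : wt w = y - x) (h' : wt w' = y - x), hom2 A (wd h) (wd h').

Lemma wfamP w w' (u v : wfam w w') :
  (forall x y h h', u x y h h' = v x y h h') -> u = v.
Proof. by move=> uv; do 4!(apply: functional_extensionality_dep => ?). Qed.

HB.instance Definition _ w w' := gen_eqMixin (wfam w w').
HB.instance Definition _ w w' := gen_choiceMixin (wfam w w').

Section Module.
Variables w w' : word.
Implicit Types (u v t : wfam w w').
Let wadd u v : wfam w w' := fun x y h h' => u x y h h' + v x y h h'.
Let wopp u : wfam w w' := fun x y h h' => - u x y h h'.
Let wzero : wfam w w' := fun x y h h' => 0.
Let wscale (c : k) u : wfam w w' := fun x y h h' => c *: u x y h h'.
Let waddA : associative wadd.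
Proof. by move=> u v t; apply: wfamP => *; apply: addrA. Qed.
Let waddC : commutative wadd.
Proof. by move=> u v; apply: wfamP => *; apply: addrC. Qed.
Let wadd0 : left_id wzero wadd.
Proof. by move=> u; apply: wfamP => *; apply: add0r. Qed.
Let waddN : left_inverse wzero wopp wadd.
Proof. by move=> u; apply: wfamP => *; apply: addNr. Qed.
HB.instance Definition _ :=
  GRing.isZmodule.Build (wfam w w') waddA waddC wadd0 waddN.
Let wscaleA c d u : wscale c (wscale d u) = wscale (c * d) u.
Proof. by apply: wfamP => *; apply: scalerA. Qed.
Let wscale1 : left_id 1 wscale.
Proof. by move=> u; apply: wfamP => *; apply: scale1r. Qed.
Let wscaleDr : right_distributive wscale +%R.
Proof. by move=> c u v; apply: wfamP => *; apply: scalerDr. Qed.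
Let wscaleDl v : {morph wscale^~ v : c d / c + d}.
Proof. by move=> c d; apply: wfamP => *; apply: scalerDl. Qed.
HB.instance Definition _ := GRing.Zmodule_isLmodule.Build k (wfam w w')
  wscaleA wscale1 wscaleDr wscaleDl.
End Module.

Lemma wfam_lin w w' x y h h' : linear (fun u : wfam w w' => u x y h h').
Proof. by []. Qed.

Lemma wfam_irr w w' (u : wfam w w') x y (h k0 : wt w = y - x)
    (h' k' : wt w' = y - x) (e : wd h = wd k0) (e' : wd h' = wd k') :
  cst e e' (u x y k0 k') = u x y h h'.
Proof.
by case: _ / (Prop_irrelevance h k0) e; case: _ / (Prop_irrelevance h' k') e' => *;
  rewrite cst_id.
Qed.

Definition pid w : wfam w w := fun x y h h' => idto A (wd_eq h h').

(** All words are 1-arrows of the same 2-category, so that families can be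
    composed through a word whose weight does not fit; the value [0] is forced
    by linearity as there is no 2-arrow of [B1] between such words
    ([B1_weight]). *)
Definition pvc f g i (v : wfam g i) (u : wfam f g) : wfam f i :=
  fun x y hf hi => if wt g =P y - x is ReflectT e
    then vcmp (v x y e hi) (u x y hf e) else 0.

Lemma pvcE f g i (v : wfam g i) (u : wfam f g) x y hf (e : wt g = y - x) hi :
  pvc v u hf hi = vcmp (v x y e hi) (u x y hf e).
Proof.
by rewrite /pvc; case: eqP => // e'; rewrite (Prop_irrelevance e' e).
Qed.

Lemma pvc0 f g i (v : wfam g i) (u : wfam f g) x y hf hi :
  wt g <> y - x -> pvc v u (x := x) (y := y) hf hi = 0.
Proof. by rewrite /pvc; case: eqP. Qed.

Lemma wt_right x f : wt f = x + wt f - x.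
Proof. by rewrite addrC addKr. Qed.
Lemma wt_right' x f f' : wt f' = wt f -> wt f' = x + wt f - x.
Proof. by move=> ->; apply: wt_right. Qed.
Lemma wt_left x z g f : wt (g ++ f) = z - x -> wt g = z - (x + wt f).
Proof. by rewrite wt_cat => /(canRL (addrK _)) ->; rewrite opprD addrA. Qed.
Lemma wt_left' x z g f f' :
  wt f' = wt f -> wt (g ++ f') = z - x -> wt g = z - (x + wt f).
Proof. by move=> <-; apply: wt_left. Qed.
Lemma wd_cat x y z g f (h : wt (g ++ f) = z - x) (hg : wt g = z - y)
  (hf : wt f = y - x) : wd h = cmp (wd hg) (wd hf).
Proof. exact: whom_inj. Qed.

Definition phc g g' f f' (v : wfam g g') (u : wfam f f') :
    wfam (g ++ f) (g' ++ f') :=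
  fun x z h h' => if wt f' =P wt f is ReflectT e
    then cst (wd_cat h (wt_left h) (wt_right x f))
             (wd_cat h' (wt_left' e h') (wt_right' x e))
             (hcmp (v _ _ (wt_left h) (wt_left' e h'))
                   (u _ _ (wt_right x f) (wt_right' x e))) else 0.

Lemma phcE g g' f f' (v : wfam g g') (u : wfam f f') x y z h h' hg hg' hf hf'
    (e : wd h = cmp (wd hg) (wd hf)) (e' : wd h' = cmp (wd hg') (wd hf')) :
  phc v u (x := x) (y := z) h h' = cst e e' (hcmp (v y z hg hg') (u x y hf hf')).
Proof.
have yE : y = x + wt f by rewrite hf addrC subrK.
subst y; rewrite /phc; case: eqP => [e0|[]]; last by rewrite hf hf'.
move: e e'; rewrite (Prop_irrelevance hg (wt_left h)) (Prop_irrelevance hf (wt_right x f))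
  (Prop_irrelevance hg' (wt_left' e0 h')) (Prop_irrelevance hf' (wt_right' x e0)).
by move=> e e'; congr cst; apply: Prop_irrelevance.
Qed.

Lemma phc0 g g' f f' (v : wfam g g') (u : wfam f f') x z h h' :
  wt f' <> wt f -> phc v u (x := x) (y := z) h h' = 0.
Proof. by rewrite /phc; case: eqP. Qed.

Lemma cst0 x y (P P' Q Q' : @hom1 (weights D) x y) (e : P = P') (e' : Q = Q') :
  cst (A := A) e e' 0 = 0.
Proof. exact: (lin0 (cst_lin (A := A) e e')). Qed.

Lemma pvc_castid w w' i (e : w = w') (v : wfam w' i) x y h hi
    (h' : wt w' = y - x) :
  pvc v (castid (H := fun p q => wfam p q) pid e) (x := x) (y := y) h hi
  = cst (wd_congr e h h') (erefl _) (v x y h' hi).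
Proof.
subst w'; rewrite (pvcE _ _ _ h') /= /pid (Prop_irrelevance h' h).
by rewrite cst_id idto_refl vcmp1r.
Qed.

Lemma pvc_castidl w w' f (e : w = w') (u : wfam f w) x y hf h
    (h' : wt w = y - x) :
  pvc (castid (H := fun p q => wfam p q) pid e) u (x := x) (y := y) hf h
  = cst (erefl _) (esym (wd_congr e h' h)) (u x y hf h').
Proof.
subst w'; rewrite (pvcE _ _ _ h') /= /pid (Prop_irrelevance h' h).
by rewrite cst_id idto_refl vcmp1l.
Qed.

(** The 2-category with one object whose 2-arrows are families over all weights.
    The presentation of [B1] has one object as well, so that functors between
    [B1] and [A] need not refer to weights: a functor from [A1] to [A] is the same
    thing as one from [B1] to [one_object A]. *)
Definition one_object : lin2 k (words I).
Proof.
pose H (a b : words I) (w w' : @hom1 (words I) a b) : lmodType k := wfam w w'.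
unshelve refine (@Lin2 k (words I) H (fun a b w => @pid w)
  (fun a b f g i v u => @pvc f g i v u)
  (fun a b c g g' f f' v u => @phc g g' f f' v u)
  _ _ _ _ _ _ _ _ _ _ _ _).
(* Each axiom reduces to that of [A] when the weights of the middle words fit;
   otherwise both sides vanish. *)
- move=> a b f g h i w v u; apply: wfamP => x y hf hi.
  have [eg|/eqP ng] := eqVneq (wt g) (y - x); last first.
    rewrite [RHS]pvc0 //.
    have [eh|/eqP nh] := eqVneq (wt h) (y - x); last by rewrite pvc0.
    by rewrite (pvcE _ _ _ eh) pvc0 // (lin0 (vcmp_linr _)).
  rewrite [RHS](pvcE _ _ _ eg).
  have [eh|/eqP nh] := eqVneq (wt h) (y - x); last first.
    by rewrite !pvc0 ?(lin0 (vcmp_linl _)).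
  by rewrite !(pvcE _ _ _ eh) (pvcE _ _ _ eg) vcmpA.
- move=> a b f g u; apply: wfamP => x y hf hg.
  by rewrite (pvcE _ _ _ hg) /pid idto_refl vcmp1l.
- move=> a b f g u; apply: wfamP => x y hf hg.
  by rewrite (pvcE _ _ _ hf) /pid idto_refl vcmp1r.
- move=> a b f g h u c v v'; apply: wfamP => x y hf hh.
  rewrite [RHS]wfam_lin.
  have [e|/eqP n] := eqVneq (wt g) (y - x); last by rewrite !pvc0 // scaler0 addr0.
  by rewrite !(pvcE _ _ _ e) wfam_lin vcmp_linl.
- move=> a b f g h u c v v'; apply: wfamP => x y hf hh.
  rewrite [RHS]wfam_lin.
  have [e|/eqP n] := eqVneq (wt g) (y - x); last by rewrite !pvc0 // scaler0 addr0.
  by rewrite !(pvcE _ _ _ e) wfam_lin vcmp_linr.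
- move=> a b c g g' f f' u r v v'; apply: wfamP => x y h h'.
  rewrite [RHS]wfam_lin.
  have [e|/eqP n] := eqVneq (wt f') (wt f); last by rewrite !phc0 // scaler0 addr0.
  pose hg := wt_left h; pose hg' := wt_left' e h'.
  pose E := wd_cat h hg (wt_right x f); pose E' := wd_cat h' hg' (wt_right' x e).
  by rewrite !(phcE _ _ E E') wfam_lin hcmp_linl cst_lin.
- move=> a b c g g' f f' v r u u'; apply: wfamP => x y h h'.
  rewrite [RHS]wfam_lin.
  have [e|/eqP n] := eqVneq (wt f') (wt f); last by rewrite !phc0 // scaler0 addr0.
  pose hg := wt_left h; pose hg' := wt_left' e h'.
  pose E := wd_cat h hg (wt_right x f); pose E' := wd_cat h' hg' (wt_right' x e).
  by rewrite !(phcE _ _ E E') wfam_lin hcmp_linr cst_lin.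
- move=> a b c g f; apply: wfamP => x y h h'.
  pose hf := wt_right x f; pose hg := wt_left h; pose hg' := wt_left h'.
  rewrite (phcE _ _ (wd_cat h hg hf) (wd_cat h' hg' hf)).
  rewrite /pid (Prop_irrelevance hg' hg) !idto_refl hcmp_id; exact: cst_id2.
- move=> a b c g g' g'' f f' f'' v' v u' u; apply: wfamP => x y h h''.
  have [e|/eqP n] := eqVneq (wt f'') (wt f); last first.
    rewrite [LHS]phc0 //; have [eh|/eqP nh] := eqVneq (wt (g' ++ f')) (y - x);
      last by rewrite pvc0.
    rewrite (pvcE _ _ _ eh); have [e'|/eqP n'] := eqVneq (wt f') (wt f).
      by rewrite phc0 ?(lin0 (vcmp_linl _)) // e'.
    by rewrite [X in vcmp _ X]phc0 // (lin0 (vcmp_linr _)).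
  pose hf := wt_right x f; pose hf'' := wt_right' x e.
  pose hg := wt_left h; pose hg'' := wt_left' e h''.
  rewrite [LHS](phcE _ _ (wd_cat h hg hf) (wd_cat h'' hg'' hf'')).
  have [e'|/eqP n'] := eqVneq (wt f') (wt f); last first.
    rewrite [X in hcmp _ X]pvc0 -?wt_right //.
    rewrite (lin0 (hcmp_linr _)) cst0.
    have [eh|/eqP nh] := eqVneq (wt (g' ++ f')) (y - x); last by rewrite pvc0.
    by rewrite (pvcE _ _ _ eh) [X in vcmp _ X]phc0 // (lin0 (vcmp_linr _)).
  pose hf' := wt_right' x e'; rewrite (pvcE _ _ _ hf').
  have [eg|/eqP ng] := eqVneq (wt g') (y - (x + wt f)); last first.
    rewrite pvc0 // (lin0 (hcmp_linl _)) cst0 pvc0 // => E; apply: ng.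
    exact: (wt_left' e' E).
  have h' : wt (g' ++ f') = y - x.
    by rewrite wt_cat eg e' opprD addrA subrK.
  rewrite (pvcE _ _ _ eg) (pvcE _ _ _ h') Defs.interchange.
  rewrite (phcE _ _ (wd_cat h' eg hf') (wd_cat h'' hg'' hf'')).
  by rewrite (phcE _ _ (wd_cat h hg hf) (wd_cat h' eg hf')) cst_vc.
- move=> a b c d h h' g g' f f' w v u; apply: wfamP => x y H1 H2.
  have H2' : wt (h' ++ (g' ++ f')) = y - x by rewrite catA.
  have H1' : wt ((h ++ g) ++ f) = y - x by rewrite -catA.
  apply: etrans (pvc_castidl (catA h' g' f') _ H1 H2 H2') _.
  apply: esym; apply: etrans (pvc_castid (catA h g f) _ H1 H2 H1') _.
  have [e1|/eqP n1] := eqVneq (wt f') (wt f); last first.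
    rewrite phc0 // cst0; have [e2|/eqP n2] := eqVneq (wt (g' ++ f')) (wt (g ++ f)).
      rewrite (phcE _ _ (wd_cat H1 (wt_left H1) (wt_right x _))
        (wd_cat H2' (wt_left' e2 H2') (wt_right' x e2))).
      by rewrite phc0 // (lin0 (hcmp_linr _)) !cst0.
    by rewrite phc0 // cst0.
  pose hf := wt_right x f; pose hf' := wt_right' x e1.
  pose hhg := wt_left H1'; pose hhg' := wt_left' e1 H2.
  rewrite (phcE _ _ (wd_cat H1' hhg hf) (wd_cat H2 hhg' hf')).
  have [e2|/eqP n2] := eqVneq (wt g') (wt g); last first.
    rewrite phc0 // (lin0 (hcmp_linl _)) !cst0 [X in cst _ _ X]phc0 ?cst0 //.
    by rewrite !wt_cat e1 => /addIr.
  pose hg := wt_right (x + wt f) g; pose hg' := wt_right' (x + wt f) e2.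
  pose hh := wt_left hhg; pose hh' := wt_left' e2 hhg'.
  rewrite (phcE _ _ (wd_cat hhg hh hg) (wd_cat hhg' hh' hg')).
  have hgf : wt (g ++ f) = (x + wt f) + wt g - x.
    by rewrite wt_cat [RHS]addrC !addrA addNr add0r addrC.
  have hgf' : wt (g' ++ f') = (x + wt f) + wt g - x.
    by rewrite wt_cat e1 e2 -hgf wt_cat.
  rewrite (phcE _ _ (wd_cat H1 hh hgf) (wd_cat H2' hh' hgf')).
  rewrite (phcE _ _ (wd_cat hgf hg hf) (wd_cat hgf' hg' hf')).
  rewrite cst_hcl cst_hcr (hcmpA_cst (cmpA _ _ _) (cmpA _ _ _)) !cst_trans.
  exact: cst_irr.
- move=> a b f f' u; apply: wfamP => x y h h'.
  have g : wt f = y - x by []; have g' : wt ([::] ++ f') = y - x by [].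
  apply: etrans (pvc_castidl (cat0s f') _ _ _ g') _.
  apply: esym; apply: etrans (pvc_castid (cat0s f) _ _ _ g) _.
  pose h0 := etrans (wt_nil D) (esym (subrr y)).
  rewrite (phcE _ _ (wd_cat h h0 g) (wd_cat g' h0 h')).
  rewrite /pid idto_refl (hcmp1l_cst (cmp1l _) (cmp1l _)) !cst_trans.
  exact: cst_irr.
- move=> a b f f' u; apply: wfamP => x y h h'.
  have g : wt f = y - x by rewrite -h [RHS]/(wt (f ++ [::])) cats0.
  have g' : wt (f' ++ [::]) = y - x by rewrite cats0.
  apply: etrans (pvc_castidl (cats0 f') _ _ _ g') _.
  apply: esym; apply: etrans (pvc_castid (cats0 f) _ _ _ g) _.
  pose h0 := etrans (wt_nil D) (esym (subrr x)).
  rewrite (phcE _ _ (wd_cat h g h0) (wd_cat g' h' h0)).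
  rewrite /pid idto_refl (hcmp1r_cst (cmp1r _) (cmp1r _)) !cst_trans.
  exact: cst_irr.
Defined.

Definition pwhisker (u v w w' : word) (f : wfam w w') : wfam (u ++ (w ++ v)) (u ++ (w' ++ v)) :=
  @phc _ _ _ _ (@pid u) (@phc _ _ _ _ f (@pid v)).

Lemma act_pwhisker z a b c d (u w w' v : word) (hu : wt u = d - c)
    (hw : wt w = c - b) (hw' : wt w' = c - b) (hv : wt v = b - a)
    (h : wt (u ++ (w ++ v)) = d - a) (h' : wt (u ++ (w' ++ v)) = d - a)
    (f : wfam w w') (Phi : lfun (reg0 A z c) (reg0 A z d)) (ru : real (wd hu) Phi)
    (M : whom D z a) (N : whom D z b) (eN : N = cmp (wd hv) M)
    (P Q : whom D z c) (e : P = cmp (wd hw) N) (e' : Q = cmp (wd hw') N)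
    (e1 : Phi P = cmp (wd h) M) (e1' : Phi Q = cmp (wd h') M) :
  act (@pwhisker u v _ _ f _ _ h h') e1 e1' = fmap Phi (act (f _ _ hw hw') e e').
Proof.
have hwv : wt (w ++ v) = c - a by rewrite wt_cat hw hv addrA subrK.
have hwv' : wt (w' ++ v) = c - a by rewrite wt_cat hw' hv addrA subrK.
have eP : P = cmp (wd hwv) M by rewrite e eN; apply: whom_inj; rewrite /= catA.
have eQ : Q = cmp (wd hwv') M by rewrite e' eN; apply: whom_inj; rewrite /= catA.
rewrite /pwhisker (phcE _ _ (wd_cat h hu hwv) (wd_cat h' hu hwv')) {1}/pid idto_refl.
rewrite (act_whisk _ _ _ ru eP eQ); congr fmap.
rewrite (phcE _ _ (wd_cat hwv hw hv) (wd_cat hwv' hw' hv)) /pid idto_refl.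
exact: act_whiskr.
Qed.
End WordFamilies.

(** * The regular 2-representation of the 2-Kac-Moody algebra *)

Section Images.
Variables (I : finType) (C : cartan I) (X Y : zmodType) (D : root_datum C X Y).
Variables (l : bool) (A : lin2 (kbase C) (weights D)).
Variable F : lin2fun (A1 D l) A.
Local Notation W := (words I).
Local Notation word := (seq (letter I)).
Local Notation H u v := (@hom2 (kbase C) W (B1 C l) tt tt u v).

(** Each generator preserves weights; a composite through a word of another
    weight vanishes by induction. *)
Lemma B1_weight f g (u : H f g) : wt D f <> wt D g -> u = 0.
Proof.
suff K (a b : W) (p q : @hom1 W a b) (t : term (kbase C) (@bgen I l) p q) :
    wt D p <> wt D q -> eval (A := B1 C l) (inj2 (@brel I C l)) t = 0.
  by elim/ph_ind: u => t fg; rewrite -eval_inj2; apply: K.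
elim: t => {a b p q} //=.
- move=> a b f' g' []; by move=> *; exfalso; match goal with H : _ <> _ |- _ =>
    apply: H end; rewrite ?wt2 ?wt_nil /= ?subrr ?addNr // addrC.
- move=> a b p q r v IHv w IHw pr; have [pq|/eqP pq] := eqVneq (wt D p) (wt D q).
    rewrite IHv; last by congruence.
    exact: (lin0 (@vcmp_linl _ _ (B1 C l) _ _ _ _ _ _)).
  rewrite IHw //; exact: (lin0 (@vcmp_linr _ _ (B1 C l) _ _ _ _ _ _)).
- move=> a b c q q' p p' v IHv w IHw; rewrite !wt_cat => n.
  have [pp|/eqP pp] := eqVneq (wt D p) (wt D p').
    rewrite IHv; last by congruence.
    exact: (lin0 (@hcmp_linl _ _ (B1 C l) _ _ _ _ _ _ _ _)).
  rewrite IHw //; exact: (lin0 (@hcmp_linr _ _ (B1 C l) _ _ _ _ _ _ _ _)).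
- by move=> a b p q t IHt t' IHt' n; rewrite IHt // IHt' // addr0.
- by move=> a b p q c t IHt n; rewrite IHt // scaler0.
Qed.

(** The 2-arrows of [A1] between given weights are 2-arrows of [B1], so that a
    2-arrow of [B1] has one image for each choice of the weights of its ends. *)
Definition at_weights (a b : X) (w w' : word) (h : wt D w = b - a)
    (h' : wt D w' = b - a) (f : H w w') : hom2 A (wd h) (wd h') :=
  fun2 F (f : @A1hom2 I C X Y D l a b (wd h) (wd h')).

Lemma at_weights_irr (a b : X) (w w' : word) (h1 h2 : wt D w = b - a)
    (h1' h2' : wt D w' = b - a) (f : H w w') (e : wd h1 = wd h2)
    (e' : wd h1' = wd h2') : at_weights h1 h1' f = cst e e' (at_weights h2 h2' f).
Proof.
by case: _ / (Prop_irrelevance h1 h2) e; case: _ / (Prop_irrelevance h1' h2') e' => *;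
  rewrite cst_id.
Qed.

Lemma at_weights_vc (a b : X) (w w' w'' : word) (h : wt D w = b - a)
    (h' : wt D w' = b - a) (h'' : wt D w'' = b - a) (g : H w' w'') (f : H w w') :
  at_weights h h'' (vcmp g f) = vcmp (at_weights h' h'' g) (at_weights h h' f).
Proof. exact: (@fun2_vcmp _ _ _ _ F a b (wd h) (wd h') (wd h'') g f). Qed.

Lemma at_weights_lin (a b : X) (w w' : word) (h : wt D w = b - a)
    (h' : wt D w' = b - a) : linear (at_weights (w := w) (w' := w') h h').
Proof. exact: (@fun2_lin _ _ _ _ F a b (wd h) (wd h')). Qed.

Lemma at_weights_hc (a b c : X) (w w' v v' : word) (hw : wt D w = c - b)
    (hw' : wt D w' = c - b) (hv : wt D v = b - a) (hv' : wt D v' = b - a)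
    (h : wt D (w ++ v) = c - a) (h' : wt D (w' ++ v') = c - a)
    (e : wd h = cmp (wd hw) (wd hv)) (e' : wd h' = cmp (wd hw') (wd hv'))
    (g : H w w') (f : H v v') :
  at_weights (w := w ++ v) (w' := w' ++ v') h h' (@hcmp _ W (B1 C l) tt tt tt _ _ _ _ g f)
  = cst e e' (hcmp (at_weights hw hw' g) (at_weights hv hv' f)).
Proof.
have E : wd (w := w ++ v) (wcmp_subproof (wd hw) (wd hv)) = cmp (wd hw) (wd hv).
  by [].
rewrite (@at_weights_irr _ _ _ _ h (wcmp_subproof (wd hw) (wd hv)) h'
  (wcmp_subproof (wd hw') (wd hv')) _ e e').
congr cst; exact: (@fun2_hcmp _ _ _ _ F a b c (wd hw) (wd hw') (wd hv) (wd hv') g f).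
Qed.

(* The type of objects of [words I] is [unit], which has no definitional eta. *)
Definition at_tt (a b : W) : forall f g : @hom1 W a b, hom2 (B1 C l) f g -> H f g :=
  match a, b with tt, tt => fun f g u => u end.

Definition to_words : lin2fun (B1 C l) (one_object A).
Proof.
unshelve refine (@Lin2fun _ W (B1 C l) (one_object A)
  (fun a b f g u => fun x y h h' => at_weights h h' (at_tt u)) _ _ _ _).
- move=> [] [] f g c u v; apply: wfamP => x y h h'; exact: at_weights_lin.
- move=> [] [] f; apply: wfamP => x y h h'.
  case: _ / (Prop_irrelevance h h'); rewrite [RHS]idto_refl; exact: (fun2_id F).
- move=> [] [] f g i v u; apply: wfamP => x y h h'.
  have [e|/eqP n] := eqVneq (wt D g) (y - x).
    by rewrite [RHS](pvcE _ _ _ e) -at_weights_vc.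
  rewrite [RHS]pvc0 // (_ : u = 0); last by apply: B1_weight => E; apply: n; rewrite -E.
  rewrite (lin0 (@vcmp_linr _ _ (B1 C l) _ _ _ _ _ _)); exact: (lin0 (at_weights_lin _ _)).
- move=> [] [] [] g g' f f' v u; apply: wfamP => x y h h'.
  have [e|/eqP n] := eqVneq (wt D f') (wt D f).
    rewrite [RHS](phcE _ _ (wd_cat h (wt_left h) (wt_right D x f))
      (wd_cat h' (wt_left' e h') (wt_right' x e))); exact: at_weights_hc.
  rewrite [RHS]phc0 // (_ : u = 0); last by apply: B1_weight => E; apply: n; rewrite -E.
  rewrite (lin0 (@hcmp_linr _ _ (B1 C l) _ _ _ _ _ _ _ _)).
  exact: (lin0 (at_weights_lin _ _)).
Defined.

(** As [act], but with ends constrained only as words: since the proofs that a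
    word has the right weight are irrelevant, the side conditions hold by
    computation for all iterated images of [M]. *)
Definition act_at (z a b : X) (w w' : word) (h : wt D w = b - a)
    (h' : wt D w' = b - a) (f : H w w') (M : whom D z a) (P Q : whom D z b)
    (e : sval P = w ++ sval M) (e' : sval Q = w' ++ sval M) : hom2 A P Q :=
  act (A := A) (M := M) (P := P) (Q := Q) (at_weights h h' f)
    (whom_inj (u := P) (v := wcmp (wd h) M) e)
    (whom_inj (u := Q) (v := wcmp (wd h') M) e').

Lemma act_at_id (z a b : X) (w : word) (h h' : wt D w = b - a) (M : whom D z a)
    (P : whom D z b) (e e' : sval P = w ++ sval M) :
  act_at h h' (id2 (B1 C l) (a := tt) (b := tt) w) e e' = id2 A P.
Proof.
rewrite /act_at; case: _ / (Prop_irrelevance h h') => {h'}.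
have -> : at_weights h h (id2 (B1 C l) (a := tt) (b := tt) w) = id2 A (wd h).
  exact: (fun2_id F).
exact: act_id.
Qed.

Lemma act_at_vc (z a b : X) (w w' w'' : word) (h : wt D w = b - a)
    (h' : wt D w' = b - a) (h'' : wt D w'' = b - a) (g : H w' w'') (f : H w w')
    (M : whom D z a) (P Q R : whom D z b) (e : sval P = w ++ sval M)
    (e' : sval Q = w' ++ sval M) (e'' : sval R = w'' ++ sval M) :
  act_at h h'' (vcmp g f) e e'' = vcmp (act_at h' h'' g e' e'') (act_at h h' f e e').
Proof. by rewrite /act_at (at_weights_vc h h' h''); apply: act_vc. Qed.

Lemma act_at_lin (z a b : X) (w w' : word) (h : wt D w = b - a)
    (h' : wt D w' = b - a) (M : whom D z a) (P Q : whom D z b)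
    (e : sval P = w ++ sval M) (e' : sval Q = w' ++ sval M) :
  linear (fun f : H w w' => act_at h h' f e e').
Proof. by move=> c f g; rewrite /act_at at_weights_lin act_lin. Qed.

Lemma act_at_wh (z a b c d : X) (u w w' v : word) (hu : wt D u = d - c)
    (hw : wt D w = c - b) (hw' : wt D w' = c - b) (hv : wt D v = b - a)
    (h : wt D (u ++ (w ++ v)) = d - a) (h' : wt D (u ++ (w' ++ v)) = d - a)
    (f : H w w') (Phi : lfun (reg0 A z c) (reg0 A z d)) (ru : real (wd hu) Phi)
    (M : whom D z a) (N : whom D z b) (eN : sval N = v ++ sval M)
    (P Q : whom D z c) (e : sval P = w ++ sval N) (e' : sval Q = w' ++ sval N)
    (e1 : sval (Phi P : whom D z d) = (u ++ (w ++ v)) ++ sval M)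
    (e1' : sval (Phi Q : whom D z d) = (u ++ (w' ++ v)) ++ sval M) :
  act_at h h' (bwh u v f) e1 e1' = fmap Phi (act_at hw hw' f e e').
Proof.
rewrite /act_at; have -> : at_weights h h' (bwh u v f)
    = @pwhisker _ _ _ _ _ A u v w w' (fun2 to_words (a := tt) (b := tt) f) _ _ h h'.
  have : fun2 to_words (a := tt) (b := tt) (bwh u v f)
      = @pwhisker _ _ _ _ _ A u v w w' (fun2 to_words (a := tt) (b := tt) f).
    by rewrite [LHS]fun2_hcmp fun2_id [X in hcmp _ X]fun2_hcmp fun2_id.
  by move=> /(congr1 (fun t => t _ _ h h')).
have eN' : N = cmp (wd hv) M :> whom D z b by apply: whom_inj.
exact: (act_pwhisker _ ru eN').
Qed.
End Images.

Section RegularSl2.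
Variables (I : finType) (C : cartan I) (X Y : zmodType) (D : root_datum C X Y).
Variables (l : bool) (A : lin2 (kbase C) (weights D)).
Variable iF : lin2fun (A1 D l) A.
Variables (s : I) (z : X).
Local Notation k := (kbase C).
Local Notation alpha := (sroot D s).
Local Notation "[E]" := [:: LE s].
Local Notation "[F]" := [:: LF s].
Local Notation act_at := (act_at iF).

Lemma wtE a b : b = a + alpha -> wt D [E] = b - a.
Proof. by move=> ->; rewrite addrC addKr /wt big_cons big_nil addr0. Qed.
Lemma wtF a b : b = a + alpha -> wt D [F] = a - b.
Proof.
move=> ->; rewrite /wt big_cons big_nil addr0 /= opprD addrA subrr sub0r //.
Qed.
Definition wt0 (a : X) : wt D [::] = a - a := etrans (wt_nil D) (esym (subrr a)).
Lemma wtEE a b c : b = a + alpha -> c = b + alpha -> wt D [:: LE s; LE s] = c - a.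
Proof. by move=> /wtE h /wtE h'; rewrite -[[:: _; _]]/([E] ++ [E]) wt_cat {1}h' h addrA subrK. Qed.

Lemma real_wd0 a (h : wt D [::] = a - a) : real (wd h) (lfun_id (reg0 A z a)).
Proof. by apply: real_one; apply: whom_inj. Qed.

Lemma real_wd a b w (h : wt D w = b - a) : real (wd h) (reg1 A z (wd h)).
Proof. exact: real_reg1. Qed.

Lemma real_wd2 a b c (e e' : letter I) (h : wt D [:: e] = c - b)
    (h' : wt D [:: e'] = b - a) (h'' : wt D [:: e; e'] = c - a) :
  real (wd h'') (lfun_cmp (reg1 A z (wd h)) (reg1 A z (wd h'))).
Proof. by apply: (real_cmp (real_wd h) (real_wd h')); apply: whom_inj. Qed.

Lemma act_at_whr a b c w w' v (hw : wt D w = c - b) (hw' : wt D w' = c - b)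
    (hv : wt D v = b - a) h h' (f : @hom2 _ (words I) (B1 C l) tt tt w w')
    (M : whom D z a) (N : whom D z b) (eN : sval N = v ++ sval M)
    (P Q : whom D z c) (e : sval P = w ++ sval N) (e' : sval Q = w' ++ sval N)
    (e1 : sval P = (w ++ v) ++ sval M) (e1' : sval Q = (w' ++ v) ++ sval M) :
  act_at h h' (bwh [::] v f) e1 e1' = act_at hw hw' f e e'.
Proof. exact: (act_at_wh iF (u := [::]) hw hw' hv _ _ _ (real_wd0 (wt0 c)) eN). Qed.

Lemma act_at_whl a b c u w w' (hu : wt D u = c - b) (hw : wt D w = b - a)
    (hw' : wt D w' = b - a) h h' (f : @hom2 _ (words I) (B1 C l) tt tt w w')
    (Phi : lfun (reg0 A z b) (reg0 A z c)) (ru : real (wd hu) Phi)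
    (M : whom D z a) (P Q : whom D z b) (e : sval P = w ++ sval M)
    (e' : sval Q = w' ++ sval M)
    (e1 : sval (Phi P : whom D z c) = (u ++ (w ++ [::])) ++ sval M)
    (e1' : sval (Phi Q : whom D z c) = (u ++ (w' ++ [::])) ++ sval M) :
  act_at h h' (bwh u [::] f) e1 e1' = fmap Phi (act_at hw hw' f e e').
Proof. exact: (act_at_wh iF (v := [::]) hw hw' (wt0 a) _ _ _ ru (erefl _)). Qed.

Section Step.
Variables (a b : X) (h : b = a + alpha).
Local Notation E := (reg1 A z (wd (wtE h))).
Local Notation F := (reg1 A z (wd (wtF h))).

Definition reg_ep (N : reg0 A z b) : lhom (E (F N)) N :=
  act_at (wtEF0 D s b) (wt0 b) (bcounit C l s) (M := N) (P := E (F N)) (Q := N)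
    (erefl _) (erefl _).

Definition reg_et (M : reg0 A z a) : lhom M (F (E M)) :=
  act_at (wt0 a) (wtFE0 D s a) (bunit C l s) (M := M) (P := M) (Q := F (E M))
    (erefl _) (erefl _).

Lemma reg_zigE (M : reg0 A z a) : reg_ep (E M) ** fmap E (reg_et M) = lid (E M).
Proof.
have hh : wt D [:: LE s; LF s; LE s] = b - a.
  by rewrite -[[:: _; _; _]]/([E] ++ [:: LF s; LE s]) wt_cat (wtFE0 D s a) (wtE h) subrr addr0.
have eM : sval (E M : whom D z b) = [E] ++ sval M by [].
rewrite -[RHS](act_at_id iF (wtE h) (wtE h) eM eM) -bdualE.
rewrite (act_at_vc iF _ hh _ _ _ (M := M) (Q := E (F (E M))) _ (erefl _)).
congr vcmp.
  exact/esym/(act_at_whr (wtEF0 D s b) (wt0 b) (wtE h) _ _ _ (N := E M)).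
exact/esym/(act_at_whl (wt0 a) (wtFE0 D s a) _ _ _ (real_wd (wtE h))
  (P := M) (Q := F (E M))).
Qed.

Lemma reg_zigF (N : reg0 A z b) : fmap F (reg_ep N) ** reg_et (F N) = lid (F N).
Proof.
have hh : wt D [:: LF s; LE s; LF s] = a - b.
  by rewrite -[[:: _; _; _]]/([F] ++ [:: LE s; LF s]) wt_cat (wtEF0 D s b) (wtF h) subrr addr0.
have eN : sval (F N : whom D z a) = [F] ++ sval N by [].
rewrite -[RHS](act_at_id iF (wtF h) (wtF h) eN eN) -bdualF.
rewrite (act_at_vc iF _ hh _ _ _ (M := N) (Q := F (E (F N))) _ (erefl _)).
congr vcmp.
  exact/esym/(act_at_whl (wtEF0 D s b) (wt0 b) _ _ _ (real_wd (wtF h))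
    (P := E (F N)) (Q := N)).
exact/esym/(act_at_whr (wt0 a) (wtFE0 D s a) (wtF h) _ _ _ (N := F N)).
Qed.

(** The duality between [E_s] and [F_s] becomes an adjunction between the
    categories attached to [a] and [a + alpha]. *)
Definition reg_adj : adj (reg0 A z a) (reg0 A z b).
Proof.
apply: (@Adj k _ _ E F reg_ep reg_et _ _ reg_zigE reg_zigF).
- move=> N N' g.
  exact: (act_nat _ (real_wd2 (wtE h) (wtF h) (wtEF0 D s b)) (real_wd0 (wt0 b))).
- move=> N N' g.
  exact: (act_nat _ (real_wd0 (wt0 a)) (real_wd2 (wtF h) (wtE h) (wtFE0 D s a))).
Defined.

Definition reg_x (M : reg0 A z a) : lhom (E M) (E M) :=
  act_at (wtE h) (wtE h) (bx C l s) (M := M) (P := E M) (Q := E M)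
    (erefl _) (erefl _).

Lemma reg_x_nat (M M' : reg0 A z a) (g : lhom M M') :
  reg_x M' ** fmap E g = fmap E g ** reg_x M.
Proof. exact: (act_nat _ (real_wd _) (real_wd _)). Qed.

Lemma reg_x_pow (M : reg0 A z a) i :
  act_at (wtE h) (wtE h) (pow2 (bx C l s) i) (M := M) (P := E M) (Q := E M)
    (erefl _) (erefl _) = lpow (reg_x M) i.
Proof.
elim: i => [|i IH]; first by rewrite lpow0; apply: act_at_id.
by rewrite lpowS -IH; apply: act_at_vc.
Qed.
End Step.

Section Steps.
Variables (a b c : X) (h : b = a + alpha) (h' : c = b + alpha).
Local Notation E0 := (reg1 A z (wd (wtE h))).
Local Notation F0 := (reg1 A z (wd (wtF h))).
Local Notation E1 := (reg1 A z (wd (wtE h'))).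
Local Notation F1 := (reg1 A z (wd (wtF h'))).

Definition reg_t (M : reg0 A z a) : lhom (E1 (E0 M)) (E1 (E0 M)) :=
  act_at (wtEE h h') (wtEE h h') (btau C l s s) (M := M) (P := E1 (E0 M))
    (Q := E1 (E0 M)) (erefl _) (erefl _).

Lemma reg_nilHecke :
  nilHecke (a0 := reg_adj h) (a1 := reg_adj h') (reg_x h) (reg_x h') reg_t.
Proof.
split.
- exact: reg_x_nat.
- exact: reg_x_nat.
- move=> M M' g; pose r := real_wd2 (wtE h') (wtE h) (wtEE h h').
  exact: (act_nat _ r r).
- move=> M; apply: etrans (esym (act_at_vc _ _ _ _ _ _ _ _ _)) _.
  by rewrite btau_nil; apply: (lin0 (act_at_lin _ _ _ _ _)).
- move=> M.
  suff : reg_t M ** reg_x h' (E0 M) = fmap E1 (reg_x h M) ** reg_t M + lid (E1 (E0 M)).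
    by [].
  pose eM := erefl (sval (E1 (E0 M) : whom D z c)) : _ = [:: LE s; LE s] ++ sval M.
  pose wx := act_at (wtEE h h') (wtEE h h') (bwh [::] [E] (bx C l s)) eM eM.
  pose xw := act_at (wtEE h h') (wtEE h h') (bwh [E] [::] (bx C l s)) eM eM.
  have <- : wx = reg_x h' (E0 M).
    exact: (act_at_whr (wtE h') (wtE h') (wtE h) _ _ _ (N := E0 M)).
  have <- : xw = fmap E1 (reg_x h M).
    exact: (act_at_whl (wtE h) (wtE h) _ _ _ (real_wd (wtE h')) (P := E0 M) (Q := E0 M)).
  rewrite -[lid _](act_at_id iF (wtEE h h') (wtEE h h') eM eM).
  pose EE := wtEE h h'.
  apply: (etrans (esym (act_at_vc iF EE EE EE (btau C l s s) (bwh [::] [E] (bx C l s))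
    eM eM eM))).
  rewrite btau_dotl.
  rewrite (linD (act_at_lin iF _ _ _ _)); congr (_ + _); exact: act_at_vc.
- move=> M.
  suff : reg_t M ** fmap E1 (reg_x h M) = reg_x h' (E0 M) ** reg_t M - lid (E1 (E0 M)).
    by [].
  pose eM := erefl (sval (E1 (E0 M) : whom D z c)) : _ = [:: LE s; LE s] ++ sval M.
  pose wx := act_at (wtEE h h') (wtEE h h') (bwh [::] [E] (bx C l s)) eM eM.
  pose xw := act_at (wtEE h h') (wtEE h h') (bwh [E] [::] (bx C l s)) eM eM.
  have <- : wx = reg_x h' (E0 M).
    exact: (act_at_whr (wtE h') (wtE h') (wtE h) _ _ _ (N := E0 M)).
  have <- : xw = fmap E1 (reg_x h M).
    exact: (act_at_whl (wtE h) (wtE h) _ _ _ (real_wd (wtE h')) (P := E0 M) (Q := E0 M)).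
  rewrite -[lid _](act_at_id iF (wtEE h h') (wtEE h h') eM eM).
  pose EE := wtEE h h'.
  apply: (etrans (esym (act_at_vc iF EE EE EE (btau C l s s) (bwh [E] [::] (bx C l s))
    eM eM eM))).
  rewrite btau_dotr.
  rewrite (linD (act_at_lin iF _ _ _ _)) (linN (act_at_lin iF _ _ _ _)).
  congr (_ - _); exact: act_at_vc.
Qed.

Lemma reg_sig (M : reg0 A z b) :
  act_at (wtEF0 D s b) (wtFE0 D s b) (bsigma C l s s) (M := M) (P := E0 (F0 M))
    (Q := F1 (E1 M)) (erefl _) (erefl _)
  = sig (a0 := reg_adj h) (a1 := reg_adj h') reg_t M.
Proof.
have hh : wt D [:: LF s; LE s; LE s; LF s] = b - b.
  rewrite -[[:: _; _; _; _]]/([:: LF s; LE s] ++ [:: LE s; LF s]) wt_cat.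
  by rewrite (wtFE0 D s b) (wtEF0 D s b) !subrr addr0.
pose Q := F1 (E1 (E0 (F0 M))).
rewrite (act_at_vc iF (wtEF0 D s b) hh (wtFE0 D s b) _ _ (M := M) (Q := Q) _
  (erefl _)).
rewrite (act_at_vc iF hh hh (wtFE0 D s b) _ _ (M := M) (Q := Q) _ (erefl _)).
rewrite sigE flatE fmap_cmp; congr (vcmp (vcmp _ _) _).
- exact: (act_at_whl (wtEF0 D s b) (wt0 b) _ _ _
    (real_wd2 (wtF h') (wtE h') (wtFE0 D s b)) (P := E0 (F0 M)) (Q := M)).
- exact: (act_at_wh iF (wtEE h h') (wtEE h h') (wtF h) _ _ _ (real_wd (wtF h'))
    (N := F0 M) (erefl _) (P := E1 (E0 (F0 M))) (Q := E1 (E0 (F0 M)))).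
- exact: (act_at_whr (wt0 b) (wtFE0 D s b) (wtEF0 D s b) _ _ _ (N := E0 (F0 M))).
Qed.

Lemma reg_epx i (M : reg0 A z b) :
  act_at (wtEF0 D s b) (wt0 b) (bcounitx C l s i) (M := M) (P := E0 (F0 M))
    (Q := M) (erefl _) (erefl _)
  = epx (a0 := reg_adj h) (reg_x h) i M.
Proof.
rewrite (act_at_vc iF (wtEF0 D s b) (wtEF0 D s b) (wt0 b) _ _ (M := M)
  (Q := E0 (F0 M)) _ (erefl _)).
rewrite epxE -reg_x_pow; congr vcmp.
exact: (act_at_whr (wtE h) (wtE h) (wtF h) _ _ _ (N := F0 M)).
Qed.

Lemma reg_etx i (M : reg0 A z b) :
  act_at (wt0 b) (wtFE0 D s b) (bunitx C l s i) (M := M) (P := M)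
    (Q := F1 (E1 M)) (erefl _) (erefl _)
  = etx (a1 := reg_adj h') (reg_x h') i M.
Proof.
rewrite (act_at_vc iF (wt0 b) (wtFE0 D s b) (wtFE0 D s b) _ _ (M := M)
  (Q := F1 (E1 M)) _ (erefl _)).
rewrite etxE -reg_x_pow; congr vcmp.
exact: (act_at_whl (wtE h') (wtE h') _ _ _ (real_wd (wtF h')) (P := E1 M) (Q := E1 M)).
Qed.

Definition actFE (g : hom2 A (FE D s b) (EF D s b)) (M : reg0 A z b) :
    lhom (F1 (E1 M)) (E0 (F0 M)) :=
  act (A := A) g (M := M) (P := F1 (E1 M)) (Q := E0 (F0 M))
    (whom_inj (u := F1 (E1 M)) (v := wcmp (FE D s b) M) (erefl _))
    (whom_inj (u := E0 (F0 M)) (v := wcmp (EF D s b) M) (erefl _)).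

Definition act1EF (g : hom2 A (wone D b) (EF D s b)) (M : reg0 A z b) :
    lhom M (E0 (F0 M)) :=
  act (A := A) g (M := M) (P := M) (Q := E0 (F0 M))
    (whom_inj (u := M) (v := wcmp (wone D b) M) (erefl _))
    (whom_inj (u := E0 (F0 M)) (v := wcmp (EF D s b) M) (erefl _)).

Definition actFE1 (g : hom2 A (FE D s b) (wone D b)) (M : reg0 A z b) :
    lhom (F1 (E1 M)) M :=
  act (A := A) g (M := M) (P := F1 (E1 M)) (Q := M)
    (whom_inj (u := F1 (E1 M)) (v := wcmp (FE D s b) M) (erefl _))
    (whom_inj (u := M) (v := wcmp (wone D b) M) (erefl _)).

Definition sigma_at := at_weights iF (wtEF0 D s b) (wtFE0 D s b) (bsigma C l s s).
Definition epsx_at i := at_weights iF (wtEF0 D s b) (wt0 b) (bcounitx C l s i).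
Definition etax_at i := at_weights iF (wt0 b) (wtFE0 D s b) (bunitx C l s i).

Lemma reg_pos_inv n (gs : hom2 A (FE D s b) (EF D s b))
    (gc : 'I_n -> hom2 A (wone D b) (EF D s b)) :
  [/\ vcmp sigma_at gs = id2 A _, forall i : 'I_n, vcmp (epsx_at i) gs = 0,
    vcmp gs sigma_at + \sum_(i < n) vcmp (gc i) (epsx_at i) = id2 A _,
    forall i, vcmp sigma_at (gc i) = 0 &
    forall i j : 'I_n, vcmp (epsx_at i) (gc j) = if i == j then id2 A _ else 0] ->
  pos_inv (a0 := reg_adj h) (a1 := reg_adj h') (reg_x h) reg_t (actFE gs)
    (fun i => act1EF (gc i)).
Proof.
move=> [e1 e2 e3 e4 e5] M.
have L u v P Q e e' := @act_lin _ _ A z b b u v M P Q e e'.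
split.
- rewrite -reg_sig; apply: etrans (esym (act_vc _ _ _ _ _)) _.
  by rewrite e1; apply: act_id.
- move=> i; rewrite -reg_epx; apply: etrans (esym (act_vc _ _ _ _ _)) _.
  by rewrite e2; apply: (lin0 (L _ _ _ _ _ _)).
- rewrite -reg_sig; under eq_bigr => i _ do rewrite -reg_epx.
  apply: (etrans _ (act_id A (u := EF D s b) (M := M)
    (whom_inj (u := E0 (F0 M)) (v := wcmp (EF D s b) M) (erefl _))
    (whom_inj (u := E0 (F0 M)) (v := wcmp (EF D s b) M) (erefl _)))).
  rewrite -e3 (linD (L _ _ _ _ _ _)) (lin_sum (L _ _ _ _ _ _)).
  congr (_ + _); first exact/esym/act_vc.
  by apply: eq_bigr => i _; apply/esym/act_vc.
- move=> i; rewrite -reg_sig; apply: etrans (esym (act_vc _ _ _ _ _)) _.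
  by rewrite e4; apply: (lin0 (L _ _ _ _ _ _)).
- move=> i j; rewrite -reg_epx; apply: etrans (esym (act_vc _ _ _ _ _)) _.
  rewrite e5; case: eqP => _; first exact: act_id.
  exact: (lin0 (L _ _ _ _ _ _)).
Qed.

Lemma reg_neg_inv n (gs : hom2 A (FE D s b) (EF D s b))
    (gd : 'I_n -> hom2 A (FE D s b) (wone D b)) :
  [/\ vcmp gs sigma_at = id2 A _, forall i : 'I_n, vcmp gs (etax_at i) = 0,
    vcmp sigma_at gs + \sum_(i < n) vcmp (etax_at i) (gd i) = id2 A _,
    forall i, vcmp (gd i) sigma_at = 0 &
    forall i j : 'I_n, vcmp (gd j) (etax_at i) = if i == j then id2 A _ else 0] ->
  neg_inv (a0 := reg_adj h) (a1 := reg_adj h') (reg_x h') reg_t (actFE gs)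
    (fun i => actFE1 (gd i)).
Proof.
move=> [e1 e2 e3 e4 e5] M.
have L u v P Q e e' := @act_lin _ _ A z b b u v M P Q e e'.
split.
- rewrite -reg_sig; apply: etrans (esym (act_vc _ _ _ _ _)) _.
  by rewrite e1; apply: act_id.
- move=> i; rewrite -reg_etx; apply: etrans (esym (act_vc _ _ _ _ _)) _.
  by rewrite e2; apply: (lin0 (L _ _ _ _ _ _)).
- rewrite -reg_sig; under eq_bigr => i _ do rewrite -reg_etx.
  apply: (etrans _ (act_id A (u := FE D s b) (M := M)
    (whom_inj (u := F1 (E1 M)) (v := wcmp (FE D s b) M) (erefl _))
    (whom_inj (u := F1 (E1 M)) (v := wcmp (FE D s b) M) (erefl _)))).
  rewrite -e3 (linD (L _ _ _ _ _ _)) (lin_sum (L _ _ _ _ _ _)).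
  congr (_ + _); first exact/esym/act_vc.
  by apply: eq_bigr => i _; apply/esym/act_vc.
- move=> i; rewrite -reg_sig; apply: etrans (esym (act_vc _ _ _ _ _)) _.
  by rewrite e4; apply: (lin0 (L _ _ _ _ _ _)).
- move=> i j; rewrite -reg_etx; apply: etrans (esym (act_vc _ _ _ _ _)) _.
  rewrite e5; case: eqP => _; first exact: act_id.
  exact: (lin0 (L _ _ _ _ _ _)).
Qed.
End Steps.

Lemma reg_braid a b c d (h : b = a + alpha) (h' : c = b + alpha)
    (h'' : d = c + alpha) (M : reg0 A z a) :
  let E0 := reg1 A z (wd (wtE h)) in
  let E2 := reg1 A z (wd (wtE h'')) in
  reg_t h' h'' (E0 M) ** fmap E2 (reg_t h h' M) ** reg_t h' h'' (E0 M)
  = fmap E2 (reg_t h h' M) ** reg_t h' h'' (E0 M) ** fmap E2 (reg_t h h' M).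
Proof.
move=> E0 E2; pose E1 := reg1 A z (wd (wtE h')).
have hh : wt D [:: LE s; LE s; LE s] = d - a.
  rewrite -[[:: _; _; _]]/([:: LE s; LE s] ++ [:: LE s]) wt_cat.
  by rewrite (wtEE h' h'') (wtE h) addrA subrK.
pose P := E2 (E1 (E0 M)).
pose eM := erefl (sval (P : whom D z d)) : _ = [:: LE s; LE s; LE s] ++ sval M.
have <- : act_at hh hh (bwh [::] [E] (btau C l s s)) eM eM = reg_t h' h'' (E0 M).
  exact: (act_at_whr (wtEE h' h'') (wtEE h' h'') (wtE h) _ _ _ (N := E0 M)).
have <- : act_at hh hh (bwh [E] [::] (btau C l s s)) eM eM = fmap E2 (reg_t h h' M).
  exact: (act_at_whl (wtEE h h') (wtEE h h') _ _ _ (real_wd (wtE h''))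
    (P := E1 (E0 M)) (Q := E1 (E0 M))).
have V f g : act_at hh hh f eM eM ** act_at hh hh g eM eM = act_at hh hh (vcmp f g) eM eM :> lhom (P : reg0 A z d) P.
  exact/esym/act_at_vc.
by rewrite !V btau_braid.
Qed.
End RegularSl2.

(** * The second adjunction *)

Section SecondAdjunction.
Variables (I : finType) (C : cartan I) (X Y : zmodType) (D : root_datum C X Y).
Variables (l : bool) (s : I).
Local Notation k := (kbase C).
Local Notation A := (AA D l).
Local Notation iF := (iA D l).
Local Notation alpha := (sroot D s).
Local Notation "v *o u" := (vcmp v u) (at level 40, left associativity).

(** The entries of the formal inverse of [rho] and of the two matrix identities
    that it satisfies. *)
Lemma rho_inv_pos a n : `|wtn D s a|%N = n -> 0 <= wtn D s a ->
  exists (gs : hom2 A (FE D s a) (EF D s a))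
         (gc : 'I_n -> hom2 A (wone D a) (EF D s a)),
  [/\ sigma_at iF s a *o gs = id2 A _, forall i : 'I_n, epsx_at iF s a i *o gs = 0,
    gs *o sigma_at iF s a + \sum_(i < n) gc i *o epsx_at iF s a i = id2 A _,
    forall i, sigma_at iF s a *o gc i = 0 &
    forall i j : 'I_n, epsx_at iF s a i *o gc j = if i == j then id2 A _ else 0].
Proof.
move=> <- h; pose j := ix_pos h.
pose G q := loc_ginv (loc_arr l) (j := j) q tt.
exists (G None), (fun i => G (Some i)); split.
- have := loc_invr_eq (loc_arr l) (j := j) None None.
  by rewrite mxdelta_diag sum_unit.
- move=> i; have := loc_invr_eq (loc_arr l) (j := j) None (Some i).
  by rewrite mxdelta_off // sum_unit.
- have := loc_invl_eq (loc_arr l) (j := j) tt tt.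
  by rewrite mxdelta_diag sum_option.
- move=> i; have := loc_invr_eq (loc_arr l) (j := j) (Some i) None.
  by rewrite mxdelta_off // sum_unit.
- move=> i i'; have := loc_invr_eq (loc_arr l) (j := j) (Some i') (Some i).
  rewrite sum_unit; case: eqP => [->|ii]; first by rewrite mxdelta_diag.
  by rewrite mxdelta_off //; apply/eqP => -[] /esym.
Qed.

Lemma rho_inv_neg a n : `|wtn D s a|%N = n -> wtn D s a <= 0 ->
  exists (gs : hom2 A (FE D s a) (EF D s a))
         (gd : 'I_n -> hom2 A (FE D s a) (wone D a)),
  [/\ gs *o sigma_at iF s a = id2 A _, forall i : 'I_n, gs *o etax_at iF s a i = 0,
    sigma_at iF s a *o gs + \sum_(i < n) etax_at iF s a i *o gd i = id2 A _,
    forall i, gd i *o sigma_at iF s a = 0 &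
    forall i j : 'I_n, gd j *o etax_at iF s a i = if i == j then id2 A _ else 0].
Proof.
move=> <- h; pose j := ix_neg h.
pose G p := loc_ginv (loc_arr l) (j := j) tt p.
exists (G None), (fun i => G (Some i)); split.
- have := loc_invl_eq (loc_arr l) (j := j) None None.
  by rewrite mxdelta_diag sum_unit.
- move=> i; have := loc_invl_eq (loc_arr l) (j := j) (Some i) None.
  by rewrite mxdelta_off // sum_unit.
- have := loc_invr_eq (loc_arr l) (j := j) tt tt.
  by rewrite mxdelta_diag sum_option.
- move=> i; have := loc_invl_eq (loc_arr l) (j := j) None (Some i).
  by rewrite mxdelta_off // sum_unit.
- move=> i i'; have := loc_invl_eq (loc_arr l) (j := j) (Some i) (Some i').
  rewrite sum_unit; case: eqP => [->|ii]; first by rewrite mxdelta_diag.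
  by rewrite mxdelta_off //; apply/eqP => -[].
Qed.

Lemma wtn_step a b : b = a + alpha -> wtn D s b = wtn D s a + 2.
Proof. by move=> ->; rewrite /wtn pairingDr pairing_cartan ca_diag. Qed.

(** The two zigzag identities for the counit [e] and the unit [u], stated on the
    regular 2-representations. *)
Definition second_unit a b (h : b = a + alpha)
    (e : hom2 A (FE D s a) (wone D a)) (u : hom2 A (wone D b) (EF D s b)) :=
  forall z,
  (forall M : reg0 A z a,
    fmap (reg1 A z (wd (wtE h))) (actFE1 h e M)
    ** act1EF h u (reg1 A z (wd (wtE h)) M) = lid _) /\
  (forall N : reg0 A z b,
    actFE1 h e (reg1 A z (wd (wtF h)) N)
    ** fmap (reg1 A z (wd (wtF h))) (act1EF h u N) = lid _).

Lemma actFE1_lin z a b (h : b = a + alpha) (M : reg0 A z a) :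
  linear (fun g => actFE1 h g M).
Proof. by move=> c f g; apply: act_lin. Qed.

Lemma act1EF_lin z a b (h : b = a + alpha) (N : reg0 A z b) :
  linear (fun g => act1EF h g N).
Proof. by move=> c f g; apply: act_lin. Qed.

Lemma actFE1_eps z a b c (h : b = a + alpha) (h' : c = b + alpha) i
    (gs : hom2 A (FE D s b) (EF D s b)) (M : reg0 A z b) :
  actFE1 h' (epsx_at iF s b i *o gs) M
  = epx (a0 := reg_adj iF z h) (reg_x iF h) i M ** actFE h h' gs M.
Proof. by rewrite -reg_epx; apply: act_vc. Qed.

Lemma act1EF_eta z a b c (h : b = a + alpha) (h' : c = b + alpha) i
    (gs : hom2 A (FE D s b) (EF D s b)) (M : reg0 A z b) :
  act1EF h (gs *o etax_at iF s b i) M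
  = actFE h h' gs M ** etx (a1 := reg_adj iF z h') (reg_x iF h') i M.
Proof. by rewrite -reg_etx; apply: act_vc. Qed.

(** The signs of [epstilde] are compensated by signs of the unit. *)
Lemma second_unitZ a b (h : b = a + alpha) e u (sg : k) : sg * sg = 1 ->
  second_unit h e u -> second_unit h (sg *: e) (sg *: u).
Proof.
move=> sg2 eu z; have [eE eF] := eu z; split=> [M|N].
  rewrite (linZ (actFE1_lin _ _)) (linZ (act1EF_lin _ _)).
  by rewrite fmapZ lcmpZl lcmpZr scalerA sg2 scale1r eE.
rewrite (linZ (actFE1_lin _ _)) (linZ (act1EF_lin _ _)).
by rewrite fmapZ lcmpZl lcmpZr scalerA sg2 scale1r eF.
Qed.

(** By cases on the value of the coroot at [a]: nonnegative, equal to [-1], and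
    at most [-2].  In each case [epstilde] and the unit are components of the
    inverses of [rho] at [a] and at [a + alpha], so that the zigzag lemmas apply
    with the weights [a - alpha], [a], [a + alpha] and [a + alpha + alpha]. *)
Theorem epstilde_counit a b (h : b = a + alpha)
  (e : hom2 A (FE D s a) (wone D a)) :
  is_epstilde e -> exists u, second_unit h e u.
Proof.
have h0 : a = (a - alpha) + alpha by rewrite subrK.
have h2 : b + alpha = b + alpha by [].
have wb := wtn_step h.
pose n := `|wtn D s a|%N; pose sg : k := (-1) ^+ n.+1.
have sg2 : sg * sg = 1 by rewrite -expr2 sqrr_sign.
rewrite /is_epstilde -/n; case: ifP => [a0|a0].
  have n2 : `|wtn D s b|%N = n.+2.
    by rewrite wb /n; case: (wtn D s a) a0 => // m _; rewrite -[RHS]addn2.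
  have b0 : 0 <= wtn D s b by rewrite wb addr_ge0.
  have [gs [gc Ha]] := rho_inv_pos (erefl n) a0.
  have [gs' [gc' Hb]] := rho_inv_pos n2 b0.
  have [e1 e2 _ _ _] := Ha.
  case=> c ec.
  (* The indeterminate multiples of lower dotted caps die on [gs]. *)
  have -> : e = sg *: (epsx_at iF s a n *o gs).
    rewrite -[LHS]vcmp1r -e1 vcmpA [e *o _]ec (linD (vcmp_linl _)).
    rewrite (linZ (vcmp_linl _)) (lin_sum (vcmp_linl _)) big1 ?addr0 // => i _.
    by rewrite -vcmpA [X in _ *o X]e2 (lin0 (vcmp_linr _)).
  exists (sg *: gc' ord_max); apply: second_unitZ => // z.
  have Pa := reg_pos_inv (z := z) h0 h Ha.
  have Pb := reg_pos_inv (z := z) h h2 Hb.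
  have N1 := reg_nilHecke iF z h0 h; have N2 := reg_nilHecke iF z h h2.
  have br := reg_braid iF (z := z) h0 h h2.
  split=> [M|N]; rewrite (actFE1_eps h0).
  - exact: (zigzagE_pos N1 N2 br Pa Pb).
  - exact: (zigzagF_pos N1 N2 br Pa Pb).
have {a0} a0 : wtn D s a < 0 by rewrite ltNge a0.
have a0' := ltW a0.
have n0 : (0 < n)%N by rewrite absz_gt0 lt_eqF.
have [m nm] : exists m, n = m.+1 by exists n.-1; rewrite prednK.
have [gs [gd Ha]] := rho_inv_neg nm a0'.
have [_ _ e3 _ _] := Ha.
case=> es ee.
have -> : e = sg *: gd ord_max.
  rewrite -[LHS]vcmp1r -e3 (linD (vcmp_linr e)) vcmpA [e *o _]es.
  rewrite (lin0 (vcmp_linl _)) add0r (lin_sum (vcmp_linr e)).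
  have ei (i : 'I_m.+1) : e *o etax_at iF s a i
      = if i == ord_max then sg *: id2 A (wone D a) else 0.
    have ni : (i < n)%N by rewrite nm.
    by apply: etrans (ee (Ordinal ni)) _; rewrite /= -/sg nm eqSS.
  rewrite (bigD1 ord_max) // big1 => [|i i_max].
    by apply: etrans (addr0 _) _; rewrite vcmpA ei eqxx (linZ (vcmp_linl _)) vcmp1l.
  by rewrite vcmpA ei (negPf i_max) (lin0 (vcmp_linl _)).
have N1 z := reg_nilHecke iF z h0 h; have N2 z := reg_nilHecke iF z h h2.
have br z := reg_braid iF (z := z) h0 h h2.
have Pa z := reg_neg_inv (z := z) h0 h Ha.
(* For [m = 0] the values are [-1] and [1], and [rho] changes shape. *)
clear e3; case: m nm => [|m] nm in gd Ha Pa *.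
  have n2 : `|wtn D s b|%N = 1%N.
    by rewrite wb; move: a0 nm; rewrite /n; case: (wtn D s a) => // -[].
  have b0 : 0 <= wtn D s b.
    by rewrite wb; move: a0 nm; rewrite /n; case: (wtn D s a) => // -[].
  have [gs' [gc' Hb]] := rho_inv_pos n2 b0.
  exists (sg *: gc' ord_max); apply: second_unitZ => // z.
  have Pb := reg_pos_inv (z := z) h h2 Hb.
  split=> [M|N].
  - exact: (zigzagE_mid (N1 z) (N2 z) (br z) (Pa z) Pb).
  - exact: (zigzagF_mid (N1 z) (N2 z) (br z) (Pa z) Pb).
have n2 : `|wtn D s b|%N = m.
  rewrite wb; move: a0 nm; rewrite /n; case: (wtn D s a) => // q _ /= [->].
  by rewrite NegzE -addn2 PoszD opprD addrNK abszN.
have b0 : wtn D s b <= 0.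
  rewrite wb; move: a0 nm; rewrite /n; case: (wtn D s a) => // q _ /= [->].
  by rewrite NegzE -addn2 PoszD opprD addrNK oppr_le0.
have [gs' [gd' Hb]] := rho_inv_neg n2 b0.
exists (sg *: - (gs' *o etax_at iF s b m)); apply: second_unitZ => // z.
have Pb := reg_neg_inv (z := z) h h2 Hb.
split=> [M|N]; rewrite (linN (act1EF_lin _ _)) (act1EF_eta h h2).
- by rewrite lcmpNr [X in - X](zigzagE_neg (a0 := reg_adj iF z h0) (N2 z) (br z) (Pa z) Pb) opprK.
- by rewrite fmapN lcmpNr [X in - X](zigzagF_neg (N1 z) (N2 z) (br z) (Pa z) Pb) opprK.
Qed.
End SecondAdjunction.

(** * Functors out of presented 2-categories *)

Section Functors.
Variables (k : comNzRingType) (C : cat1).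

Lemma eval_fun2 (G : forall a b : C, hom1 a b -> hom1 a b -> Type) (A Z : lin2 k C)
  (i : forall (a b : C) (f g : hom1 a b), G a b f g -> hom2 A f g)
  (K : lin2fun A Z) (a b : C) (f g : hom1 a b) (t : term k G f g) :
  eval (fun a b f g x => fun2 K (i a b f g x)) t = fun2 K (eval i t).
Proof.
elim: t => {a b f g} //=.
- by move=> a b f; rewrite fun2_id.
- by move=> a b f g h v -> u ->; rewrite fun2_vcmp.
- by move=> a b c g g' f f' v -> u ->; rewrite fun2_hcmp.
- by move=> a b f g; rewrite fun2_0.
- by move=> a b f g t -> u ->; rewrite (linD (@fun2_lin _ _ _ _ K _ _ _ _)).
- by move=> a b f g c t ->; rewrite (linZ (@fun2_lin _ _ _ _ K _ _ _ _)).
Qed.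

Lemma presented_ext (G : forall a b : C, hom1 a b -> hom1 a b -> Type)
  (R : forall (a b : C) (f g : hom1 a b), term k G f g -> term k G f g -> Prop)
  (Z : lin2 k C) (K K' : lin2fun (presented R) Z) :
  (forall (a b : C) (f g : hom1 a b) (x : G a b f g),
    fun2 K (inj2 R x) = fun2 K' (inj2 R x)) ->
  forall (a b : C) (f g : hom1 a b) (u : hom2 (presented R) f g),
    fun2 K u = fun2 K' u.
Proof.
move=> KK a b f g; elim/ph_ind=> t; rewrite -eval_inj2 -!eval_fun2.
congr (eval _ t); do 5!(apply: functional_extensionality_dep => ?); exact: KK.
Qed.

Definition lin2fun_id (A : lin2 k C) : lin2fun A A.
Proof. by apply: (@Lin2fun k C A A (fun a b f g u => u)). Defined.

End Functors.

(** A natural family [u] satisfying one zigzag identity and a family [v]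
    satisfying the other one agree: [v] is inserted into the zigzag of [u]. *)
Lemma unit_unique (k : comNzRingType) (V W : lcat k) (E : lfun V W) (F : lfun W V)
  (e : forall M, lhom (F (E M)) M) (u v : forall N, lhom N (E (F N))) :
  (forall N N' (g : lhom N N'), u N' ** g = fmap E (fmap F g) ** u N) ->
  (forall M, fmap E (e M) ** u (E M) = lid _) ->
  (forall N, e (F N) ** fmap F (v N) = lid _) ->
  forall N, u N = v N.
Proof.
move=> u_nat eu ev N.
by rewrite -[RHS]lcmp1l -eu -lcmpA u_nat lcmpA -fmap_cmp ev fmap_id lcmp1l.
Qed.

Section LeftDual.
Variables (I : finType) (C : cartan I) (Z : lin2 (kbase C) (words I)) (s : I).
Local Notation W := (words I).
Local Notation "[E]" := [:: LE s].
Local Notation "[F]" := [:: LF s].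
Local Notation H u v := (@hom2 (kbase C) W Z tt tt u v).
Local Notation "[::E]" := ([:: LE s] : @hom1 W tt tt).
Local Notation "[::F]" := ([:: LF s] : @hom1 W tt tt).

Definition whisker (u w w' v : @hom1 W tt tt) (f : H w w') :
    H (u ++ (w ++ v)) (u ++ (w' ++ v)) :=
  @hcmp _ W Z tt tt tt _ _ _ _ (id2 Z u) (@hcmp _ W Z tt tt tt _ _ _ _ f (id2 Z v)).

Definition left_zigzagE (e : H [:: LF s; LE s] [::]) (u : H [::] [:: LE s; LF s]) :=
  @vcmp _ W Z tt tt [E] [:: LE s; LF s; LE s] [E]
    (whisker [E] [::] e) (whisker [::] [E] u)
    = id2 Z ([E] : @hom1 W tt tt).
Definition left_zigzagF (e : H [:: LF s; LE s] [::]) (u : H [::] [:: LE s; LF s]) :=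
  @vcmp _ W Z tt tt [F] [:: LF s; LE s; LF s] [F]
    (whisker [::] [F] e) (whisker [F] [::] u)
    = id2 Z ([F] : @hom1 W tt tt).

(** [unit_unique] in the regular 2-representation, which is faithful. *)
Lemma left_unit_unique e u v : left_zigzagE e u -> left_zigzagF e v -> u = v.
Proof.
move=> eu ev.
pose V := reg0 Z tt tt.
pose E := reg1 Z tt ([E] : @hom1 W tt tt).
pose F := reg1 Z tt ([F] : @hom1 W tt tt).
have rE : real ([E] : @hom1 W tt tt) E by apply: real_reg1.
have rF : real ([F] : @hom1 W tt tt) F by apply: real_reg1.
have r1 : real ([::] : @hom1 W tt tt) (lfun_id V) by apply: real_one.
have rEF : real ([:: LE s; LF s] : @hom1 W tt tt) (lfun_cmp E F).
  exact: (real_cmp rE rF).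
pose ee M := @act _ _ Z tt tt tt _ _ e M (F (E M)) M erefl erefl.
pose uu N := @act _ _ Z tt tt tt _ _ u N N (E (F N)) erefl erefl.
pose vv N := @act _ _ Z tt tt tt _ _ v N N (E (F N)) erefl erefl.
apply: (@act_inj _ _ Z tt tt _ _ u v [::] [:: LE s; LF s] erefl erefl).
apply: (@unit_unique _ V V E F ee uu vv).
- by move=> N N' g; apply: (act_nat _ r1 rEF).
- move=> M; apply: (etrans _ (@act_id _ _ Z tt tt tt [::E] M (E M) erefl erefl)).
  rewrite -eu; apply/esym; apply: etrans (@act_vc _ _ Z tt tt tt _ _ _
    (whisker [E] [::] e) (whisker [::] [E] u) M
    (E M) (E (F (E M))) (E M) erefl erefl erefl) _.
  congr vcmp.
    exact: (@act_wh _ _ Z tt tt tt tt tt [::E] _ _ [::] e E rE M M erefl).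
  exact: (@act_wh _ _ Z tt tt tt tt tt [::] _ _ [::E] u (lfun_id V) r1 M (E M) erefl).
- move=> M; apply: (etrans _ (@act_id _ _ Z tt tt tt [::F] M (F M) erefl erefl)).
  rewrite -ev; apply/esym; apply: etrans (@act_vc _ _ Z tt tt tt _ _ _
    (whisker [::] [F] e) (whisker [F] [::] v) M
    (F M) (F (E (F M))) (F M) erefl erefl erefl) _.
  congr vcmp.
    exact: (@act_wh _ _ Z tt tt tt tt tt [::] _ _ [::F] e (lfun_id V) r1 M (F M) erefl).
  exact: (@act_wh _ _ Z tt tt tt tt tt [::F] _ _ [::] v F rF M M erefl).
Qed.
End LeftDual.

(** A functor out of [B1] without left duals extends to [B1] with left duals as
    soon as images of the counits and units satisfying the zigzag identities are
    given. *)
Section LeftDualExtension.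
Variables (I : finType) (C : cartan I) (Z : lin2 (kbase C) (words I)).
Local Notation W := (words I).
Variable K : lin2fun (B1 C false) Z.
Variables (e : forall s, @hom2 (kbase C) W Z tt tt [:: LF s; LE s] [::]).
Variables (u : forall s, @hom2 (kbase C) W Z tt tt [::] [:: LE s; LF s]).
Hypothesis eu : forall s, left_zigzagE (e s) (u s).
Hypothesis eu' : forall s, left_zigzagF (e s) (u s).

Definition left_gen (a b : W) (f g : @hom1 W a b) (x : @bgen I true a b f g) :
    @hom2 _ W Z a b f g :=
  match x in @bgen _ _ a b f g return @hom2 _ W Z a b f g with
  | gx s => fun2 (K) (bx C false s)
  | gtau s t => fun2 (K) (btau C false s t)
  | geps s => fun2 (K) (bcounit C false s)
  | geta s => fun2 (K) (bunit C false s)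
  | gepsl s _ => e s
  | getal s _ => u s
  end.

Lemma left_rel (a b : W) (f g : @hom1 W a b)
  (t1 t2 : term (kbase C) (@bgen I true) f g) : brel t1 t2 -> eval left_gen t1 = eval left_gen t2.
Proof.
(* The relations not involving left duals hold for [K]; the generators of
   [B1 false] are those of [B1 true] under other names, so that only the sums
   in the [Q] terms have to be compared. *)
pose j a b f g x := @fun2 _ W _ _ (K) a b f g (inj2 (@brel I C false) x).
have R (a' b' : W) (f' g' : @hom1 W a' b') t' u' : @brel I C false a' b' f' g' t' u' ->
    eval j t' = eval j u'.
  by move=> r; rewrite /j !eval_fun2 (eval_rel r).
have EQ w s t' (U V : @term _ W (@bgen I true) tt tt w w)
   (U' V' : @term _ W (@bgen I false) tt tt w w) :
   eval left_gen U = eval j U' -> eval left_gen V = eval j V' ->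
   eval left_gen (tQ s t' U V) = eval j (tQ s t' U' V').
  move=> hU hV; rewrite /tQ /tsumn !eval_tsum; apply: eq_bigr => p _.
  rewrite !eval_tsum; apply: eq_bigr => q _.
  by rewrite [LHS]/= [RHS]/= !eval_tpow hU hV.
have EQd w s t' (U1 U2 V : @term _ W (@bgen I true) tt tt w w)
   (U1' U2' V' : @term _ W (@bgen I false) tt tt w w) :
   eval left_gen U1 = eval j U1' -> eval left_gen U2 = eval j U2' ->
   eval left_gen V = eval j V' ->
   eval left_gen (tQdiff s t' U1 U2 V) = eval j (tQdiff s t' U1' U2' V').
  move=> hU hU' hV; rewrite /tQdiff /tsumn !eval_tsum; apply: eq_bigr => p _.
  rewrite !eval_tsum; apply: eq_bigr => q _.
  rewrite [LHS]/= [RHS]/= !eval_tpow hV !eval_tsum.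
  congr (_ *: vcmp _ _).
  by apply: eq_bigr => r _; rewrite [LHS]/= [RHS]/= !eval_tpow hU hU'.
case=> {a b f g t1 t2}.
- move=> s t; rewrite (EQ _ _ _ _ _ (twh [:: LE t] [::] (ttx C false s))
    (twh [::] [:: LE s] (ttx C false t))) //.
  exact: (R _ _ _ _ _ _ (rel_quad C false s t)).
- by move=> s t r sr; exact: (R _ _ _ _ _ _ (rel_braid C false t sr)).
- move=> s t; rewrite (EQd _ _ _ _ _ _
    (twh [::] [:: LE t; LE s] (ttx C false s)) (twh [:: LE s; LE t] [::] (ttx C false s))
    (twh [:: LE s] [:: LE s] (ttx C false t))) //.
  exact: (R _ _ _ _ _ _ (rel_braid_eq C false s t)).
- by move=> s t st; exact: (R _ _ _ _ _ _ (rel_dotl C false st)).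
- by move=> s; exact: (R _ _ _ _ _ _ (rel_dotl_eq C false s)).
- by move=> s t st; exact: (R _ _ _ _ _ _ (rel_dotr C false st)).
- by move=> s; exact: (R _ _ _ _ _ _ (rel_dotr_eq C false s)).
- by move=> s; exact: (R _ _ _ _ _ _ (rel_dualE C false s)).
- by move=> s; exact: (R _ _ _ _ _ _ (rel_dualF C false s)).
- by move=> s h; exact: eu.
- by move=> s h; exact: eu'.
Qed.

Definition left_ext : lin2fun (B1 C true) Z := presented_lift left_rel.

Lemma left_extE (a b : W) (f g : @hom1 W a b) (x : @bgen I true a b f g) :
  fun2 left_ext (inj2 (@brel I C true) x) = left_gen x.
Proof. by rewrite [LHS]presented_liftE. Qed.
End LeftDualExtension.

(** The unit of a left dual is determined by its counit, in the target of a
    functor as well; hence a functor out of [B1 true] is determined by its values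
    on the generators other than the units of the left duals. *)
Section LeftDualUnique.
Variables (I : finType) (C : cartan I) (Z : lin2 (kbase C) (words I)).
Local Notation W := (words I).
Local Notation gen K x := (@fun2 _ W _ Z K tt tt _ _ (inj2 (@brel I C true) x)).

Lemma fun2_zigzagE (K : lin2fun (B1 C true) Z) s :
  left_zigzagE (gen K (gepsl s isT)) (gen K (getal s isT)).
Proof.
have E := eval_rel (@rel_ldualE I C true s isT).
have := congr1 (fun t => @fun2 _ W _ Z K tt tt [:: LE s] [:: LE s] t) E.
by rewrite -!eval_fun2.
Qed.

Lemma fun2_zigzagF (K : lin2fun (B1 C true) Z) s :
  left_zigzagF (gen K (gepsl s isT)) (gen K (getal s isT)).
Proof.
have E := eval_rel (@rel_ldualF I C true s isT).
have := congr1 (fun t => @fun2 _ W _ Z K tt tt [:: LF s] [:: LF s] t) E.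
by rewrite -!eval_fun2.
Qed.

Lemma left_dual_ext (K K' : lin2fun (B1 C true) Z) :
  (forall (a b : W) (f g : @hom1 W a b) (x : @bgen I false a b f g),
    fun2 K (bgen_incl C x) = fun2 K' (bgen_incl C x)) ->
  (forall s, gen K (gepsl s isT) = gen K' (gepsl s isT)) ->
  forall (a b : W) (f g : @hom1 W a b) (x : @bgen I true a b f g),
    fun2 K (inj2 (@brel I C true) x) = fun2 K' (inj2 (@brel I C true) x).
Proof.
move=> KK Ke a b f g; case=> {a b f g} [s|s t|s|s|s h|s h].
- exact: (KK _ _ _ _ (gx false s)).
- exact: (KK _ _ _ _ (gtau false s t)).
- exact: (KK _ _ _ _ (geps false s)).
- exact: (KK _ _ _ _ (geta false s)).
- by rewrite (bool_irrelevance h isT) Ke.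
- rewrite (bool_irrelevance h isT); apply: left_unit_unique (fun2_zigzagF K' s).
  by rewrite -Ke; apply: fun2_zigzagE.
Qed.
End LeftDualUnique.

(** * The inverse functor *)

Section FromWords.
Variables (I : finType) (C : cartan I) (X Y : zmodType) (D : root_datum C X Y).
Variables (l : bool) (A : lin2 (kbase C) (weights D)).
Local Notation W := (words I).

Lemma whom_wd (x y : X) (u : @hom1 (weights D) x y) : u = wd (svalP u).
Proof. exact: whom_inj. Qed.

(** The converse of [to_words]: a 2-arrow of [A1] is sent to the member of the
    family of its underlying 2-arrow of [B1] at its own weights. *)
Definition from_words (K : lin2fun (B1 C l) (one_object A)) : lin2fun (A1 D l) A.
Proof.
unshelve refine (@Lin2fun _ (weights D) (A1 D l) A
  (fun x y u v t => cst (whom_wd u) (whom_wd v)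
     (@fun2 _ W _ _ K tt tt (sval u) (sval v) t x y (svalP u) (svalP v))) _ _ _ _).
- move=> x y u v c t t'.
  by rewrite (@fun2_lin _ W _ _ K tt tt (sval u) (sval v)) wfam_lin cst_lin.
- move=> x y u.
  apply: etrans (congr1 (fun f : wfam A _ _ => cst _ _ (f x y _ _))
    (@fun2_id _ W _ _ K tt tt (sval u))) _.
  by rewrite /= /pid idto_refl (cst_id2 A (whom_wd u) (whom_wd u) (erefl u)).
- move=> x y u v w t' t.
  apply: etrans (congr1 (fun f : wfam A _ _ => cst _ _ (f x y _ _))
    (@fun2_vcmp _ W _ _ K tt tt (sval u) (sval v) (sval w) t' t)) _.
  by rewrite cst_vc; congr cst; apply: (pvcE _ _ _ (svalP v)).
- move=> x y z v v' u u' t' t.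
  apply: etrans (congr1 (fun f : wfam A _ _ => cst _ _ (f x z _ _))
    (@fun2_hcmp _ W _ _ K tt tt tt (sval v) (sval v') (sval u) (sval u') t' t)) _.
  rewrite cst_hcl cst_hcr cst_trans.
  rewrite [X in cst _ _ X](phcE _ _ (wd_cat _ (svalP v) (svalP u))
    (wd_cat _ (svalP v') (svalP u'))) cst_trans; exact: cst_irr.
Defined.

Lemma from_wordsE (K : lin2fun (B1 C l) (one_object A)) x y w w' (h : wt D w = y - x)
    (h' : wt D w' = y - x) (f : @hom2 _ W (B1 C l) tt tt w w') :
  at_weights (from_words K) h h' f = @fun2 _ W _ _ K tt tt w w' f x y h h'.
Proof. exact: wfam_irr. Qed.

(** Each 2-arrow of [A1] is one of [B1] at some weights, and the latter is
    determined by the generators. *)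
Lemma A1_ext (F F' : lin2fun (A1 D l) A) :
  (forall (a b : W) (f g : @hom1 W a b) (x : @bgen I l a b f g),
    fun2 (to_words F) (inj2 (@brel I C l) x)
    = fun2 (to_words F') (inj2 (@brel I C l) x)) ->
  forall (x y : X) (u v : whom D x y) (t : hom2 (A1 D l) u v),
    fun2 F t = fun2 F' t.
Proof.
move=> /presented_ext FF x y [u hu] [v hv] t.
by have /(congr1 (fun f => f x y hu hv)) := FF tt tt u v t.
Qed.
End FromWords.

Section Inverse.
Variables (I : finType) (C : cartan I) (X Y : zmodType) (D : root_datum C X Y).
Local Notation W := (words I).
Local Notation word := (seq (letter I)).
Local Notation A := (AA D false).
Local Notation iF := (iA D false).

(** Chosen by unique existence, hence characterized by [is_epstilde]. *)
Definition epstilde s (a : X) : hom2 A (FE D s a) (wone D a) :=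
  sval (cid (@is_epstilde_unique _ _ _ _ D false s a)).

Lemma epstildeP s a : is_epstilde (epstilde s a).
Proof. by case: (svalP (cid (@is_epstilde_unique _ _ _ _ D false s a))). Qed.

Lemma epstilde_unique s a (e : hom2 A (FE D s a) (wone D a)) :
  is_epstilde e -> epstilde s a = e.
Proof. by case: (svalP (cid (@is_epstilde_unique _ _ _ _ D false s a))) => _; apply. Qed.

Definition etatilde s (b : X) : hom2 A (wone D b) (EF D s b) :=
  sval (cid (epstilde_counit (esym (subrK (sroot D s) b)) (epstildeP s _))).

Lemma etatildeP s a b (h : b = a + sroot D s) : second_unit h (epstilde s a) (etatilde s b).
Proof.
have E : b - sroot D s = a by rewrite h addrK.
subst a; have := svalP (cid (epstilde_counit (esym (subrK (sroot D s) b)) (epstildeP s _))).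
by rewrite -/(etatilde s b) (Prop_irrelevance (esym _) h).
Qed.

(** Both words have weight [0], so that the ends of a member of the family are at
    equal weights and the value [0] never occurs; it saves deriving this
    equality before matching on it. *)
Section Diagonal.
Variables (w w' : word) (p : forall a : X, wt D w = a - a)
  (q : forall a : X, wt D w' = a - a).
Variable g : forall a, hom2 A (wd (p a)) (wd (q a)).

Definition wdiag : wfam A w w' := fun x y =>
  if x =P y is ReflectT e then
    match e in _ = y' return forall h h', hom2 A (@wd _ _ _ _ D x y' w h) (wd h')
    with erefl => fun h h' => cst (wd_eq h (p x)) (wd_eq h' (q x)) (g x) end
  else fun h h' => 0.

Lemma wdiagE a h h' : wdiag (x := a) (y := a) h h'
  = cst (wd_eq h (p a)) (wd_eq h' (q a)) (g a).
Proof.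
by rewrite /wdiag; case: eqP => // e; rewrite (Prop_irrelevance e (erefl a)).
Qed.
End Diagonal.

Definition epstilde_words s : wfam A [:: LF s; LE s] [::] :=
  wdiag (p := wtFE0 D s) (q := wt0 D) (epstilde s).
Definition etatilde_words s : wfam A [::] [:: LE s; LF s] :=
  wdiag (p := wt0 D) (q := wtEF0 D s) (etatilde s).

Lemma wtE_inv s (x y : X) : wt D [:: LE s] = y - x -> y = x + sroot D s.
Proof. by rewrite /wt big_cons big_nil addr0 /= => ->; rewrite addrC subrK. Qed.
Lemma wtF_inv s (x y : X) : wt D [:: LF s] = y - x -> x = y + sroot D s.
Proof.
rewrite /wt big_cons big_nil addr0 /= => /eqP; rewrite eqr_oppLR opprB => /eqP ->.
by rewrite addrC subrK.
Qed.

(** The zigzag identities of [epstilde_counit], read off from the action on the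
    identity 1-arrow of [x]. *)
Lemma epstilde_zigzagE s : left_zigzagE (Z := one_object A) (@epstilde_words s) (@etatilde_words s).
Proof.
apply: wfamP => x y h h'; have hb := wtE_inv h.
have hh : wt D [:: LE s; LF s; LE s] = y - x.
  by rewrite -[[:: _; _; _]]/([:: LE s; LF s] ++ [:: LE s]) wt_cat (wtEF0 D s x) h' subrr add0r.
rewrite [LHS](pvcE _ _ _ hh).
pose E := reg1 A x (wd (wtE hb)); pose F := reg1 A x (wd (wtF hb)).
pose M := wone D x : reg0 A x x.
have eM : E M = cmp (wd h) (wone D x) by apply: whom_inj.
have eM' : E M = cmp (wd h') (wone D x) by apply: whom_inj.
apply: (act_inj (e := eM) (e' := eM')).
have eQ : E (F (E M)) = cmp (wd hh) (wone D x) by apply: whom_inj.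
rewrite (act_vc _ _ eM eQ eM').
have -> : act (pid A h h') eM eM' = id2 A (E M).
  by case: _ / (Prop_irrelevance h h') eM' => eM'; rewrite /pid idto_refl act_id.
apply: etrans _ (proj1 (etatildeP hb x) M); congr vcmp.
  have eP : F (E M) = cmp (wd (wtFE0 D s x)) M by apply: whom_inj.
  have eR : M = cmp (wd (wt0 D x)) M by apply: whom_inj.
  apply: etrans (@act_pwhisker _ _ _ _ _ A x x x x y [:: LE s] _ _ [::] (wtE hb)
    (wtFE0 D s x) (wt0 D x) (wt0 D x) hh h' (@epstilde_words s) E (real_reg1 _ _ _)
    M M eR (F (E M)) M eP eR eQ eM') _.
  apply: congr1; rewrite /epstilde_words /etatilde_words wdiagE; exact: act_cst.
have eN : E M = cmp (wd (wtE hb)) M by [].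
have eP : E M = cmp (wd (wt0 D y)) (E M) by apply: whom_inj.
have eR : E (F (E M)) = cmp (wd (wtEF0 D s y)) (E M) by apply: whom_inj.
apply: etrans (@act_pwhisker _ _ _ _ _ A x x y y y [::] _ _ [:: LE s] (wt0 D y)
  (wt0 D y) (wtEF0 D s y) (wtE hb) h hh (@etatilde_words s) (lfun_id _) (real_wd0 _ _ _)
  M (E M) eN (E M) (E (F (E M))) eP eR eM eQ) _.
rewrite /epstilde_words /etatilde_words wdiagE; exact: act_cst.
Qed.

Lemma epstilde_zigzagF s : left_zigzagF (Z := one_object A) (@epstilde_words s) (@etatilde_words s).
Proof.
apply: wfamP => x y h h'; have hb := wtF_inv h.
have hh : wt D [:: LF s; LE s; LF s] = y - x.
  by rewrite -[[:: _; _; _]]/([:: LF s] ++ [:: LE s; LF s]) wt_cat (wtEF0 D s x) h' subrr addr0.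
rewrite [LHS](pvcE _ _ _ hh).
pose E := reg1 A x (wd (wtE hb)); pose F := reg1 A x (wd (wtF hb)).
pose M := wone D x : reg0 A x x.
have eM : F M = cmp (wd h) (wone D x) by apply: whom_inj.
have eM' : F M = cmp (wd h') (wone D x) by apply: whom_inj.
apply: (act_inj (e := eM) (e' := eM')).
have eQ : F (E (F M)) = cmp (wd hh) (wone D x) by apply: whom_inj.
rewrite (act_vc _ _ eM eQ eM').
have -> : act (pid A h h') eM eM' = id2 A (F M).
  by case: _ / (Prop_irrelevance h h') eM' => eM'; rewrite /pid idto_refl act_id.
apply: etrans _ (proj2 (etatildeP hb x) M); congr vcmp.
  have eN : F M = cmp (wd (wtF hb)) M by [].
  have eP : F M = cmp (wd (wt0 D y)) (F M) by apply: whom_inj.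
  have eR : F (E (F M)) = cmp (wd (wtFE0 D s y)) (F M) by apply: whom_inj.
  apply: etrans (@act_pwhisker _ _ _ _ _ A x x y y y [::] _ _ [:: LF s] (wt0 D y)
    (wtFE0 D s y) (wt0 D y) (wtF hb) hh h' (@epstilde_words s) (lfun_id _)
    (real_wd0 _ _ _) M (F M) eN (F (E (F M))) (F M) eR eP eQ eM') _.
  rewrite /epstilde_words /etatilde_words wdiagE; exact: act_cst.
have eP : E (F M) = cmp (wd (wtEF0 D s x)) M by apply: whom_inj.
have eR : M = cmp (wd (wt0 D x)) M by apply: whom_inj.
apply: etrans (@act_pwhisker _ _ _ _ _ A x x x x y [:: LF s] _ _ [::] (wtF hb)
  (wt0 D x) (wtEF0 D s x) (wt0 D x) h hh (@etatilde_words s) F (real_reg1 _ _ _)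
  M M eR M (E (F M)) eR eP eM eQ) _.
apply: congr1; rewrite /epstilde_words /etatilde_words wdiagE; exact: act_cst.
Qed.

End Inverse.

Section InverseFunctor.
Variables (I : finType) (C : cartan I) (X Y : zmodType) (D : root_datum C X Y).
Local Notation W := (words I).
Local Notation A := (AA D false).
Local Notation A' := (AA' D).

Definition inv_words : lin2fun (B1 C true) (one_object A) :=
  left_ext (to_words (iA D false)) (@epstilde_zigzagE _ C _ _ D) (@epstilde_zigzagF _ C _ _ D).

Definition inv_A1 : lin2fun (A1 D true) A := from_words inv_words.

Lemma inv_A1_gen (w w' : seq (letter I)) (x : @bgen I true tt tt w w') p q
    (h : wt D w = q - p) (h' : wt D w' = q - p) :
  at_weights inv_A1 h h' (inj2 (@brel I C true) x)
  = @left_gen _ _ (one_object A) (to_words (iA D false)) (@epstilde_words _ C _ _ D)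
      (@etatilde_words _ C _ _ D) tt tt w w' x p q h h'.
Proof.
have E := left_extE (to_words (iA D false)) (@epstilde_zigzagE _ C _ _ D)
  (@epstilde_zigzagF _ C _ _ D) x.
rewrite /inv_A1 from_wordsE; exact: (congr1 (fun f : wfam A _ _ => f p q h h') E).
Qed.

Lemma inv_A1_incl (x y : X) (u v : whom D x y) (t : hom2 (A1 D false) u v) :
  fun2 inv_A1 (fun2 (A1_incl D) t) = fun2 (iA D false) t.
Proof.
apply: (@A1_ext _ _ _ _ _ _ _ (lin2fun_comp inv_A1 (A1_incl D)) (iA D false)).
move=> a b f g w; apply: wfamP => p q h h'.
case: w h h' => [r|r t'|r|r|r|r] h h' //.
- apply: etrans (congr1 (at_weights inv_A1 h h') (B1_incl_gen C (gx false r))) _.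
  exact: (inv_A1_gen (gx true r)).
- apply: etrans (congr1 (at_weights inv_A1 h h') (B1_incl_gen C (gtau false r t'))) _.
  exact: (inv_A1_gen (gtau true r t')).
- apply: etrans (congr1 (at_weights inv_A1 h h') (B1_incl_gen C (geps false r))) _.
  exact: (inv_A1_gen (geps true r)).
- apply: etrans (congr1 (at_weights inv_A1 h h') (B1_incl_gen C (geta false r))) _.
  exact: (inv_A1_gen (geta true r)).
Qed.

Lemma inv_A1_arr (j : loc_ix D) (p : ms_P (loc_shape j)) (q : ms_Q (loc_shape j)) :
  fun2 inv_A1 (loc_arr true (j := j) p q)
  = fun2 (iA D false) (loc_arr false (j := j) p q).
Proof. by rewrite -A1_incl_arr inv_A1_incl. Qed.

Definition inv_AA : lin2fun (AA D true) A.
Proof.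
apply: (loc_lift (m := @loc_arr _ _ _ _ D true) (F := inv_A1)
  (inv := fun j q p => loc_ginv (@loc_arr _ _ _ _ D false) q p)).
- move=> j p p'; rewrite -(loc_invl_eq (@loc_arr _ _ _ _ D false)).
  by apply: eq_bigr => q _; rewrite inv_A1_arr.
- move=> j q q'; rewrite -(loc_invr_eq (@loc_arr _ _ _ _ D false)).
  by apply: eq_bigr => p _; rewrite inv_A1_arr.
Defined.

Lemma inv_AA_old (x y : X) (u v : whom D x y) (t : hom2 (A1 D true) u v) :
  fun2 inv_AA (fun2 (iA D true) t) = fun2 inv_A1 t.
Proof. exact: presented_liftE. Qed.

Lemma inv_AA_ginv (j : loc_ix D) (q : ms_Q (loc_shape j)) (p : ms_P (loc_shape j)) :
  fun2 inv_AA (loc_ginv (@loc_arr _ _ _ _ D true) q p)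
  = loc_ginv (@loc_arr _ _ _ _ D false) q p.
Proof. exact: presented_liftE. Qed.

(** The equations that define [epstilde] contain, apart from [e], only the
    2-arrows that [K] is assumed to preserve. *)
Lemma is_epstilde_map l l' (K : lin2fun (AA D l) (AA D l')) s a :
  fun2 K (sigmaA D l s a) = sigmaA D l' s a ->
  (forall i, fun2 K (epsxA D l s a i) = epsxA D l' s a i) ->
  (forall i, fun2 K (etaxA D l s a i) = etaxA D l' s a i) ->
  forall e, @is_epstilde _ _ _ _ D l s a e ->
    @is_epstilde _ _ _ _ D l' s a (fun2 K e).
Proof.
move=> Ks Kx Ke e; rewrite /is_epstilde.
case: ifP => _ [e1 e2].
  exists (fun i => fun2 K (e1 i)); rewrite -Ks -fun2_vcmp e2.
  rewrite (linD (@fun2_lin _ _ _ _ K _ _ _ _)) (linZ (@fun2_lin _ _ _ _ K _ _ _ _)).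
  rewrite Kx fun2_sum; congr (_ + _); apply: eq_bigr => i _.
  by rewrite fun2_vcmp Kx.
split; first by rewrite -Ks -fun2_vcmp e1 fun2_0.
move=> i; rewrite -Ke -fun2_vcmp e2; case: eqP => _; last exact: fun2_0.
by rewrite (linZ (@fun2_lin _ _ _ _ K _ _ _ _)) fun2_id.
Qed.

Lemma inv_AA_incl (x y : X) (u v : whom D x y) (t : hom2 (A1 D false) u v) t' :
  fun2 (A1_incl D) t = t' -> fun2 inv_AA (fun2 (iA D true) t') = fun2 (iA D false) t.
Proof. by move=> <-; rewrite inv_AA_old inv_A1_incl. Qed.

Lemma inv_AA_epstilde s a (e : hom2 (AA D true) (FE D s a) (wone D a)) :
  is_epstilde e -> fun2 inv_AA e = epstilde D s a.
Proof.
move=> he; apply/esym/epstilde_unique; move: he; apply: is_epstilde_map.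
- by apply: inv_AA_incl; apply: B1_incl_sigma.
- by move=> i; apply: inv_AA_incl; apply: B1_incl_epsx.
- by move=> i; apply: inv_AA_incl; apply: B1_incl_etax.
Qed.

Lemma inv_AA_epsl s a : fun2 inv_AA (epslA D s a) = epstilde D s a.
Proof.
rewrite inv_AA_old.
apply: etrans (inv_A1_gen (gepsl s isT) (wtFE0 D s a) (wt0 D a)) _.
by rewrite /= /epstilde_words wdiagE cst_id.
Qed.

(** The added relation holds in [AA]: [epsilon^l] and [epstilde] of [AA true] are
    both sent to [epstilde]. *)
Definition inv_AA' : lin2fun A' A.
Proof.
apply: (@presented_lift _ _ _ A (fun a b f g u => fun2 inv_AA u)
  (quot_rel (@epsl_rel _ _ _ _ D))).
move=> a b f g t u; case=> {a b f g t u} [a b f g t u|a b f g u v].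
  exact: inc_rel_eval.
case=> {a b f g u v} s a e he.
by apply: (etrans (inv_AA_epsl s a)); rewrite -(inv_AA_epstilde he).
Defined.

Lemma inv_AA'_quot (x y : X) (u v : whom D x y) (t : hom2 (AA D true) u v) :
  fun2 inv_AA' (fun2 (quot_fun (@epsl_rel _ _ _ _ D)) t) = fun2 inv_AA t.
Proof. exact: presented_liftE. Qed.
End InverseFunctor.

Section InverseLaws.
Variables (I : finType) (C : cartan I) (X Y : zmodType) (D : root_datum C X Y).
Local Notation W := (words I).
Local Notation A := (AA D false).
Local Notation A' := (AA' D).
Local Notation qf := (quot_fun (@epsl_rel _ _ _ _ D)).

Lemma AA_AA'_old (x y : X) (u v : whom D x y) (t : hom2 (A1 D false) u v) :
  fun2 (AA_AA' D) (fun2 (iA D false) t)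
  = fun2 qf (fun2 (iA D true) (fun2 (A1_incl D) t)).
Proof. exact: presented_liftE. Qed.

Lemma AA_AA'_ginv (j : loc_ix D) (q : ms_Q (loc_shape j)) (p : ms_P (loc_shape j)) :
  fun2 (AA_AA' D) (loc_ginv (@loc_arr _ _ _ _ D false) q p)
  = fun2 qf (loc_ginv (@loc_arr _ _ _ _ D true) q p).
Proof. exact: presented_liftE. Qed.

(** The generators of [AA], namely those of [A1] and the formal inverses, are
    fixed. *)
Lemma inv_AA'K (x y : X) (u v : whom D x y) (t : hom2 A u v) :
  fun2 (inv_AA' D) (fun2 (AA_AA' D) t) = t.
Proof.
apply: (@presented_ext _ _ _ _ _ (lin2fun_comp (inv_AA' D) (AA_AA' D))
  (lin2fun_id A)) => a b f g; case=> {a b f g} [a b f g w|j q p].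
- suff : fun2 (inv_AA' D) (fun2 (AA_AA' D) (fun2 (iA D false) w))
    = fun2 (iA D false) w by [].
  by rewrite AA_AA'_old inv_AA'_quot inv_AA_old inv_A1_incl.
- pose g := loc_ginv (@loc_arr _ _ _ _ D false) q p.
  suff : fun2 (inv_AA' D) (fun2 (AA_AA' D) g) = g by [].
  by rewrite AA_AA'_ginv inv_AA'_quot inv_AA_ginv.
Qed.

(** The canonical functor into [AA'] before the relation on [epsilon^l] is
    imposed; it shows that [epstilde] of [AA] maps to [epstilde] of [AA true]. *)
Definition AA_incl : lin2fun A (AA D true).
Proof.
apply: (loc_lift (m := @loc_arr _ _ _ _ D false)
  (F := lin2fun_comp (iA D true) (A1_incl D))
  (inv := fun j q p => loc_ginv (@loc_arr _ _ _ _ D true) q p)).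
- move=> j p p'; rewrite -(loc_invl_eq (@loc_arr _ _ _ _ D true)).
  by apply: eq_bigr => q _; rewrite -A1_incl_arr.
- move=> j q q'; rewrite -(loc_invr_eq (@loc_arr _ _ _ _ D true)).
  by apply: eq_bigr => p _; rewrite -A1_incl_arr.
Defined.

Lemma AA_incl_old (x y : X) (u v : whom D x y) (t : hom2 (A1 D false) u v) t' :
  fun2 (A1_incl D) t = t' ->
  fun2 AA_incl (fun2 (iA D false) t) = fun2 (iA D true) t'.
Proof. by move=> <-; apply: presented_liftE. Qed.

Lemma quot_AA_incl (x y : X) (u v : whom D x y) (t : hom2 A u v) :
  fun2 (AA_AA' D) t = fun2 qf (fun2 AA_incl t).
Proof.
apply: (@presented_ext _ _ _ _ _ (AA_AA' D) (lin2fun_comp qf AA_incl)).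
move=> a b f g; case=> {a b f g} [a b f g w|j q p].
- suff : fun2 (AA_AA' D) (fun2 (iA D false) w)
    = fun2 qf (fun2 AA_incl (fun2 (iA D false) w)) by [].
  by rewrite AA_AA'_old (AA_incl_old (erefl _)).
- pose g := loc_ginv (@loc_arr _ _ _ _ D false) q p.
  suff : fun2 (AA_AA' D) g = fun2 qf (fun2 AA_incl g) by [].
  rewrite AA_AA'_ginv; congr (fun2 qf _); apply/esym; exact: presented_liftE.
Qed.

(** By uniqueness the image of [epstilde] in [AA true] is the arrow to which the
    added relation equates [epsilon^l]. *)
Lemma AA_AA'_epstilde s a : fun2 (AA_AA' D) (epstilde D s a) = fun2 qf (epslA D s a).
Proof.
rewrite quot_AA_incl; apply/esym.
have h : @is_epstilde _ _ _ _ D true s a (fun2 AA_incl (epstilde D s a)).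
  move: (epstildeP D s a); apply: is_epstilde_map.
  - by apply: AA_incl_old; apply: B1_incl_sigma.
  - by move=> i; apply: AA_incl_old; apply: B1_incl_epsx.
  - by move=> i; apply: AA_incl_old; apply: B1_incl_etax.
by apply/phomP/eqt_rel/quot_id; exact: (EpslRel h).
Qed.

(** The counits of the left duals are fixed by [AA_AA'_epstilde], and then the
    units by [left_dual_ext]. *)
Lemma AA_AA'_inv_A1 (x y : X) (u v : whom D x y) (t : hom2 (A1 D true) u v) :
  fun2 (AA_AA' D) (fun2 (inv_A1 D) t) = fun2 qf (fun2 (iA D true) t).
Proof.
apply: (@A1_ext _ _ _ _ _ _ _ (lin2fun_comp (AA_AA' D) (inv_A1 D))
  (lin2fun_comp qf (iA D true))).
apply: left_dual_ext => [a b f g w|s].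
  apply: wfamP => p q h h'.
  have K (w1 w2 : seq (letter I)) (e : wt D w1 = q - p) (e' : wt D w2 = q - p)
      (t1 : @hom2 _ W (B1 C false) tt tt w1 w2) t2 : fun2 (B1_incl C) t1 = t2 ->
      at_weights (lin2fun_comp (AA_AA' D) (inv_A1 D)) e e' t2
      = at_weights (lin2fun_comp qf (iA D true)) e e' t2.
    move=> <-; pose t0 := t1 : @hom2 _ _ (A1 D false) p q (wd e) (wd e').
    suff : fun2 (AA_AA' D) (fun2 (inv_A1 D) (fun2 (A1_incl D) t0))
      = fun2 qf (fun2 (iA D true) (fun2 (A1_incl D) t0)) by [].
    by rewrite inv_A1_incl AA_AA'_old.
  by case: w h h' => [r|r t'|r|r|r|r] h h' //; apply: (K _ _ _ _ _ _ (B1_incl_gen C _)).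
apply: wfamP => p q h h'.
have E : q = p by move: h'; rewrite /= wt_nil => /eqP; rewrite eq_sym subr_eq0 => /eqP.
subst q; case: _ / (Prop_irrelevance (wtFE0 D s p) h).
case: _ / (Prop_irrelevance (wt0 D p) h').
suff : fun2 (AA_AA' D) (fun2 (inv_A1 D) (bcounitl C s : hom2 (A1 D true) (FE D s p) (wone D p)))
  = fun2 qf (epslA D s p) by [].
by rewrite -inv_AA_old [fun2 (inv_AA D) _]inv_AA_epsl AA_AA'_epstilde.
Qed.

Lemma AA_AA'_inv_AA (x y : X) (u v : whom D x y) (t : hom2 (AA D true) u v) :
  fun2 (AA_AA' D) (fun2 (inv_AA D) t) = fun2 qf t.
Proof.
apply: (@presented_ext _ _ _ _ _ (lin2fun_comp (AA_AA' D) (inv_AA D)) qf).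
move=> a b f g; case=> {a b f g} [a b f g w|j q p].
- suff : fun2 (AA_AA' D) (fun2 (inv_AA D) (fun2 (iA D true) w))
    = fun2 qf (fun2 (iA D true) w) by [].
  by rewrite inv_AA_old AA_AA'_inv_A1.
- pose g := loc_ginv (@loc_arr _ _ _ _ D true) q p.
  suff : fun2 (AA_AA' D) (fun2 (inv_AA D) g) = fun2 qf g by [].
  by rewrite inv_AA_ginv AA_AA'_ginv.
Qed.

Lemma AA_AA'K (x y : X) (u v : whom D x y) (t : hom2 A' u v) :
  fun2 (AA_AA' D) (fun2 (inv_AA' D) t) = t.
Proof.
apply: (@presented_ext _ _ _ _ _ (lin2fun_comp (AA_AA' D) (inv_AA' D))
  (lin2fun_id A')) => a b f g w.
suff : fun2 (AA_AA' D) (fun2 (inv_AA' D) (fun2 qf w)) = fun2 qf w by [].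
by rewrite inv_AA'_quot AA_AA'_inv_AA.
Qed.
End InverseLaws.

(** * Restriction along an isomorphism *)

Section Restriction.
Variables (k : comNzRingType) (C : cat1) (B : lfsub k) (A A' : lin2 k C).
Variables (F : lin2fun A A') (G : lin2fun A' A).
Hypothesis FK : forall (a b : C) (f g : hom1 a b) (u : hom2 A f g),
  fun2 G (fun2 F u) = u.
Hypothesis GK : forall (a b : C) (f g : hom1 a b) (u : hom2 A' f g),
  fun2 F (fun2 G u) = u.
Variables (Q' : rep2 B A' -> Prop) (Q : rep2 B A -> Prop).
Hypothesis QQ : forall V, Q' V -> Q (restr0 F V).
Hypothesis QQ' : forall V, Q V -> Q' (restr0 G V).

(** A modification refers only to 1-arrows, which [A] and [A'] share. *)
Lemma restriction_full (V W : rep2 B A') (S T : Defs.pnat V W) :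
  bijective (@restr2 k C B A A' F V W S T).
Proof.
pose inv (m : modif (restr1 F S) (restr1 F T)) : modif S T :=
  @Modif _ _ _ _ V W S T m (@md_nat _ _ _ _ _ _ _ _ m).
by exists inv => m; apply: modif_eq.
Qed.

(** Every 2-arrow of [A'] is the image of one of [A], so that naturality for the
    restrictions is naturality for [A']. *)
Definition unrestr1 (V W : rep2 B A') (S : Defs.pnat (restr0 F V) (restr0 F W)) : Defs.pnat V W.
Proof.
apply: (@Pnat _ _ _ _ V W S (@p1_in _ _ _ _ _ _ S) (fun a b f => p2 S f)
  (@p2_iso _ _ _ _ _ _ S) _ (@p2_cmp _ _ _ _ _ _ S) (@p2_one _ _ _ _ _ _ S)).
by move=> a b f g u M; rewrite -(GK u); exact: (p2_nat S (fun2 G u) M).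
Defined.

Lemma unrestr1K (V W : rep2 B A') (S : Defs.pnat (restr0 F V) (restr0 F W)) :
  restr1 F (unrestr1 S) = S.
Proof. by case: S => *; rewrite /restr1 /=; congr Pnat; apply: Prop_irrelevance. Qed.

(** A 2-representation is determined by its data, as its axioms are proof
    irrelevant; here only the data on 2-arrows is replaced by equal data. *)
Lemma rep2_same_data (V : rep2 B A) r2' : @r2 _ _ _ _ V = r2' ->
  forall p q r s t u v,
    @Rep2 k C B A V (@r0_in _ _ _ _ V) (@r1 _ _ _ _ V) (@r1_in _ _ _ _ V) r2'
      p q r (@rc _ _ _ _ V) (@rc_iso _ _ _ _ V) (@ru _ _ _ _ V)
      (@ru_iso _ _ _ _ V) s t u v = V.
Proof.
move=> E; subst r2'; case: V => V0 i0 V1 i1 V2 p' q' r' c ci w wi s' t' u' v' /= *.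
by congr (@Rep2 k C B A V0 i0 V1 i1 V2 _ _ _ c ci w wi _ _ _ _);
  apply: Prop_irrelevance.
Qed.

Lemma restr0K (V : rep2 B A) : restr0 F (restr0 G V) = V.
Proof.
apply: rep2_same_data; do 5!(apply: functional_extensionality_dep => ?).
by rewrite /= FK.
Qed.

(** Restriction is the identity on 2-arrows, surjective on 1-arrows and
    surjective on objects. *)
Theorem restriction_equivalence : equivalence2 (restriction (F := F) QQ).
Proof.
split.
- move=> V W S T; exact: restriction_full.
- move=> V W h; exists (unrestr1 h).
  suff : iso1 (h : @b1 (rep_bicat Q) (restriction QQ V) (restriction QQ W)) h.
    by rewrite -{1}(unrestr1K h).
  exists (bid h); exists (bid h); by split; apply: bvc1l.
- move=> [V QV]; exists (exist _ (restr0 G V) (QQ' QV)).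
  have -> : restriction QQ (exist _ (restr0 G V) (QQ' QV)) = exist _ V QV.
    by apply: eq_exist; apply: restr0K.
  exists (bone _), (bone _).
  by split; exists (blu _); apply: blu_inv.
Qed.
End Restriction.

Theorem theorem5p16 (I : finType) (C : cartan I) (X Y : zmodType)
  (D : root_datum C X Y) (B : lfsub (kbase C)) :
  equivalence2 (int_restriction D B).
Proof.
apply: (restriction_equivalence (G := inv_AA' D)).
- exact: (@inv_AA'K I C X Y D).
- exact: (@AA_AA'K I C X Y D).
- by [].
Qed.
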